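(* Let $(\mathcal X,Q,\pi)$ be an irreducible reversible finite Markov triple with a mapping representation $(G,c)$ that is commutative, i.e. $\delta\circ\eta=\eta\circ\delta$ for all $\delta,\eta\in G$. Put $q(x,\delta,\eta)=c(x,\delta)c(x,\eta)\pi(x)$ and, for $\eta\ne\delta,\delta^{-1}$, $$q_*(x,\delta,\eta)=\min\big\{q(x,\delta,\eta),\,q(\delta x,\delta^{-1},\eta),\,q(\eta x,\delta,\eta^{-1}),\,q(\delta\eta x,\delta^{-1},\eta^{-1})\big\}.$$ Assume that $$\lambda:=\min_{x\in\mathcal X,\ \delta\in G,\ c(x,\delta)>0}\left[c(x,\delta)-\mathbf 1_{\{\delta\neq\delta^{-1}\}}\,c(\delta x,\delta)-\sum_{\eta\in G:\ \eta\neq\delta,\delta^{-1}}\frac{(q-q_* )(\delta x,\delta^{-1},\eta)}{c(x,\delta)\pi(x)}\right]\ \geq\ 0.$$ Then $\mathrm{Ric}(\mathcal X,Q,\pi)\ge2\lambda$. Moreover, assume in addition that there are subsets $H_1,H_2$ of $G$ with $H_1\cap H_2=\emptyset$ and $H_i\cup H_i^{-1}=G$ for $i=1,2$ (where $H_i^{-1}=\{\delta^{-1}:\delta\in H_i\}$), and set $$\lambda_i:=\min_{x\in\mathcal X,\ \delta\in H_i,\ c(x,\delta)>0}\left[c(x,\delta)-\mathbf 1_{\{\delta\neq\delta^{-1}\}}\,c(\delta x,\delta)-\sum_{\eta\in G:\ \eta\neq\delta,\delta^{-1}}\frac{(q-q_* )(\delta x,\delta^{-1},\eta)}{c(x,\delta)\pi(x)}\right].$$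 Then also $\mathrm{Ric}(\mathcal X,Q,\pi)\ge\frac12(\lambda_1+\lambda_2)$.
   Context: Markov triple. $\mathcal X$ is a finite set, $Q:\mathcal X\times\mathcal X\to[0,\infty)$ are irreducible transition rates with $Q(x,x)=0$, reversible with respect to the strictly positive probability measure $\pi$: $Q(x,y)\pi(x)=Q(y,x)\pi(y)$. The generator is $L\psi(x)=\sum_yQ(x,y)(\psi(y)-\psi(x))$. Mapping representation. A pair $(G,c)$, where $G$ is a set of maps from $\mathcal X$ to itself and $c:\mathcal X\times G\to[0,\infty)$, is a mapping representation of $Q$ if: (1) $L\psi(x)=\sum_{\delta\in G}(\psi(\delta x)-\psi(x))c(x,\delta)$; (2) for every $\delta\in G$ there is a unique $\delta^{-1}\in G$ with $\delta^{-1}(\delta(x))=x$ for all $x$ with $c(x,\delta)>0$; (3) for every $F:\mathcal X\times G\to\mathbb R$, $\sum_{x,\delta}F(x,\delta)c(x,\delta)\pi(x)=\sum_{x,\delta}F(\delta x,\delta^{-1})c(x,\delta)\pi(x)$. In particular $c(x,\delta)\pi(x)=c(\delta x,\delta^{-1})\pi(\delta x)$. Entropic Ricci curvature. Let $\mathscr P(\mathcal X)=\{\rho\in[0,\infty)^{\mathcal X}:\sum_x\rho(x)\pi(x)=1\}$ and $\theta(s,t)=\int_0^1 s^\alpha t^{1-\alpha}\,d\alpha$. For $\rho_0,\rho_1\in\mathscr P(\mathcal X)$ define $$\mathcal W(\rho_0,\rho_1)^2=\inf_{\rho,\psi}\ \frac12\int_0^1\sum_{x,y\in\mathcal X}(\psi_t(x)-\psi_t(y))^2\,\theta(\rho_t(x),\rho_t(y))\,Q(x,y)\pi(x)\,dt,$$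 the infimum running over all sufficiently regular curves (say $\rho$ piecewise $C^1$, $\psi$ measurable) $\rho:[0,1]\to\mathscr P(\mathcal X)$, $\psi:[0,1]\to\mathbb R^{\mathcal X}$ with $\frac{d}{dt}\rho_t(x)+\sum_{y}(\psi_t(y)-\psi_t(x))\theta(\rho_t(x),\rho_t(y))Q(x,y)=0$ for all $x$, and with $\rho|_{t=0}=\rho_0$, $\rho|_{t=1}=\rho_1$. This is a distance. The entropy is $\mathcal H(\rho)=\sum_x\pi(x)\rho(x)\log\rho(x)$. A constant speed geodesic is a curve $(\rho_t)_{t\in[0,1]}$ in $\mathscr P(\mathcal X)$ with $\mathcal W(\rho_s,\rho_t)=|s-t|\mathcal W(\rho_0,\rho_1)$ for all $s,t$. One writes $\mathrm{Ric}(\mathcal X,Q,\pi)\ge\kappa$ if for every constant speed geodesic and all $t\in[0,1]$, $$\mathcal H(\rho_t)\le(1-t)\mathcal H(\rho_0)+t\mathcal H(\rho_1)-\frac\kappa2t(1-t)\mathcal W(\rho_0,\rho_1)^2.$$ *)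

(* Defs.v *)
From HB Require Import structures.
From mathcomp Require Import all_boot all_order all_algebra.
From mathcomp Require Import all_classical all_reals all_analysis.
Import Order.TTheory GRing.Theory Num.Theory.
Import numFieldNormedType.Exports.

Set Implicit Arguments.
Unset Strict Implicit.
Unset Printing Implicit Defensive.

Local Open Scope classical_set_scope.
Local Open Scope ring_scope.

Record markov_triple (R : realType) (X : finType)
    (Q : X -> X -> R) (pi : X -> R) : Prop := MarkovTriple {
  rate_ge0 : forall x y, 0 <= Q x y ;
  rate_diag : forall x, Q x x = 0 ;
  rate_irreducible : forall x y, connect (fun u v => 0 < Q u v) x y ;
  stationary_gt0 : forall x, 0 < pi x ;
  stationary_sum : \sum_x pi x = 1 ;
  detailed_balance : forall x y, Q x y * pi x = Q y x * pi y }.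

Definition generator (R : realType) (X : finType) (Q : X -> X -> R)
    (psi : X -> R) (x : X) : R :=
  \sum_y Q x y * (psi y - psi x).

(* Maps of X to itself are finite functions, so that a set of maps is a        *)
(* {set {ffun X -> X}}, and equality of maps is extensional and decidable.      *)

Definition is_move_inverse (R : realType) (X : finType)
    (c : X -> {ffun X -> X} -> R) (d e : {ffun X -> X}) : bool :=
  [forall x, (0 < c x d) ==> (e (d x) == x)].

(* The element d^{-1} of G, which is unique for a mapping representation; the  *)
(* default value d is never used in that case.                                 *)
Definition move_inv (R : realType) (X : finType) (G : {set {ffun X -> X}})
    (c : X -> {ffun X -> X} -> R) (d : {ffun X -> X}) : {ffun X -> X} :=
  odflt d [pick e in G | is_move_inverse c d e].

(* The values c x d with d outside G are irrelevant.                           *)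
Record mapping_representation (R : realType) (X : finType)
    (Q : X -> X -> R) (pi : X -> R) (G : {set {ffun X -> X}})
    (c : X -> {ffun X -> X} -> R) : Prop := MappingRepresentation {
  move_rate_ge0 : forall x d, d \in G -> 0 <= c x d ;
  move_generator : forall (psi : X -> R) x,
    generator Q psi x = \sum_(d in G) (psi (d x) - psi x) * c x d ;
  move_inverse : forall d, d \in G ->
    exists! e : {ffun X -> X}, e \in G /\ is_move_inverse c d e ;
  move_reversible : forall F : X -> {ffun X -> X} -> R,
    \sum_x \sum_(d in G) F x d * c x d * pi x
    = \sum_x \sum_(d in G) F (d x) (move_inv G c d) * c x d * pi x }.

Definition commutative_moves (X : finType) (G : {set {ffun X -> X}}) : Prop :=
  forall d e : {ffun X -> X}, d \in G -> e \in G -> d \o e =1 e \o d.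

Definition qrate (R : realType) (X : finType) (pi : X -> R)
    (c : X -> {ffun X -> X} -> R) (x : X) (d e : {ffun X -> X}) : R :=
  c x d * c x e * pi x.

Definition qrate_min (R : realType) (X : finType) (pi : X -> R)
    (G : {set {ffun X -> X}}) (c : X -> {ffun X -> X} -> R)
    (x : X) (d e : {ffun X -> X}) : R :=
  let q := qrate pi c in
  let inv := move_inv G c in
  Num.min (Num.min (q x d e) (q (d x) (inv d) e))
          (Num.min (q (e x) d (inv e)) (q (d (e x)) (inv d) (inv e))).

Definition local_curvature (R : realType) (X : finType) (pi : X -> R)
    (G : {set {ffun X -> X}}) (c : X -> {ffun X -> X} -> R)
    (x : X) (d : {ffun X -> X}) : R :=
  let inv := move_inv G c in
  c x d - (d != inv d)%:R * c (d x) d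
  - \sum_(e in G | (e != d) && (e != inv d))
      (qrate pi c (d x) (inv d) e - qrate_min pi G c (d x) (inv d) e)
      / (c x d * pi x).

(* The set below is finite, so that its infimum is a minimum as soon as it is  *)
(* nonempty.  For H = G (or H \cup H^{-1} = G) it can only be empty when X is  *)
(* a single point, in which case the value is inf set0 = 0.                    *)
Definition min_curvature (R : realType) (X : finType) (pi : X -> R)
    (G : {set {ffun X -> X}}) (c : X -> {ffun X -> X} -> R)
    (H : {set {ffun X -> X}}) : R :=
  inf [set k | exists x d,
    [/\ d \in H, 0 < c x d & k = local_curvature pi G c x d]].

Definition density (R : realType) (X : finType) (pi : X -> R)
    (rho : X -> R) : Prop :=
  (forall x, 0 <= rho x) /\ \sum_x rho x * pi x = 1.

(* Since 0 `^ a = 0 for a != 0, theta s 0 = theta 0 t = 0.                     *)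
Definition theta (R : realType) (s t : R) : R :=
  \int[lebesgue_measure]_(a in `[0, 1]) (s `^ a * t `^ (1 - a)).

(* C^1 on the closed interval [a, b]: f is continuous on [a, b] and continuously *)
(* differentiable on ]a, b[, with a derivative that has limits at a and b.     *)
Definition C1_itv (R : realType) (f : R -> R) (a b : R) : Prop :=
  [/\ derivable_oo_LRcontinuous f a b,
      {in `]a, b[, continuous (derive1 f)},
      cvg (derive1 f t @[t --> a^'+]) & cvg (derive1 f t @[t --> b^'-])].

(* Continuity on [0, 1] is included, as the pieces are closed intervals.       *)
Definition piecewise_C1 (R : realType) (f : R -> R) : Prop :=
  exists2 s : seq R, itv_partition 0 1 s &
    forall i, (i < size s)%N -> C1_itv f (nth 1 (0 :: s) i) (nth 1 s i).

(* Curves are functions on R of which only the values on [0, 1] matter.        *)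
Record admissible (R : realType) (X : finType) (Q : X -> X -> R) (pi : X -> R)
    (rho0 rho1 : X -> R) (rho psi : R -> X -> R) : Prop := Admissible {
  adm_density : forall t : R, t \in `[0, 1] -> density pi (rho t) ;
  adm_start : rho 0 = rho0 ;
  adm_end : rho 1 = rho1 ;
  adm_C1 : forall x, piecewise_C1 (fun t => rho t x) ;
  adm_measurable : forall x, measurable_fun (`[0, 1] : set R) (fun t : R => psi t x) ;
  adm_continuity : {ae lebesgue_measure, forall t : R, t \in `]0, 1[ ->
    forall x, derive1 (fun s => rho s x) t
      + \sum_y (psi t y - psi t x) * theta (rho t x) (rho t y) * Q x y = 0} }.

Definition action (R : realType) (X : finType) (Q : X -> X -> R) (pi : X -> R)
    (rho psi : R -> X -> R) : \bar R :=
  (2^-1%:E * \int[lebesgue_measure]_(t in `[0%R, 1%R])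
    (\sum_x \sum_y
      (psi t x - psi t y) ^+ 2 * theta (rho t x) (rho t y) * Q x y * pi x)%R%:E)%E.

(* The distance takes values in \bar R; its finiteness on densities is a       *)
(* property, not part of the definition.                                       *)
Definition Wdist (R : realType) (X : finType) (Q : X -> X -> R) (pi : X -> R)
    (rho0 rho1 : X -> R) : \bar R :=
  sqrte (ereal_inf [set A | exists rho psi,
    admissible Q pi rho0 rho1 rho psi /\ A = action Q pi rho psi]).

(* 0 * ln 0 = 0.                                                               *)
Definition entropy (R : realType) (X : finType) (pi rho : X -> R) : R :=
  \sum_x pi x * rho x * ln (rho x).

Definition constant_speed_geodesic (R : realType) (X : finType)
    (Q : X -> X -> R) (pi : X -> R) (rho : R -> X -> R) : Prop :=
  (forall t : R, t \in `[0, 1] -> density pi (rho t)) /\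
  (forall s t : R, s \in `[0, 1] -> t \in `[0, 1] ->
    Wdist Q pi (rho s) (rho t) = (`|s - t|%:E * Wdist Q pi (rho 0%R) (rho 1%R))%E).

Definition Ric_ge (R : realType) (X : finType) (Q : X -> X -> R) (pi : X -> R)
    (kappa : R) : Prop :=
  forall rho : R -> X -> R, constant_speed_geodesic Q pi rho ->
  forall t : R, t \in `[0, 1] ->
  ((entropy pi (rho t))%:E
    <= ((1 - t) * entropy pi (rho 0) + t * entropy pi (rho 1))%R%:E
       - (kappa / 2 * t * (1 - t))%R%:E * (Wdist Q pi (rho 0%R) (rho 1%R) ^+ 2))%E.

(* Main.v *)
(** The curvature bound is first an inequality for the Hessian of the entropy:
    with A(rho, psi) the metric form, commutativity writes the Hessian B(rho, psi)
    as a sum over x and two moves d, e; the part of q(x, d, e) carried by q_*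
    is invariant under the four reflections and contributes a nonnegative
    quantity, and the remainder is bounded below by twice the local curvature.
    This gives B(rho, psi) >= kappa A(rho, psi) for positive densities.

    Convexity of the entropy along geodesics then follows from an Eulerian
    argument.  Given a curve of positive densities (rho_s) of small action, the
    curve s |-> P_{h s} rho_s obtained with the heat semigroup P has a weighted
    action that is controlled by the action of (rho_s) and by the entropies at
    the end points; the derivative in h is exactly where the Hessian bound is
    used.  Reparametrising by the Moebius change of time that absorbs the
    weight (1 + kappa h s)^2 gains the factor 1 / (1 + kappa h).  For a
    geodesic (rho_t), apply this to nearly optimal curves from rho_0 and from
    rho_1 to rho_t, both ending at P_h rho_t: their concatenation cannot be
    shorter than W(rho_0, rho_1), and letting h -> 0 yields kappa-convexity.
    As densities may vanish, all curves are first mixed with the constant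
    density, at a cost that tends to 0. *)
Require Import Defs.
From HB Require Import structures.
From mathcomp Require Import all_boot all_order all_algebra.
From mathcomp Require Import ring lra.
From mathcomp Require Import all_classical all_reals all_analysis measurable_realfun.
Import Order.TTheory GRing.Theory Num.Theory.
Import numFieldNormedType.Exports.

Set Implicit Arguments.
Unset Strict Implicit.
Unset Printing Implicit Defensive.

Local Open Scope classical_set_scope.
Local Open Scope ring_scope.

(** * Calculus on intervals *)

(** A geodesic is given only as a metric curve: it comes with no regularity and no equation, and
    where a density vanishes neither [ln] nor the partial derivatives of [theta] are under control.
    So the entropy is never differentiated along the geodesic; only its end points and one
    intermediate point enter, and competing curves between them are built by hand. For the squared
    speed S(h, s) of the heat-deformed curve, the Hessian bound gives dS/dh <= - 2 dH/ds - 2 kappa s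
    S. The weight (1 + kappa h s)^2 has logarithmic h-derivative 2 kappa s / (1 + kappa h s), which
    is at most 2 kappa s because kappa >= 0. The factor 1 / (1 + kappa h) is the integral of the
    inverse weight over s in [0, 1], as Cauchy-Schwarz predicts. Three small parameters are removed
    one after the other: the mixing, with h fixed; then h, after a division by h; then the slack in
    the lower semicontinuity of the entropy at the intermediate density. *)

Section Calculus.
Variable R : realType.
Implicit Types (f F H : R -> R) (a b x l m k : R).

Lemma is_derive_continuous F l x : is_derive x (1:R) F l -> {for x, continuous F}.
Proof.
by move=> [dF _]; apply/differentiable_continuous/derivable1_diffP.
Qed.

Lemma continuous_itv_within f a b :
  (forall x, x \in `[a, b] -> {for x, continuous f}) ->
  {within `[a, b], continuous f}.
Proof.
by move=> cf; apply: continuous_in_subspaceT => x /set_mem xab; exact: cf.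
Qed.

Lemma is_derive_LRcontinuous F f a b : a < b ->
  (forall x, x \in `[a, b] -> is_derive x (1:R) F (f x)) ->
  derivable_oo_LRcontinuous F a b.
Proof.
move=> ab dF; split.
- by move=> x /subset_itv_oo_cc /dF[].
- by apply: cvg_at_right_filter; apply: is_derive_continuous (dF a _); rewrite in_itv/= lexx ltW.
- by apply: cvg_at_left_filter; apply: is_derive_continuous (dF b _); rewrite in_itv/= lexx ltW.
Qed.

Lemma FTC_itv F f a b : a < b ->
  (forall x, x \in `[a, b] -> is_derive x (1:R) F (f x)) ->
  (forall x, x \in `[a, b] -> {for x, continuous f}) ->
  (\int[lebesgue_measure]_(x in `[a, b]) (f x)%:E = (F b - F a)%:E)%E.
Proof.
move=> ab dF cf; rewrite EFinB; apply: continuous_FTC2 => //.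
- exact: continuous_itv_within.
- exact: is_derive_LRcontinuous dF.
- by move=> x /subset_itv_oo_cc /dF[? <-]; rewrite derive1E.
Qed.

Lemma integrable_itv f a b :
  (forall x, x \in `[a, b] -> {for x, continuous f}) ->
  lebesgue_measure.-integrable `[a, b] (EFin \o f).
Proof.
move=> cf; apply: continuous_compact_integrable; first exact: segment_compact.
exact: continuous_itv_within.
Qed.

(** Continuity of [f \o clamp a b] on the whole line is the form in which continuity of [f] on the
    closed interval, one-sided at the ends, is handled below. *)
Definition clamp a b x := Num.max a (Num.min x b).

Lemma clamp_itv a b x : a <= b -> clamp a b x \in `[a, b].
Proof.
by move=> ab; rewrite in_itv/= /clamp le_max lexx/= ge_max ab ge_min lexx orbT.
Qed.

Lemma clamp_id a b x : x \in `[a, b] -> clamp a b x = x.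
Proof.
by rewrite in_itv/= /clamp => /andP[ax xb]; rewrite min_l// max_r.
Qed.

Lemma continuous_clamp a b : continuous (clamp a b).
Proof.
move=> x; apply: (@continuous_max _ _ (fun=> a) (fun x => Num.min x b)).
  exact: cvg_cst.
by apply: (@continuous_min _ _ id (fun=> b)); [exact: cvg_id|exact: cvg_cst].
Qed.

Lemma primitive_itv f a b : a <= b ->
  (forall x, x \in `[a, b] -> {for x, continuous f}) ->
  exists F, forall x, x \in `[a, b] -> is_derive x (1:R) F (f x).
Proof.
move=> ab cf; pose g := f \o clamp a b.
have cg : continuous g.
  move=> x; apply: continuous_comp; first exact: continuous_clamp.
  by apply: cf; exact: clamp_itv.
(* Starting the integral at a - 1 puts a in the interior, so that the derivatives at the end points
   are two-sided. *)
exists (fun x => \int[lebesgue_measure]_(t in `[a - 1, x]) g t).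
move=> x xab; have /= := @continuous_FTC1_closed _ g (a - 1) x (x + 1).
rewrite ltrDl ltr01 => /(_ isT).
have ig : lebesgue_measure.-integrable `[a - 1, x + 1] (EFin \o g).
  by apply: integrable_itv => y _; exact: cg.
move=> /(_ ig); have ax : a - 1 < x.
  by move: xab; rewrite in_itv/= => /andP[+ _]; apply: lt_le_trans; rewrite gtrBl.
move=> /(_ ax (cg x))[dF F'].
by apply: DeriveDef => //; rewrite -derive1E F' /g/= clamp_id.
Qed.

Lemma derive_le0_itv F f a b : a <= b ->
  (forall x, x \in `[a, b] -> is_derive x (1:R) F (f x)) ->
  (forall x, x \in `]a, b[ -> f x <= 0) -> F b <= F a.
Proof.
rewrite le_eqVlt => /predU1P[->//|ab] dF f0.
have cF : {within `[a, b], continuous F}.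
  by apply: continuous_itv_within => x xab; exact: is_derive_continuous (dF x xab).
have dF' x : x \in `]a, b[ -> is_derive x (1:R) F (f x).
  by move=> xab; apply: dF; exact: subset_itv_oo_cc.
have [x xab] := @MVT _ F f a b ab dF' cF.
by rewrite -subr_le0 => ->; rewrite mulr_le0_ge0 ?f0// subr_ge0 ltW.
Qed.

Lemma derive_le_itv F f H h a b : a <= b ->
  (forall x, x \in `[a, b] -> is_derive x (1:R) F (f x)) ->
  (forall x, x \in `[a, b] -> is_derive x (1:R) H (h x)) ->
  (forall x, x \in `]a, b[ -> f x <= h x) -> F b - F a <= H b - H a.
Proof.
move=> ab dF dH fh.
have := @derive_le0_itv (F - H) (fun x => f x - h x) a b ab _ _.
rewrite !fctE => le0; rewrite lerBlDr.
suff : F b - H b <= F a - H a by lra.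
apply: le0 => x xab; first by have := dF x xab; have := dH x xab => ? ?; exact: is_deriveB.
by rewrite subr_le0 fh.
Qed.

Lemma is_derive_funD F H x l m : is_derive x (1:R) F l -> is_derive x (1:R) H m ->
  is_derive x (1:R) (fun y => F y + H y) (l + m).
Proof. by move=> dF dH; exact: is_deriveD. Qed.

Lemma is_derive_funN F x l : is_derive x (1:R) F l ->
  is_derive x (1:R) (fun y => - F y) (- l).
Proof. by move=> dF; exact: is_deriveN. Qed.

Lemma is_derive_funB F H x l m : is_derive x (1:R) F l -> is_derive x (1:R) H m ->
  is_derive x (1:R) (fun y => F y - H y) (l - m).
Proof. by move=> dF dH; exact: is_deriveB. Qed.

Lemma is_derive_funM F H x l m : is_derive x (1:R) F l -> is_derive x (1:R) H m ->
  is_derive x (1:R) (fun y => F y * H y) (l * H x + F x * m).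
Proof.
move=> dF dH; apply: (is_derive_eq (is_deriveM dF dH)).
by rewrite /GRing.scale/=; ring.
Qed.

Lemma is_derive_funZ k F x l : is_derive x (1:R) F l ->
  is_derive x (1:R) (fun y => k * F y) (k * l).
Proof. by move=> dF; exact: is_deriveZ. Qed.

Lemma is_derive_fun_sum (I : Type) (r : seq I) (P : pred I) (F : I -> R -> R) x (l : I -> R) :
  (forall i, is_derive x (1:R) (F i) (l i)) ->
  is_derive x (1:R) (fun y => \sum_(i <- r | P i) F i y) (\sum_(i <- r | P i) l i).
Proof.
move=> dF; elim: r => [|i r ih].
  by under eq_fun do rewrite big_nil; rewrite big_nil; exact: is_derive_cst.
under eq_fun do rewrite big_cons; rewrite big_cons.
by case: ifP => _ //; exact: is_derive_funD.
Qed.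

Lemma is_derive_fun_comp F H x l m : is_derive (H x) (1:R) F l -> is_derive x (1:R) H m ->
  is_derive x (1:R) (fun y => F (H y)) (m * l).
Proof.
move=> [dF Fl] [dH Hm]; have dFH : derivable (F \o H) x 1.
  have /derivable1_diffP d1 := dH; have /derivable1_diffP d2 := dF.
  by apply/derivable1_diffP; exact: differentiable_comp d1 d2.
apply: DeriveDef; first exact: dFH.
transitivity (derive1 (F \o H) x); first by rewrite derive1E.
by rewrite (derive1_comp dH dF) !derive1E Hm Fl mulrC.
Qed.

Lemma is_derive_near F H x l : (\forall y \near x, F y = H y) ->
  is_derive x (1:R) F l -> is_derive x (1:R) H l.
Proof. exact: near_eq_is_derive. Qed.

Lemma is_derive_quotient F x l :
  (fun h => h^-1 * (F (x + h) - F x)) @ 0^' --> l -> is_derive x (1:R) F l.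
Proof.
move=> h; have E : (fun h => h^-1 *: ((F \o shift x) (h *: (1:R)) - F x)) =
    (fun h => h^-1 * (F (x + h) - F x)).
  by apply/funext => y /=; rewrite /GRing.scale/= mulr1 [_ + x]addrC.
apply: DeriveDef; first by rewrite /derivable E; apply/cvg_ex; exists l.
by rewrite /derive E; apply: cvg_lim.
Qed.

Lemma is_derive_cvg_quotient F x l : is_derive x (1:R) F l ->
  (fun h => h^-1 * (F (x + h) - F x)) @ 0^' --> l.
Proof.
move=> [dF <-]; have E : (fun h => h^-1 *: ((F \o shift x) (h *: (1:R)) - F x)) =
    (fun h => h^-1 * (F (x + h) - F x)).
  by apply/funext => y /=; rewrite /GRing.scale/= mulr1 [_ + x]addrC.
by rewrite -E; exact: dF.
Qed.

Lemma cvg_fun_sum (T : Type) (FF : set_system T) (I : Type) (r : seq I) (P : pred I)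
    (F : I -> T -> R) (l : I -> R) : Filter FF ->
  (forall i, F i @ FF --> l i) ->
  (fun y => \sum_(i <- r | P i) F i y) @ FF --> \sum_(i <- r | P i) l i.
Proof.
move=> FFF cF; elim: r => [|i r ih].
  by under eq_fun do rewrite big_nil; rewrite big_nil; exact: cvg_cst.
under eq_fun do rewrite big_cons; rewrite big_cons.
by case: ifP => _ //; apply: cvgD.
Qed.

Lemma cvg_fun_prod (T : Type) (FF : set_system T) (I : Type) (r : seq I) (P : pred I)
    (F : I -> T -> R) (l : I -> R) : Filter FF ->
  (forall i, F i @ FF --> l i) ->
  (fun y => \prod_(i <- r | P i) F i y) @ FF --> \prod_(i <- r | P i) l i.
Proof.
move=> FFF cF; elim: r => [|i r ih].
  by under eq_fun do rewrite big_nil; rewrite big_nil; exact: cvg_cst.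
under eq_fun do rewrite big_cons; rewrite big_cons.
by case: ifP => _ //; apply: cvgM.
Qed.

Lemma cvg_shift_dnbhs (f : R -> R) x : {for x, continuous f} ->
  f (x + r) @[r --> 0^'] --> f x.
Proof.
move=> cf; have c0 : {for 0, continuous (fun r => f (x + r))}.
  apply: (@continuous_comp _ _ _ (fun r => x + r) f); last by rewrite /= addr0.
  by apply: cvgD; [exact: cvg_cst|exact: cvg_id].
suff : f (x + r) @[r --> 0^'] --> f (x + 0) by rewrite addr0.
by apply: cvg_trans c0; apply: cvg_app; exact: nbhs_dnbhs.
Qed.

Lemma cvg_fun_comp (T : Type) (FF : set_system T) (g : R -> R) (h : T -> R) l :
  Filter FF -> {for l, continuous g} -> h @ FF --> l ->
  (fun z => g (h z)) @ FF --> g l.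
Proof. by move=> FFF cg hl; exact: continuous_cvg. Qed.

End Calculus.

(** * Mapping representations *)

Section MappingRepresentation.
Variables (R : realType) (X : finType) (Q : X -> X -> R) (pi : X -> R).
Variables (G : {set {ffun X -> X}}) (c : X -> {ffun X -> X} -> R).
Hypothesis hQ : markov_triple Q pi.
Hypothesis hG : mapping_representation Q pi G c.

Local Notation inv := (move_inv G c).
Local Notation q := (qrate pi c).
Local Notation qs := (qrate_min pi G c).

Let pi_gt0 x : 0 < pi x. Proof. exact: stationary_gt0 hQ x. Qed.
Let c_ge0 x d : d \in G -> 0 <= c x d. Proof. exact: move_rate_ge0 hG x d. Qed.

Let c_le0 x d : d \in G -> ~~ (0 < c x d) -> c x d = 0.
Proof. by move=> dG; rewrite lt0r (c_ge0 x dG) andbT negbK => /eqP. Qed.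

Lemma move_invP d : d \in G -> inv d \in G /\ is_move_inverse c d (inv d).
Proof.
move=> dG; rewrite /move_inv; case: pickP => [e /andP[]//|no_e].
by have [e [[eG he] _]] := move_inverse hG dG; move: (no_e e); rewrite eG he.
Qed.

Lemma move_inv_in d : d \in G -> inv d \in G.
Proof. by case/move_invP. Qed.

Lemma move_invE d x : d \in G -> 0 < c x d -> inv d (d x) = x.
Proof. by move=> dG cx; have [_ /forallP/(_ x)/implyP/(_ cx)/eqP] := move_invP dG. Qed.

Lemma move_inv_uniq d e : d \in G -> e \in G ->
  (forall x, 0 < c x d -> e (d x) = x) -> inv d = e.
Proof.
move=> dG eG h; have [f [_ uf]] := move_inverse hG dG.
rewrite -(uf _ (move_invP dG)); apply: uf; split=> //.
by apply/forallP=> x; apply/implyP=> /h ->.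
Qed.

Lemma rate_move_rev z e : e \in G ->
  c z e * pi z = \sum_x \sum_(d in G | (d x == z) && (inv d == e)) c x d * pi x.
Proof.
(* Reversibility is tested on the indicator of the single edge (z, e). *)
move=> eG; pose F x (d : {ffun X -> X}) : R := ((x == z) && (d == e))%:R.
have := move_reversible hG F; rewrite (bigD1 z)//= (bigD1 e)//= /F !eqxx mul1r.
rewrite big1 ?addr0; last by move=> d /andP[_ /negbTE->]; rewrite !mul0r.
rewrite big1 ?addr0; last first.
  by move=> x /negbTE->; rewrite big1// => d _; rewrite !mul0r.
move=> ->; apply: eq_bigr => x _; rewrite [RHS]big_mkcondr/=.
by apply: eq_bigr => d _; case: ifP => _; rewrite ?mul1r ?mul0r.
Qed.

Lemma rate_move_rev_gt0 z e : e \in G -> 0 < c z e ->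
  exists x d, [/\ d \in G, 0 < c x d, d x = z & inv d = e].
Proof.
move=> eG ce; have : c z e * pi z != 0 by rewrite gt_eqF// mulr_gt0.
rewrite (rate_move_rev z eG) => nz.
have [x _ nx] : exists2 x, xpredT x &
    \sum_(d in G | (d x == z) && (inv d == e)) c x d * pi x != 0.
  by apply/exists_inP; apply: contraNT nz => /exists_inPn h; rewrite big1// => x _;
    apply/eqP; move: (h x isT); rewrite negbK.
have [d /and3P[dG /eqP dx /eqP de] nd] :
    exists2 d, (d \in G) && ((d x == z) && (inv d == e)) & c x d * pi x != 0.
  by apply/exists_inP; apply: contraNT nx => /exists_inPn h; rewrite big1// => d hd;
    apply/eqP; move: (h d hd); rewrite negbK.
exists x, d; split=> //; rewrite lt0r (c_ge0 x dG) andbT.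
by apply: contra_neqN nd => /eqP->; rewrite mul0r.
Qed.

Lemma move_inv_surj e : e \in G -> exists2 d, d \in G & inv d = e.
Proof.
move=> eG; case: (pselect (exists z, 0 < c z e)) => [[z cz]|nz].
  by have [x [d [dG _ _ de]]] := rate_move_rev_gt0 eG cz; exists d.
(* A move of zero rate everywhere is inverted vacuously by each element of G, hence, by uniqueness,
   it is its own inverse. *)
exists e => //; apply: move_inv_uniq => // x cx.
by exfalso; apply: nz; exists x.
Qed.

(** A surjection of a finite set onto itself is injective. *)
Lemma move_inv_inj : {in G &, injective inv}.
Proof.
apply/imset_injP; apply/eqP; congr (#|pred_of_set _|); apply/setP=> e.
apply/imsetP/idP => [[d dG ->]|/move_inv_surj[d dG <-]]; last by exists d.
exact: move_inv_in.
Qed.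

(** An edge out of z along [inv d] is the reversal of some edge (x, e) with e x = z and inv e = inv
    d. Injectivity gives e = d, so d undoes [inv d] at z. *)
Lemma move_invK d : d \in G -> inv (inv d) = d.
Proof.
move=> dG; have iG := move_inv_in dG.
apply: move_inv_uniq => // z cz.
have [x [e [eG ce <- /move_inv_inj ed]]] := rate_move_rev_gt0 iG cz.
by move: ce; rewrite (ed eG dG) => ce; rewrite move_invE.
Qed.

(** In [rate_move_rev] at (d x, inv d), injectivity leaves only the move d, and any y with d y = d x
    and positive rate is recovered by the inverse as x itself. *)
Lemma rate_move_inv d x : d \in G -> 0 < c x d ->
  c (d x) (inv d) * pi (d x) = c x d * pi x.
Proof.
move=> dG cx; rewrite rate_move_rev ?move_inv_in//.
rewrite (bigD1 x)//= [X in _ + X]big1 ?addr0 => [|y /eqP yx].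
  rewrite (bigD1 d)/= ?dG ?eqxx// big1 ?addr0// => e.
  move=> /andP[/and3P[eG _ /eqP /move_inv_inj h]].
  by rewrite h// eqxx.
rewrite big1// => e /and3P[eG /eqP ex /eqP /move_inv_inj h].
move: ex; rewrite h// => ex; have [cy|cy] := boolP (0 < c y d).
  by case: yx; rewrite -(move_invE dG cy) ex move_invE.
by rewrite (c_le0 dG cy) mul0r.
Qed.

(* The pairs (x, d) with c x d > 0 are the oriented edges; the map *)
(* (x, d) |-> (d x, d^{-1}) is an involution of them. *)
Definition edge_sum (F : X -> {ffun X -> X} -> R) : R :=
  \sum_x \sum_(d in G | 0 < c x d) F x d.

Lemma eq_edge_sum F F' :
  (forall x d, d \in G -> 0 < c x d -> F x d = F' x d) ->
  edge_sum F = edge_sum F'.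
Proof.
by move=> h; apply: eq_bigr => x _; apply: eq_bigr => d /andP[*]; exact: h.
Qed.

Lemma edge_sum_supp F :
  (forall x d, d \in G -> c x d = 0 -> F x d = 0) ->
  \sum_x \sum_(d in G) F x d = edge_sum F.
Proof.
move=> h; apply: eq_bigr => x _; rewrite [RHS]big_mkcondr.
apply: eq_bigr => d dG; case: ifPn => // /(c_le0 dG); exact: h.
Qed.

Lemma edge_sum_rev F : edge_sum F = edge_sum (fun x d => F (d x) (inv d)).
Proof.
(* [move_reversible] carries the factor c * pi, so F is divided by it; where c x d = 0 the summands
   vanish on both sides. *)
have := move_reversible hG (fun x d => F x d / (c x d * pi x)).
rewrite edge_sum_supp; last by move=> x d _ ->; rewrite !(mul0r,mulr0).
rewrite edge_sum_supp; last by move=> x d _ ->; rewrite !(mul0r,mulr0).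
rewrite (eq_edge_sum (F' := F)) => [->|x d dG cx]; last first.
  by rewrite -mulrA divfK// mulf_neq0// gt_eqF.
apply: eq_edge_sum => x d dG cx.
by rewrite rate_move_inv// -mulrA divfK// mulf_neq0// gt_eqF.
Qed.

Lemma edge_sumD F F' :
  edge_sum F + edge_sum F' = edge_sum (fun x d => F x d + F' x d).
Proof. by rewrite /edge_sum -big_split; apply: eq_bigr => x _; rewrite -big_split. Qed.

Lemma edge_sumZ k F : k * edge_sum F = edge_sum (fun x d => k * F x d).
Proof. by rewrite /edge_sum mulr_sumr; apply: eq_bigr => x _; rewrite mulr_sumr. Qed.

Lemma ler_edge_sum F F' :
  (forall x d, d \in G -> 0 < c x d -> F x d <= F' x d) ->
  edge_sum F <= edge_sum F'.
Proof.
by move=> h; apply: ler_sum => x _; apply: ler_sum => d /andP[*]; exact: h.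
Qed.

(** The generator identity of the representation, applied at x to the function F x, which vanishes
    at x. *)
Lemma edge_sum_rate (F : X -> X -> R) : (forall x, F x x = 0) ->
  \sum_x \sum_y F x y * Q x y * pi x =
  edge_sum (fun x d => F x (d x) * c x d * pi x).
Proof.
move=> F0; rewrite -edge_sum_supp; last by move=> x d _ ->; rewrite mulr0 mul0r.
apply: eq_bigr => x _; rewrite -!mulr_suml; congr (_ * _).
have := move_generator hG (F x) x; rewrite /generator F0 => h.
rewrite (eq_bigr (fun y => Q x y * (F x y - 0))) => [|y _]; last by ring.
by rewrite h; apply: eq_bigr => d _; ring.
Qed.

End MappingRepresentation.

(** * The logarithmic mean *)

Section LogarithmicMean.
Variable R : realType.
Implicit Types a b c d s t u x y e : R.
Local Notation mu := (@lebesgue_measure R).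

(** The partial derivative of [theta] in its first variable, with a s^(a - 1) written as a s^a / s.
    By symmetry the second partial is [dtheta t s]. That these are derivatives is deduced from
    concavity in [is_derive_theta]. *)
Definition dtheta s t : R :=
  s^-1 * \int[lebesgue_measure]_(a in `[0, 1]) (a * (s `^ a * t `^ (1 - a))).

Lemma continuous_integrable01 (f : R -> R) :
  continuous f -> mu.-integrable `[0, 1] (EFin \o f).
Proof.
move=> cf; apply: continuous_compact_integrable; first exact: segment_compact.
exact: continuous_subspaceT.
Qed.

Lemma powR_prodE s t a : 0 < s -> 0 < t ->
  s `^ a * t `^ (1 - a) = t * expR (a * (ln s - ln t)).
Proof.
move=> s0 t0; rewrite /powR !gt_eqF// -[in X in _ = X * _](lnK (x:=t))//.
by rewrite -!expRD; congr expR; ring.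
Qed.

Lemma continuous_expRM u : continuous (fun a : R => expR (a * u)).
Proof.
move=> a; apply: continuous_comp; last exact: continuous_expR.
by apply: cvgM; [exact: cvg_id|exact: cvg_cst].
Qed.

Lemma thetaE s t : 0 < s -> 0 < t ->
  theta s t = t * \int[mu]_(a in `[0, 1]) expR (a * (ln s - ln t)).
Proof.
move=> s0 t0; rewrite -RintegralZl//; last first.
  by apply: continuous_integrable01; exact: continuous_expRM.
by apply: eq_Rintegral => a _; rewrite powR_prodE.
Qed.

Lemma continuous_MexpRM u : continuous (fun a : R => a * expR (a * u)).
Proof.
by move=> a; apply: cvgM; [exact: cvg_id|exact: continuous_expRM].
Qed.

Lemma dthetaE s t : 0 < s -> 0 < t ->
  dtheta s t = s^-1 * (t * \int[mu]_(a in `[0, 1]) (a * expR (a * (ln s - ln t)))).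
Proof.
move=> s0 t0; rewrite -RintegralZl//; last first.
  by apply: continuous_integrable01; exact: continuous_MexpRM.
by congr (_ * _); apply: eq_Rintegral => a _; rewrite powR_prodE//; ring.
Qed.

Lemma Rintegral01_onem (f : R -> R) : continuous f ->
  \int[mu]_(a in `[0, 1]) f a = \int[mu]_(a in `[0, 1]) f (1 - a).
Proof.
move=> cf; rewrite Rintegration_by_substitution_onem ?ler01 ?lexx//; last first.
  exact: continuous_subspaceT.
by rewrite /unstable.onem subrr.
Qed.

Lemma continuous_powR_prod s t : 0 < s -> 0 < t ->
  continuous (fun a => s `^ a * t `^ (1 - a)).
Proof.
move=> s0 t0 a; under eq_fun do rewrite powR_prodE//.
by apply: cvgM; [exact: cvg_cst|exact: continuous_expRM].
Qed.

Lemma thetaC_gt0 s t : 0 < s -> 0 < t -> theta s t = theta t s.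
Proof.
move=> s0 t0; rewrite /theta.
have cf := continuous_powR_prod s0 t0.
rewrite (Rintegral01_onem cf); apply: eq_Rintegral => a _.
by rewrite mulrC; congr (_ `^ _ * _); ring.
Qed.

Lemma dtheta_sym s t : 0 < s -> 0 < t ->
  dtheta t s = t^-1 * \int[mu]_(a in `[0, 1]) ((1 - a) * (s `^ a * t `^ (1 - a))).
Proof.
move=> s0 t0; rewrite /dtheta; congr (_ * _).
have cf : continuous (fun a => a * (t `^ a * s `^ (1 - a))).
  move=> a; under eq_fun do rewrite powR_prodE//.
  apply: cvgM; first exact: cvg_id.
  by apply: cvgM; [exact: cvg_cst|exact: continuous_expRM].
rewrite (Rintegral01_onem cf); apply: eq_Rintegral => a _; congr (_ * _).
by rewrite mulrC; congr (_ `^ _ * _); ring.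
Qed.

Lemma integrable_theta s t : 0 < s -> 0 < t ->
  mu.-integrable `[0, 1] (EFin \o fun a => s `^ a * t `^ (1 - a)).
Proof.
by move=> s0 t0; apply: continuous_integrable01; exact: continuous_powR_prod.
Qed.

Lemma integrable_dtheta k s t : 0 < s -> 0 < t ->
  mu.-integrable `[0, 1] (EFin \o fun a => k * (a * (s `^ a * t `^ (1 - a)))).
Proof.
move=> s0 t0; apply: continuous_integrable01 => a.
apply: cvgM; first exact: cvg_cst.
by apply: cvgM; [exact: cvg_id|exact: continuous_powR_prod].
Qed.

Lemma integrable_dtheta_onem k s t : 0 < s -> 0 < t ->
  mu.-integrable `[0, 1] (EFin \o fun a => k * ((1 - a) * (s `^ a * t `^ (1 - a)))).
Proof.
move=> s0 t0; apply: continuous_integrable01 => a.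
apply: cvgM; first exact: cvg_cst.
apply: cvgM; last exact: continuous_powR_prod.
by apply: cvgB; [exact: cvg_cst|exact: cvg_id].
Qed.

Let integrable_dtheta1 s t : 0 < s -> 0 < t ->
  mu.-integrable `[0, 1] (EFin \o fun a => a * (s `^ a * t `^ (1 - a))).
Proof.
move=> s0 t0; have := integrable_dtheta 1 s0 t0.
by congr (_.-integrable _ (_ \o _)); apply/funext => a; rewrite mul1r.
Qed.

Let integrable_dtheta_onem1 s t : 0 < s -> 0 < t ->
  mu.-integrable `[0, 1] (EFin \o fun a => (1 - a) * (s `^ a * t `^ (1 - a))).
Proof.
move=> s0 t0; have := integrable_dtheta_onem 1 s0 t0.
by congr (_.-integrable _ (_ \o _)); apply/funext => a; rewrite mul1r.
Qed.

(** Euler's identity for a function homogeneous of degree one: the weights a and 1 - a of the two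
    partials add up to 1. *)
Lemma theta_euler s t : 0 < s -> 0 < t ->
  s * dtheta s t + t * dtheta t s = theta s t.
Proof.
move=> s0 t0; rewrite (dtheta_sym s0 t0) /dtheta !mulrA !divff ?gt_eqF// !mul1r.
rewrite -RintegralD//; first by apply: eq_Rintegral => a _; ring.
  exact: integrable_dtheta1.
exact: integrable_dtheta_onem1.
Qed.

Lemma theta_ge0 s t : 0 <= theta s t.
Proof. by apply: Rintegral_ge0 => a _; rewrite mulr_ge0// powR_ge0. Qed.

Lemma dtheta_ge0 s t : 0 < s -> 0 <= dtheta s t.
Proof.
move=> s0; apply: mulr_ge0; first by rewrite invr_ge0 ltW.
apply: Rintegral_ge0 => a.
by rewrite /= in_itv/= => /andP[a0 _]; rewrite !mulr_ge0// powR_ge0.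
Qed.

Lemma expR_convex a x y : 0 <= a <= 1 ->
  expR (a * x + (1 - a) * y) <= a * expR x + (1 - a) * expR y.
Proof.
move=> /andP[a0 a1]; set m := a * x + (1 - a) * y.
have h z : expR m * (1 + (z - m)) <= expR z.
  have -> : expR z = expR m * expR (z - m) by rewrite -expRD addrC subrK.
  by rewrite ler_wpM2l ?expR_ge0// expR_ge1Dx.
have := lerD (ler_wpM2l a0 (h x)) (ler_wpM2l (_ : 0 <= 1 - a) (h y)).
rewrite subr_ge0 => /(_ a1); apply: le_trans; rewrite le_eqVlt; apply/orP; left.
by apply/eqP; rewrite /m; ring.
Qed.

(** Concavity combined with homogeneity, by which the tangent plane at (a, b) passes through the
    origin. It is the weighted arithmetic-geometric inequality for c / a and d / b, integrated over
    the exponent. *)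
Lemma theta_tangent a b c d : 0 < a -> 0 < b -> 0 < c -> 0 < d ->
  theta c d <= dtheta a b * c + dtheta b a * d.
Proof.
move=> a0 b0 c0 d0; rewrite (dtheta_sym a0 b0) /dtheta.
rewrite mulrAC (mulrAC b^-1) -!RintegralZl//; last 2 first.
  exact: integrable_dtheta_onem1.
  exact: integrable_dtheta1.
rewrite -RintegralD//; last 2 first.
  exact: integrable_dtheta.
  exact: integrable_dtheta_onem.
apply: le_Rintegral => //; first exact: integrable_theta.
  under [X in _.-integrable _ X]eq_fun do rewrite /= EFinD.
  by apply: integrableD => //; [exact: integrable_dtheta|exact: integrable_dtheta_onem].
move=> x; rewrite /= in_itv/= => x01.
have -> : c `^ x * d `^ (1 - x) =
    (a `^ x * b `^ (1 - x)) * expR (x * ln (c / a) + (1 - x) * ln (d / b)).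
  rewrite /powR !gt_eqF// -!expRD !ln_div//; congr expR; ring.
have := expR_convex (ln (c / a)) (ln (d / b)) x01.
rewrite !lnK ?posrE ?divr_gt0// => /(ler_wpM2l (_ : 0 <= a `^ x * b `^ (1 - x))).
rewrite mulr_ge0 ?powR_ge0// => /(_ isT) /le_trans; apply.
by rewrite le_eqVlt; apply/orP; left; apply/eqP; field; rewrite !gt_eqF.
Qed.

End LogarithmicMean.

(** * Monotonicity, homogeneity and differentiability of the logarithmic mean *)

Section LogarithmicMean2.
Variable R : realType.
Implicit Types a b c d s t u x y e k : R.
Local Notation mu := (@lebesgue_measure R).

(** With u = ln s - ln t, [theta] is t times the integral of exp (a u), and u times that integral is
    exp u - 1. This identity is the source of the gradient flow structure in [generator_log]. *)
Lemma theta_log s t : 0 < s -> 0 < t -> theta s t * (ln s - ln t) = s - t.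
Proof.
move=> s0 t0; rewrite thetaE//; set u := ln s - ln t.
have dE a : is_derive a (1:R) (fun y => expR (y * u)) (u * expR (a * u)).
  apply: (@is_derive_fun_comp _ expR (fun y => y * u)).
  by apply: (is_derive_eq (is_derive_funM (is_derive_id _ _) (is_derive_cst _ _ _))) => /=;
    rewrite mul1r mulr0 addr0.
have /= := @FTC_itv R (fun y => expR (y * u)) (fun a => u * expR (a * u)) 0 1 ltr01
  (fun a _ => dE a) _.
rewrite mul0r mul1r expR0 => h.
rewrite -mulrA [X in _ * X]mulrC -RintegralZl//; last first.
  by apply: continuous_integrable01; exact: continuous_expRM.
rewrite /Rintegral h => [|a _]; last first.
  by apply: cvgM; [exact: cvg_cst|exact: continuous_expRM].
rewrite /= mulrBr /u expRB !lnK ?posrE// mulr1; field.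
by rewrite gt_eqF.
Qed.

Lemma theta_le s s' t t' : 0 <= s <= s' -> 0 <= t <= t' -> 0 < s' -> 0 < t' ->
  theta s t <= theta s' t'.
Proof.
move=> /andP[s0 ss] /andP[t0 tt] s'0 t'0.
have le a : 0 <= a <= 1 -> s `^ a * t `^ (1 - a) <= s' `^ a * t' `^ (1 - a).
  move=> /andP[a0 a1]; apply: ler_pM; rewrite ?powR_ge0//.
    by apply: ge0_ler_powR; rewrite ?nnegrE// ltW.
  by apply: ge0_ler_powR; rewrite ?nnegrE// ?subr_ge0// ltW.
apply: le_Rintegral => //.
  apply: le_integrable (integrable_theta s'0 t'0) => //.
    apply/measurable_EFinP/measurable_funTS; apply: measurable_funM.
      exact: measurable_powRr.
    apply: (measurableT_comp (measurable_powRr t)).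
    by apply: measurable_funB.
  move=> a; rewrite /= in_itv/= => /le h.
  by rewrite lee_fin !ger0_norm// mulr_ge0// powR_ge0.
exact: integrable_theta.
Qed.

Lemma theta_diag e : 0 < e -> theta e e = e.
Proof.
move=> e0; rewrite thetaE// subrr -[RHS]mulr1; congr (_ * _).
under eq_Rintegral do rewrite mulr0 expR0.
have := @FTC_itv R id (fun=> 1) 0 1 ltr01 (fun a _ => is_derive_id _ _) _.
by rewrite /Rintegral => -> //=; [rewrite subr0|move=> x _; exact: cvg_cst].
Qed.

Lemma theta_ge_min e s t : 0 < e -> e <= s -> e <= t -> e <= theta s t.
Proof.
move=> e0 es et; have s0 := lt_le_trans e0 es; have t0 := lt_le_trans e0 et.
have := @theta_le e s e t; rewrite theta_diag// es et (ltW e0); exact.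
Qed.

Lemma thetaZ k s t : 0 < k -> 0 <= s -> 0 <= t ->
  theta (k * s) (k * t) = k * theta s t.
Proof.
move=> k0 s0 t0; have E a : (k * s) `^ a * (k * t) `^ (1 - a) = k * (s `^ a * t `^ (1 - a)).
  rewrite !powRM// ?(ltW k0)// mulrACA -powRD; last first.
    by rewrite (gt_eqF k0) implybT.
  by rewrite addrC subrK powRr1// ltW.
transitivity (\int[mu]_(a in `[0, 1]) (k * (s `^ a * t `^ (1 - a)))).
  by apply: eq_Rintegral => a _; exact: E.
rewrite RintegralZl//.
apply: le_integrable (@integrable_theta R (s + 1) (t + 1) _ _) => //.
- apply/measurable_EFinP/measurable_funTS; apply: measurable_funM.
    exact: measurable_powRr.
  apply: (measurableT_comp (measurable_powRr t)).
  by apply: measurable_funB.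
- move=> a; rewrite /= in_itv/= => /andP[a0 a1].
  rewrite lee_fin !ger0_norm ?mulr_ge0 ?powR_ge0//.
  apply: ler_pM; rewrite ?powR_ge0//.
    by apply: ge0_ler_powR; rewrite ?nnegrE ?addr_ge0// lerDl.
  by apply: ge0_ler_powR; rewrite ?subr_ge0 ?nnegrE ?addr_ge0// lerDl.
- by rewrite ltr_wpDl.
- by rewrite ltr_wpDl.
Qed.

(** Homogeneity takes 1 - e inside and monotonicity absorbs the added e. As it covers s = 0 and t =
    0, curves through vanishing densities can be regularized by mixing. *)
Lemma theta_mix e s t : 0 < e <= 1 -> 0 <= s -> 0 <= t ->
  (1 - e) * theta s t <= theta ((1 - e) * s + e) ((1 - e) * t + e).
Proof.
move=> /andP[e0]; rewrite le_eqVlt => /predU1P[->|e1] s0 t0.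
  by rewrite subrr mul0r theta_ge0.
have e1' : 0 < 1 - e by rewrite subr_gt0.
rewrite -(thetaZ e1' s0 t0); apply: theta_le.
- by rewrite mulr_ge0// ?(ltW e1')// lerDl ltW.
- by rewrite mulr_ge0// ?(ltW e1')// lerDl ltW.
- by rewrite ltr_wpDl// mulr_ge0// ltW.
- by rewrite ltr_wpDl// mulr_ge0// ltW.
Qed.

Let phi u := \int[mu]_(a in `[0, 1]) (a * expR (a * u)).

Let continuous_phi : continuous phi.
Proof.
move=> u; apply: (@continuity_under_integral R _ _ mu
  (fun u a => a * expR (a * u)) `[0, 1] _ (u - 1) (u + 1) _ _
  (cst (expR (`|u| + 1))) _ _ u) => //.
- by move=> x _; apply: continuous_integrable01; exact: continuous_MexpRM.
- apply: aeW => a _ x _.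
  apply: cvgM; first exact: cvg_cst.
  apply: continuous_comp; last exact: continuous_expR.
  by apply: cvgM; [exact: cvg_cst|exact: cvg_id].
- by apply: continuous_integrable01 => x; exact: cvg_cst.
- move=> x /=; rewrite in_itv/= => /andP[x1 x2]; apply: aeW => a.
  rewrite /= in_itv/= => /andP[a0 a1].
  rewrite ger0_norm ?mulr_ge0 ?expR_ge0// -[leRHS]mul1r.
  apply: ler_pM; rewrite ?expR_ge0// ler_expR.
  apply: (@le_trans _ _ (a * (`|u| + 1))).
    rewrite ler_wpM2l//; apply: (le_trans (ltW x2)).
    by rewrite lerD2r ler_norm.
  by rewrite -[leRHS]mul1r ler_wpM2r// addr_ge0.
- by rewrite inE/= in_itv/=; apply/andP; split; rewrite ?ltrDl ?gtrBl.
Qed.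

Lemma cvg_dtheta (T : Type) (FF : set_system T) (f g : T -> R) a b : Filter FF ->
  0 < a -> 0 < b -> f @ FF --> a -> g @ FF --> b ->
  (fun z => dtheta (f z) (g z)) @ FF --> dtheta a b.
Proof.
move=> FFF a0 b0 fa gb; rewrite dthetaE// -/(phi _).
have E : {near FF, (fun z => (f z)^-1 * (g z * phi (ln (f z) - ln (g z)))) =1
    (fun z => dtheta (f z) (g z))}.
  near=> z; rewrite dthetaE//.
    by near: z; exact: cvgr_gt a0.
  by near: z; exact: cvgr_gt b0.
apply: cvg_trans; first exact: (near_eq_cvg E).
apply: cvgM; first by apply: cvgV => //; rewrite gt_eqF.
apply: cvgM => //.
have cl : (ln (f z) - ln (g z)) @[z --> FF] --> ln a - ln b.
  apply: cvgB; first exact: cvg_fun_comp (continuous_ln a0) fa.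
  exact: cvg_fun_comp (continuous_ln b0) gb.
have cphi : {for ln a - ln b, continuous phi} by exact: continuous_phi.
exact: cvg_fun_comp cphi cl.
Unshelve. all: by end_near. Qed.

Lemma cvg_theta (T : Type) (FF : set_system T) (f g : T -> R) a b : Filter FF ->
  0 < a -> 0 < b -> f @ FF --> a -> g @ FF --> b ->
  (fun z => theta (f z) (g z)) @ FF --> theta a b.
Proof.
move=> FFF a0 b0 fa gb; rewrite -theta_euler//.
have E : {near FF, (fun z => f z * dtheta (f z) (g z) + g z * dtheta (g z) (f z)) =1
    (fun z => theta (f z) (g z))}.
  near=> z; rewrite theta_euler//.
    by near: z; exact: cvgr_gt a0.
  by near: z; exact: cvgr_gt b0.
apply: cvg_trans; first exact: (near_eq_cvg E).
by apply: cvgD; apply: cvgM => //; exact: cvg_dtheta.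
Unshelve. all: by end_near. Qed.

Lemma theta_concave a b c d : 0 < a -> 0 < b -> 0 < c -> 0 < d ->
  theta c d - theta a b <= dtheta a b * (c - a) + dtheta b a * (d - b).
Proof.
move=> a0 b0 c0 d0; have := theta_tangent a0 b0 c0 d0.
rewrite -(theta_euler a0 b0).
by move: (theta c d) (dtheta a b) (dtheta b a) => T p q h; lra.
Qed.

(** By concavity the increment is squeezed between the tangents at the displaced point ([lo]) and at
    the base point ([up]). The two quotients have the same limit because [dtheta] is continuous. *)
Lemma is_derive_theta (f g : R -> R) x l m : 0 < f x -> 0 < g x ->
  is_derive x (1:R) f l -> is_derive x (1:R) g m ->
  is_derive x (1:R) (fun y => theta (f y) (g y))
    (dtheta (f x) (g x) * l + dtheta (g x) (f x) * m).
Proof.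
move=> f0 g0 df dg; apply: is_derive_quotient.
have cf := cvg_shift_dnbhs (is_derive_continuous df).
have cg := cvg_shift_dnbhs (is_derive_continuous dg).
have qf := is_derive_cvg_quotient df; have qg := is_derive_cvg_quotient dg.
pose lo h := dtheta (f (x + h)) (g (x + h)) * (h^-1 * (f (x + h) - f x))
  + dtheta (g (x + h)) (f (x + h)) * (h^-1 * (g (x + h) - g x)).
pose up h := dtheta (f x) (g x) * (h^-1 * (f (x + h) - f x))
  + dtheta (g x) (f x) * (h^-1 * (g (x + h) - g x)).
set L := (X in _ --> X).
have clo : lo h @[h --> 0^'] --> L.
  by apply: cvgD; apply: cvgM => //; exact: cvg_dtheta.
have cup : up h @[h --> 0^'] --> L.
  by apply: cvgD; apply: cvgM => //; exact: cvg_cst.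
(* For h < 0 the bounds [lo] and [up] change sides; adding and subtracting the distance between them
   squeezes for both signs at once. *)
have cd : `|lo h - up h| @[h --> 0^'] --> (0 : R).
  have c0 : (lo h - up h) @[h --> 0^'] --> L - L := cvgB clo cup.
  rewrite subrr in c0; by apply/norm_cvg0P; exact: c0.
have c1 : (up h - `|lo h - up h|) @[h --> 0^'] --> L.
  by rewrite -[X in _ --> X]subr0; exact: cvgB.
have c2 : (up h + `|lo h - up h|) @[h --> 0^'] --> L.
  by rewrite -[X in _ --> X]addr0; exact: cvgD.
apply: squeeze_cvgr c1 c2.
near=> h.
have h0 : h != 0 by near: h; exact: nbhs_dnbhs_neq.
have hK k z : h * (k * (h^-1 * z)) = k * z by rewrite mulrCA mulVKf.
have fh : 0 < f (x + h) by near: h; exact: cvgr_gt f0.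
have gh : 0 < g (x + h) by near: h; exact: cvgr_gt g0.
have hi : theta (f (x + h)) (g (x + h)) - theta (f x) (g x) <= h * up h.
  have -> : h * up h = dtheta (f x) (g x) * (f (x + h) - f x)
    + dtheta (g x) (f x) * (g (x + h) - g x).
    by rewrite /up mulrDr !hK.
  exact: theta_concave.
have hl : h * lo h <= theta (f (x + h)) (g (x + h)) - theta (f x) (g x).
  have -> : h * lo h = dtheta (f (x + h)) (g (x + h)) * (f (x + h) - f x)
    + dtheta (g (x + h)) (f (x + h)) * (g (x + h) - g x).
    by rewrite /lo mulrDr !hK.
  rewrite -[leRHS]opprB lerNr; apply: (le_trans (theta_concave fh gh f0 g0)).
  by rewrite opprD -!mulrN !opprB.
set D := theta (f (x + h)) (g (x + h)) - theta (f x) (g x) in hi hl *.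
clearbody D; move: (up h) (lo h) hi hl => U V hi hl.
rewrite -ler_distl -normrN opprB.
have h1 u : u - h^-1 * D = h^-1 * (h * u - D) by rewrite mulrBr mulKf.
rewrite h1.
have h2 u w : u - w = - (h^-1 * (h * w - h * u)) by rewrite -mulrBr mulKf// opprB.
rewrite (h2 V).
rewrite normrN !normrM ler_wpM2l// !ger0_norm ?subr_ge0 ?(le_trans hl hi)//.
by rewrite lerB.
Unshelve. all: by end_near. Qed.

End LogarithmicMean2.

(** * The Hessian of the entropy *)

Section StaticFunctionals.
Variables (R : realType) (X : finType) (Q : X -> X -> R) (pi : X -> R).

Definition metric_form (rho psi : X -> R) : R :=
  2^-1 * \sum_x \sum_y (psi x - psi y) ^+ 2 * theta (rho x) (rho y) * Q x y * pi x.

(** The sign is chosen so that the continuity equation of [admissible] reads rho' = onsager Q rho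
    psi. *)
Definition onsager (rho psi : X -> R) (x : X) : R :=
  \sum_y (psi x - psi y) * theta (rho x) (rho y) * Q x y.

Definition metric_form_deriv (rho v psi : X -> R) : R :=
  2^-1 * \sum_x \sum_y (psi x - psi y) ^+ 2 *
    (dtheta (rho x) (rho y) * v x + dtheta (rho y) (rho x) * v y) * Q x y * pi x.

(** Formally, the second derivative of the entropy along the geodesic from rho with momentum psi. *)
Definition hessian (rho psi : X -> R) : R :=
  2^-1 * metric_form_deriv rho (generator Q rho) psi
  - \sum_x generator Q psi x * onsager rho psi x * pi x.

End StaticFunctionals.

(** * Bounding the Hessian below by the local curvature *)

Section HessianBound.
Variables (R : realType) (X : finType) (Q : X -> X -> R) (pi : X -> R).
Variables (G : {set {ffun X -> X}}) (c : X -> {ffun X -> X} -> R).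
Hypothesis hQ : markov_triple Q pi.
Hypothesis hG : mapping_representation Q pi G c.
Hypothesis hcomm : commutative_moves G.

Local Notation inv := (move_inv G c).
Local Notation q := (qrate pi c).
Local Notation qs := (qrate_min pi G c).

Let pi_gt0 x : 0 < pi x. Proof. exact: stationary_gt0 hQ x. Qed.
Let c_ge0 x d : d \in G -> 0 <= c x d. Proof. exact: move_rate_ge0 hG x d. Qed.
Let inv_in d : d \in G -> inv d \in G. Proof. exact: (move_inv_in hG). Qed.
Let invK d : d \in G -> inv (inv d) = d. Proof. exact: (move_invK hQ hG). Qed.
Let comm d e x : d \in G -> e \in G -> d (e x) = e (d x).
Proof. by move=> dG eG; exact: (hcomm dG eG x). Qed.

Lemma qrate_ge0 x d e : d \in G -> e \in G -> 0 <= q x d e.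
Proof. by move=> dG eG; rewrite /qrate !mulr_ge0 ?c_ge0// ltW. Qed.

Lemma qrate_sym x d e : q x d e = q x e d.
Proof. by rewrite /qrate [c x d * _]mulrC. Qed.

Lemma qrate_min_ge0 x d e : d \in G -> e \in G -> 0 <= qs x d e.
Proof. by move=> dG eG; rewrite /qrate_min !le_min !qrate_ge0 ?inv_in. Qed.

Lemma qrate_min_le x d e : qs x d e <= q x d e.
Proof. by rewrite /qrate_min !ge_min lexx. Qed.

Lemma qrate_min_sym x d e : d \in G -> e \in G -> qs x d e = qs x e d.
Proof.
move=> dG eG; rewrite /qrate_min (qrate_sym x) [q (d x) _ _]qrate_sym.
rewrite [q (e x) _ _]qrate_sym (comm x dG eG) [q (e (d x)) _ _]qrate_sym.
by rewrite -!minA; congr Num.min; rewrite minCA.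
Qed.

(** By commutativity x, d x, e x, d (e x) are the corners of a square; reversing d exchanges the
    corners in pairs and so permutes the four terms of the minimum. *)
Lemma qrate_min_rev x d e : d \in G -> e \in G -> 0 < c x d ->
  qs (d x) (inv d) e = qs x d e.
Proof.
move=> dG eG cx; rewrite /qrate_min invK// (move_invE hG dG cx).
rewrite -(comm x dG eG) (_ : inv d (d (e x)) = e x); last first.
  by rewrite (comm x dG eG) comm ?inv_in// (move_invE hG dG cx).
by rewrite [X in Num.min X _]minC [X in Num.min _ X]minC.
Qed.

Definition offdiag d e := (e != d) && (e != inv d).

Lemma eq_move_inv_sym d e : d \in G -> e \in G -> (e == inv d) = (d == inv e).
Proof. by move=> dG eG; apply/eqP/eqP => ->; rewrite invK. Qed.

Lemma offdiag_sym d e : d \in G -> e \in G -> offdiag d e = offdiag e d.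
Proof. by move=> dG eG; rewrite /offdiag eq_sym eq_move_inv_sym. Qed.

Lemma offdiag_inv d e : d \in G -> offdiag (inv d) e = offdiag d e.
Proof. by move=> dG; rewrite /offdiag invK// andbC. Qed.

Definition triple_sum (w Y : X -> {ffun X -> X} -> {ffun X -> X} -> R) : R :=
  \sum_x \sum_(d in G) \sum_(e in G) w x d e * Y x d e.

Lemma triple_sum_swap w Y :
  triple_sum w Y = triple_sum (fun x d e => w x e d) (fun x d e => Y x e d).
Proof. by apply: eq_bigr => x _; exact: exchange_big. Qed.

Lemma eq_triple_sum w w' Y Y' :
  (forall x d e, d \in G -> e \in G -> w x d e * Y x d e = w' x d e * Y' x d e) ->
  triple_sum w Y = triple_sum w' Y'.
Proof.
by move=> h; apply: eq_bigr => x _; apply: eq_bigr => d dG; apply: eq_bigr => e eG; exact: h.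
Qed.

Lemma triple_sumD w Y Y' :
  triple_sum w Y + triple_sum w Y' = triple_sum w (fun x d e => Y x d e + Y' x d e).
Proof.
rewrite /triple_sum -big_split; apply: eq_bigr => x _; rewrite -big_split.
apply: eq_bigr => d _; rewrite -big_split; apply: eq_bigr => e _; exact/esym/mulrDr.
Qed.

Lemma triple_sumDw w w' Y :
  triple_sum w Y + triple_sum w' Y = triple_sum (fun x d e => w x d e + w' x d e) Y.
Proof.
rewrite /triple_sum -big_split; apply: eq_bigr => x _; rewrite -big_split.
apply: eq_bigr => d _; rewrite -big_split; apply: eq_bigr => e _; exact/esym/mulrDl.
Qed.

Lemma triple_sum_edge w Y :
  (forall x d e, d \in G -> e \in G -> c x d = 0 -> w x d e = 0) ->
  triple_sum w Y = edge_sum G c (fun x d => \sum_(e in G) w x d e * Y x d e).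
Proof.
move=> h; rewrite -(edge_sum_supp hG)// => x d dG cx.
by rewrite big1// => e eG; rewrite h// mul0r.
Qed.

Lemma qrate_eq0 x d e : c x d = 0 -> q x d e = 0.
Proof. by rewrite /qrate => ->; rewrite !mul0r. Qed.

Lemma qrate_min_eq0 x d e : d \in G -> e \in G -> c x d = 0 -> qs x d e = 0.
Proof.
move=> dG eG cx; apply/eqP; rewrite eq_le qrate_min_ge0// andbT.
by rewrite -(qrate_eq0 e cx) qrate_min_le.
Qed.

Definition square_weight x d e : R := (offdiag d e)%:R * qs x d e.

Lemma square_sum_rev Y : triple_sum square_weight Y =
  triple_sum square_weight (fun x d e => Y (d x) (inv d) e).
Proof.
have h0 x d e : d \in G -> e \in G -> c x d = 0 -> square_weight x d e = 0.
  by move=> dG eG cx; rewrite /square_weight qrate_min_eq0// mulr0.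
rewrite !triple_sum_edge// (edge_sum_rev hQ hG).
apply: eq_edge_sum => x d dG cx; apply: eq_bigr => e eG.
by rewrite /square_weight qrate_min_rev// offdiag_inv.
Qed.

Lemma square_sum_swap Y : triple_sum square_weight Y =
  triple_sum square_weight (fun x d e => Y x e d).
Proof.
rewrite triple_sum_swap; apply: eq_triple_sum => x d e dG eG.
by rewrite /square_weight qrate_min_sym// offdiag_sym.
Qed.

Lemma square_sum_rev2 Y : triple_sum square_weight Y =
  triple_sum square_weight (fun x d e => Y (e x) d (inv e)).
Proof. by rewrite square_sum_swap square_sum_rev square_sum_swap. Qed.

Variables (rho psi : X -> R).
Hypothesis rho_gt0 : forall x, 0 < rho x.

Let th x y := theta (rho x) (rho y).
Let th1 x y := dtheta (rho x) (rho y).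

Let thC x y : th x y = th y x. Proof. exact: thetaC_gt0. Qed.
Let th_euler x y : rho x * th1 x y + rho y * th1 y x = th x y.
Proof. exact: theta_euler. Qed.
Let th_tangent x y z w : th z w <= th1 x y * rho z + th1 y x * rho w.
Proof. exact: theta_tangent. Qed.
Let th_ge0 x y : 0 <= th x y. Proof. exact: theta_ge0. Qed.

Definition bochner x (d e : {ffun X -> X}) : R :=
  2^-1 * (psi (d x) - psi x) ^+ 2 * th1 x (d x) * (rho (e x) - rho x)
  + th x (d x) * (psi (d x) - psi x) * (psi (e x) - psi x).

(** Edge reversal turns the derivative of theta in its second argument into the one in its first,
    which doubles it and cancels one of the two factors 1/2. Both generators are then expanded over
    a second move e. *)
Lemma hessian_bochner : hessian Q pi rho psi = triple_sum q bochner.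
Proof.
rewrite /hessian /metric_form_deriv.
have -> : \sum_x \sum_y (psi x - psi y) ^+ 2 *
    (th1 x y * generator Q rho x + th1 y x * generator Q rho y) * Q x y * pi x =
  2 * edge_sum G c (fun x d => (psi (d x) - psi x) ^+ 2 * th1 x (d x) *
    generator Q rho x * c x d * pi x).
  rewrite (edge_sum_rate hG (F := fun x y => (psi x - psi y) ^+ 2 *
    (th1 x y * generator Q rho x + th1 y x * generator Q rho y))); last first.
    by move=> x; rewrite subrr expr0n mul0r.
  rewrite mulr2n mulrDl mul1r [X in _ = _ + X](edge_sum_rev hQ hG) edge_sumD.
  apply: eq_edge_sum => x d dG cx; rewrite (move_invE hG dG cx).
  rewrite -[_ * c (d x) _ * _]mulrA (rate_move_inv hQ hG dG cx).
  move: (psi x) (psi (d x)) (th1 _ _) (th1 _ _) (generator _ _ _) (generator _ _ _).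
  by move: (c x d) (pi x) => *; ring.
have -> : \sum_x generator Q psi x * onsager Q rho psi x * pi x =
  edge_sum G c (fun x d => - (th x (d x) * (psi (d x) - psi x) *
    generator Q psi x * c x d * pi x)).
  transitivity (\sum_x \sum_y
      (generator Q psi x * (psi x - psi y) * th x y) * Q x y * pi x).
    apply: eq_bigr => x _; rewrite /onsager -!mulr_suml mulr_sumr mulr_suml.
    by rewrite mulr_suml; apply: eq_bigr => y _; rewrite /th; ring.
  rewrite (edge_sum_rate hG (F := fun x y =>
    generator Q psi x * (psi x - psi y) * th x y)); last first.
    by move=> x; rewrite subrr mulr0 mul0r.
  by apply: eq_edge_sum => x d dG cx; ring.
rewrite triple_sum_edge; last by move=> x d e _ _; exact: qrate_eq0.
rewrite mulKf// !edge_sumZ -[- edge_sum _ _ _]mulN1r edge_sumZ edge_sumD.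
apply: eq_edge_sum => x d dG cx.
have E (f : X -> R) : generator Q f x = \sum_(e in G) (f (e x) - f x) * c x e.
  exact: (move_generator hG f x).
rewrite !E !(mulr_sumr, mulr_suml) -sumrN mulr_sumr -big_split.
apply: eq_bigr => e _; rewrite /bochner /qrate /=.
by move: (psi x) (psi (d x)) (psi (e x)) (rho x) (rho (e x)) (th1 _ _) (th _ _)
  (c x d) (c x e) (pi x) => *; ring.
Qed.

(** a, b, g, h are the densities and s0, s1, s2, s3 the potentials at x, d x, e x, d (e x); p, p'
    and r, r' are the partials of theta on the two parallel d-edges. The sum is half of two tangent
    gaps, weighted by squared increments, plus T1 + T2 times the square of the mixed second
    difference. *)
Let square_ineq (a b g h p p' r r' T1 T2 s0 s1 s2 s3 : R) :
  T1 = a * p + b * p' -> T2 = g * r + h * r' ->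
  T2 <= p * g + p' * h -> T1 <= r * a + r' * b -> 0 <= T1 -> 0 <= T2 ->
  0 <= (2^-1 * (s1 - s0) ^+ 2 * p * (g - a) + T1 * (s1 - s0) * (s2 - s0))
     + (2^-1 * (s0 - s1) ^+ 2 * p' * (h - b) + T1 * (s0 - s1) * (s3 - s1))
     + ((2^-1 * (s3 - s2) ^+ 2 * r * (a - g) + T2 * (s3 - s2) * (s0 - s2))
     + (2^-1 * (s2 - s3) ^+ 2 * r' * (b - h) + T2 * (s2 - s3) * (s1 - s3))).
Proof.
move=> E1 E2 h1 h2 t1 t2.
rewrite [leRHS](_ : _ = 2^-1 * ((s1 - s0) ^+ 2 * (p * g + p' * h - T2)
  + (s3 - s2) ^+ 2 * (r * a + r' * b - T1)
  + (T1 + T2) * (s3 - s2 - (s1 - s0)) ^+ 2)); last by rewrite E1 E2; field.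
by rewrite mulr_ge0// !addr_ge0// mulr_ge0 ?sqr_ge0 ?subr_ge0// addr_ge0.
Qed.

Lemma square_sum_ge0 : 0 <= triple_sum square_weight bochner.
Proof.
pose Y1 x (d e : {ffun X -> X}) := bochner (d x) (inv d) e.
pose Y2 x (d e : {ffun X -> X}) := bochner (e x) d (inv e).
pose Y3 x (d e : {ffun X -> X}) := bochner (d (e x)) (inv d) (inv e).
have e1 : triple_sum square_weight bochner = triple_sum square_weight Y1.
  exact: square_sum_rev.
have e2 : triple_sum square_weight bochner = triple_sum square_weight Y2.
  exact: square_sum_rev2.
have e3 : triple_sum square_weight bochner = triple_sum square_weight Y3.
  by rewrite e1 square_sum_rev2.
set T := triple_sum square_weight bochner in e1 e2 e3 *.
(* T is the average of its copies under the four reflections of the square, so only the sum over the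
   corners has to be nonnegative. *)
have -> : T = 4^-1 * ((T + triple_sum square_weight Y1)
    + (triple_sum square_weight Y2 + triple_sum square_weight Y3)).
  by rewrite -e1 -e2 -e3; field.
rewrite /T triple_sumD triple_sumD triple_sumD.
rewrite mulr_ge0//; apply: sumr_ge0 => x _; apply: sumr_ge0 => d dG.
apply: sumr_ge0 => e eG.
have [cd|/negP cd] := boolP (0 < c x d); last first.
  rewrite /square_weight qrate_min_eq0 ?mulr0 ?mul0r//.
  by apply/eqP; rewrite eq_le c_ge0// andbT leNgt; apply/negP.
have [ce|/negP ce] := boolP (0 < c x e); last first.
  rewrite /square_weight qrate_min_sym// qrate_min_eq0 ?mulr0 ?mul0r//.
  by apply/eqP; rewrite eq_le c_ge0// andbT leNgt; apply/negP.
apply: mulr_ge0; first by rewrite mulr_ge0// qrate_min_ge0.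
rewrite /Y1 /Y2 /Y3 /bochner (move_invE hG dG cd) (move_invE hG eG ce).
rewrite (_ : inv d (d (e x)) = e x); last first.
  by rewrite (comm x dG eG) comm ?inv_in// (move_invE hG dG cd).
rewrite (_ : inv e (d (e x)) = d x); last first.
  by rewrite comm ?inv_in// (move_invE hG eG ce).
rewrite -(comm x dG eG) (thC (d x) x) (thC (d (e x)) (e x)).
by apply: square_ineq; rewrite ?th_euler.
Qed.

(** a is the density at x, b and g those at d x and e x; D and E are the increments of psi. The
    mixed term (T1 + T0) D E is bounded by completing the square (D + E)^2, and what is left are
    again tangent gaps. *)
Let pair_ineq (a b g p p' r r' T1 T0 D E : R) :
  T0 <= p * g + p' * a -> T1 <= r * b + r' * a -> 0 <= T1 -> 0 <= T0 ->
  - (D ^+ 2 * (2^-1 * (T1 + a * (p + p')))) - (E ^+ 2 * (2^-1 * (T0 + a * (r + r'))))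
  <= (2^-1 * D ^+ 2 * p * (g - a) + T1 * D * E)
   + (2^-1 * E ^+ 2 * r * (b - a) + T0 * E * D).
Proof.
move=> h1 h2 t1 t0; rewrite -subr_ge0.
rewrite [leRHS](_ : _ = 2^-1 * (D ^+ 2 * (p * g + p' * a - T0)
  + E ^+ 2 * (r * b + r' * a - T1) + (T1 + T0) * (D + E) ^+ 2)); last by field.
by rewrite mulr_ge0// !addr_ge0// mulr_ge0 ?sqr_ge0 ?subr_ge0// addr_ge0.
Qed.

Let sq x (d : {ffun X -> X}) := (psi (d x) - psi x) ^+ 2.

(** The loss per edge in [pair_ineq] is half x (d x), the gain from the diagonal is half (d x) x;
    edge reversal makes the two comparable. *)
Let half x y : R := 2^-1 * (th x y + rho x * (th1 x y + th1 y x)).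

(** What remains of q away from e = d: the excess over q_* on genuine squares, and all of q for the
    pair of a move and its distinct inverse, whose square is degenerate. *)
Definition pair_weight x d e : R :=
  (offdiag d e)%:R * (q x d e - qs x d e)
  + ((e == inv d) && (d != inv d))%:R * q x d e.

Lemma pair_weight_ge0 x d e : d \in G -> e \in G -> 0 <= pair_weight x d e.
Proof.
by move=> dG eG; rewrite addr_ge0// mulr_ge0 ?qrate_ge0// subr_ge0 qrate_min_le.
Qed.

Lemma pair_weight_sym x d e : d \in G -> e \in G ->
  pair_weight x d e = pair_weight x e d.
Proof.
move=> dG eG; rewrite /pair_weight offdiag_sym// qrate_sym qrate_min_sym//.
rewrite eq_move_inv_sym//; congr (_ + _%:R * _).
by case: eqVneq => //= ->; rewrite invK// eq_sym.
Qed.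

Lemma pair_weight_eq0 x d e : d \in G -> e \in G -> c x d = 0 ->
  pair_weight x d e = 0.
Proof.
by move=> dG eG cx; rewrite /pair_weight qrate_eq0// qrate_min_eq0// subr0 !mulr0 addr0.
Qed.

Lemma pair_sum_ge : - triple_sum pair_weight (fun x d _ => sq x d * half x (d x))
  <= triple_sum pair_weight bochner.
Proof.
pose Y x d (e : {ffun X -> X}) := sq x d * half x (d x).
have sw Z : triple_sum pair_weight Z = triple_sum pair_weight (fun x d e => Z x e d).
  rewrite triple_sum_swap; apply: eq_triple_sum => x d e dG eG.
  by rewrite pair_weight_sym.
have -> : triple_sum pair_weight bochner = 2^-1 *
    (triple_sum pair_weight bochner + triple_sum pair_weight bochner) by field.
have -> : triple_sum pair_weight (fun x d _ => sq x d * half x (d x)) =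
  2^-1 * (triple_sum pair_weight Y + triple_sum pair_weight Y) by rewrite /Y; field.
rewrite {2}sw [X in _ <= _ * (_ + X)]sw -mulrN ler_wpM2l// !triple_sumD.
rewrite /triple_sum -sumrN; apply: ler_sum => x _.
rewrite -sumrN; apply: ler_sum => d dG; rewrite -sumrN; apply: ler_sum => e eG.
rewrite -mulrN ler_wpM2l ?pair_weight_ge0// /Y opprD.
apply: pair_ineq; rewrite ?th_ge0//.
  by rewrite thC; exact: th_tangent.
by rewrite thC; exact: th_tangent.
Qed.

Lemma triple_sum_diag : triple_sum (fun x d e => (e == d)%:R * q x d e) bochner =
  edge_sum G c (fun x d => c x d * pi x * (c x d * (sq x d * half (d x) x))).
Proof.
rewrite triple_sum_edge; last by move=> x d e dG eG cx; rewrite qrate_eq0// mulr0.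
apply: eq_edge_sum => x d dG cx; rewrite (bigD1 d)//= big1 ?addr0; last first.
  by move=> e /andP[_ /negbTE->]; rewrite !mul0r.
rewrite eqxx mul1r /bochner /half /qrate /sq thC -th_euler.
move: (psi x) (psi (d x)) (rho x) (rho (d x)) (th1 _ _) (th1 _ _) (c x d) (pi x).
by move=> *; field.
Qed.

(** q is the sum of [square_weight], [pair_weight] and its diagonal part. The squares are dropped as
    nonnegative; the loss of the pairs is subtracted from the diagonal gain, and the difference is
    exactly [local_curvature]. *)
Lemma hessian_ge : edge_sum G c (fun x d =>
    c x d * pi x * (local_curvature pi G c x d * (sq x d * half (d x) x)))
  <= hessian Q pi rho psi.
Proof.
have -> : hessian Q pi rho psi =
    triple_sum square_weight bochner + (triple_sum pair_weight bochner +
    triple_sum (fun x d e => (e == d)%:R * q x d e) bochner).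
  rewrite hessian_bochner !triple_sumDw; apply: eq_triple_sum => x d e dG eG.
  congr (_ * _); rewrite /square_weight /pair_weight /offdiag.
  have [->|ed] := eqVneq e d; first by rewrite andbN/= !mul0r !add0r mul1r.
  have [E|eid] := eqVneq e (inv d).
    by rewrite -E [d == e]eq_sym ed/= !mul0r mul1r !add0r addr0.
  by rewrite /= !mul1r !mul0r !addr0; ring.
rewrite triple_sum_diag; set P := triple_sum square_weight _.
apply: (@le_trans _ _ (0 + (- triple_sum pair_weight (fun x d _ => sq x d * half x (d x)) +
  edge_sum G c (fun x d => c x d * pi x * (c x d * (sq x d * half (d x) x)))))); last first.
  by rewrite lerD ?square_sum_ge0// lerD2r pair_sum_ge.
rewrite add0r triple_sum_edge; last by move=> x d e; exact: pair_weight_eq0.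
(* Reversal turns half x (d x) into half (d x) x and moves the weights to (d x, inv d), the place
   where [local_curvature] evaluates them. *)
rewrite [X in _ <= - X + _](edge_sum_rev hQ hG) -mulN1r edge_sumZ edge_sumD.
rewrite le_eqVlt; apply/orP; left; apply/eqP; apply: eq_edge_sum => x d dG cx.
rewrite (move_invE hG dG cx) -mulr_suml.
rewrite (_ : sq (d x) (inv d) = sq x d); last first.
  by rewrite /sq (move_invE hG dG cx) -sqrrN opprB.
rewrite (_ : \sum_(e in G) _ = c x d * pi x * (c x d - local_curvature pi G c x d)).
  move=> /=; move: (c x d) (pi x) (sq x d) (half _ _) (local_curvature _ _ _ _ _).
  by move=> *; ring.
rewrite /local_curvature /pair_weight big_split/=.
have cp : c x d * pi x != 0 by rewrite mulf_neq0// gt_eqF.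
have -> : \sum_(e in G) ((e == inv (inv d)) && (inv d != inv (inv d)))%:R * q (d x) (inv d) e
    = c x d * pi x * ((d != inv d)%:R * c (d x) d).
  rewrite invK// (bigD1 d)//= big1 ?addr0; last first.
    by move=> e /andP[_ /negbTE->]; rewrite mul0r.
  rewrite eqxx/= eq_sym /qrate -(rate_move_inv hQ hG dG cx).
  by move: (_%:R) (c _ _) (c _ _) (pi _) => *; ring.
have -> : \sum_(e in G) (offdiag (inv d) e)%:R * (q (d x) (inv d) e - qs (d x) (inv d) e) =
    c x d * pi x * \sum_(e in G | (e != d) && (e != inv d))
      (q (d x) (inv d) e - qs (d x) (inv d) e) / (c x d * pi x).
  rewrite mulr_sumr [RHS]big_mkcondr; apply: eq_bigr => e eG.
  rewrite offdiag_inv// /offdiag; case: ifP => _; rewrite ?mul0r// mul1r.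
  by rewrite mulrC divfK.
by rewrite -mulrDr; congr (_ * _); ring.
Qed.

End HessianBound.

(** * From the local curvature to the two global constants *)

Section CurvatureBound.
Variables (R : realType) (X : finType) (Q : X -> X -> R) (pi : X -> R).
Variables (G : {set {ffun X -> X}}) (c : X -> {ffun X -> X} -> R).
Hypothesis hQ : markov_triple Q pi.
Hypothesis hG : mapping_representation Q pi G c.
Hypothesis hcomm : commutative_moves G.

Local Notation inv := (move_inv G c).

Let pi_gt0 x : 0 < pi x. Proof. exact: stationary_gt0 hQ x. Qed.
Let c_ge0 x d : d \in G -> 0 <= c x d. Proof. exact: move_rate_ge0 hG x d. Qed.
Let invK d : d \in G -> inv (inv d) = d. Proof. exact: (move_invK hQ hG). Qed.

Lemma min_curvature_le (H : {set {ffun X -> X}}) x d : d \in H -> 0 < c x d ->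
  min_curvature pi G c H <= local_curvature pi G c x d.
Proof.
move=> dH cx; apply: ge_inf; last by exists x, d.
(* A crude lower bound of the set: there are only finitely many pairs of a point and a map. *)
exists (- \sum_x \sum_(d : {ffun X -> X}) `|local_curvature pi G c x d|).
move=> _ [y [e [_ _ ->]]]; rewrite lerNl.
rewrite (bigD1 y)//= (bigD1 e)//= -addrA.
apply: (le_trans (ler_norm _)); rewrite normrN lerDl addr_ge0//.
  by apply: sumr_ge0.
by apply: sumr_ge0 => z _; apply: sumr_ge0.
Qed.

Lemma min_curvature_ge0 (H : {set {ffun X -> X}}) :
  H \subset G -> 0 <= min_curvature pi G c G -> 0 <= min_curvature pi G c H.
Proof.
move=> /fintype.subsetP HG l0; rewrite /min_curvature.
(* If no move of H ever has positive rate, the value is 0 by the convention on the empty infimum. *)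
set S := (X in inf X); have [->|S0] := eqVneq S set0; first by rewrite inf0.
apply: lb_le_inf; first exact/set0P.
move=> _ [x [d [/HG dG cx ->]]]; exact: le_trans l0 (min_curvature_le dG cx).
Qed.

Variables (rho psi : X -> R).
Hypothesis rho_gt0 : forall x, 0 < rho x.

Let th x y := theta (rho x) (rho y).
Let th1 x y := dtheta (rho x) (rho y).
Let sq x (d : {ffun X -> X}) := (psi (d x) - psi x) ^+ 2.
Let half x y : R := 2^-1 * (th x y + rho x * (th1 x y + th1 y x)).
Let w x d : R := c x d * pi x * sq x d.

Let sq_rev x d : d \in G -> 0 < c x d -> sq (d x) (inv d) = sq x d.
Proof. by move=> dG cx; rewrite /sq (move_invE hG dG cx) -sqrrN opprB. Qed.

Let w_rev x d : d \in G -> 0 < c x d -> w (d x) (inv d) = w x d.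
Proof. by move=> dG cx; rewrite /w sq_rev// (rate_move_inv hQ hG dG cx). Qed.

Let w_ge0 x d : d \in G -> 0 <= w x d.
Proof.
move=> dG; apply: mulr_ge0; last exact: sqr_ge0.
by apply: mulr_ge0; [exact: c_ge0|exact/ltW].
Qed.

Lemma metric_form_edge :
  metric_form Q pi rho psi = 2^-1 * edge_sum G c (fun x d => w x d * th x (d x)).
Proof.
rewrite /metric_form (edge_sum_rate hG (F := fun x y =>
  (psi x - psi y) ^+ 2 * theta (rho x) (rho y))); last first.
  by move=> x; rewrite subrr expr0n mul0r.
congr (_ * _); apply: eq_edge_sum => x d dG cx; rewrite /w /sq -/(th x (d x)).
by move: (th _ _) (psi x) (psi (d x)) (c x d) (pi x) => *; ring.
Qed.

Let half_ge x y : 2^-1 * th x y <= half x y.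
Proof.
rewrite ler_wpM2l// lerDl; apply: mulr_ge0; first exact/ltW.
by apply: addr_ge0; exact: dtheta_ge0.
Qed.

(** The product (rho x + rho y) (th1 x y + th1 y x) contains one theta by Euler's identity and at
    least another one by the tangent inequality with exchanged arguments. *)
Let halfD_ge x y : 2 * th x y <= half x y + half y x.
Proof.
have h := theta_tangent (rho_gt0 x) (rho_gt0 y) (rho_gt0 y) (rho_gt0 x).
have e := theta_euler (rho_gt0 x) (rho_gt0 y).
rewrite -/(th y x) -/(th1 x y) -/(th1 y x) (_ : th y x = th x y) in h; last exact: thetaC_gt0.
rewrite -/(th x y) -/(th1 x y) -/(th1 y x) in e.
rewrite /half (_ : th y x = th x y); last exact: thetaC_gt0.
move: (th x y) (th1 x y) (th1 y x) (rho x) (rho y) h e => T p p' a b h e.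
by lra.
Qed.

(** Averaging over the two orientations of each edge allows the use of [halfD_ge]; [half_ge] alone
    would give only half of the constant. *)
Lemma hessian_ge_min_curvature : 0 <= min_curvature pi G c G ->
  2 * min_curvature pi G c G * metric_form Q pi rho psi <= hessian Q pi rho psi.
Proof.
move=> l0; apply: le_trans (hessian_ge hQ hG hcomm psi rho_gt0).
apply: (@le_trans _ _ (min_curvature pi G c G *
    edge_sum G c (fun x d => w x d * half (d x) x))); last first.
  rewrite edge_sumZ; apply: ler_edge_sum => x d dG cx.
  rewrite [leRHS](_ : _ = w x d * half (d x) x * local_curvature pi G c x d).
    rewrite mulrC ler_wpM2l ?min_curvature_le// mulr_ge0 ?w_ge0//.
    by apply: le_trans (half_ge _ _); rewrite mulr_ge0// theta_ge0.
  rewrite /w /half /sq; move: (local_curvature _ _ _ _ _) (2^-1 * _) (_ ^+ 2) => *.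
  by move: (c x d) (pi x) => *; ring.
rewrite metric_form_edge [2 * _]mulrC -mulrA mulVKf// ler_wpM2l//.
set S := edge_sum _ _ _; set S' := edge_sum _ _ _.
have -> : S' = 2^-1 * (S' + S') by field.
rewrite {1}/S' (edge_sum_rev hQ hG) edge_sumD edge_sumZ; apply: ler_edge_sum => x d dG cx.
rewrite w_rev// (move_invE hG dG cx) -mulrDr mulrCA ler_wpM2l ?w_ge0//.
by rewrite ler_pdivlMl//; exact: halfD_ge.
Qed.

(** The assumptions make G the disjoint union of H1 and H2, exchanged by inversion, so each edge
    sees l1 in one orientation and l2 in the other. With different constants on the two orientations
    only the one-sided bound [half_ge] applies, whence the factor 1/2. *)
Lemma hessian_ge_min_curvature2 (H1 H2 : {set {ffun X -> X}}) :
  0 <= min_curvature pi G c G -> H1 \subset G -> H2 \subset G ->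
  H1 :&: H2 = finset.set0 ->
  H1 :|: [set inv d | d in H1]%SET = G ->
  H2 :|: [set inv d | d in H2]%SET = G ->
  2^-1 * (min_curvature pi G c H1 + min_curvature pi G c H2) *
    metric_form Q pi rho psi <= hessian Q pi rho psi.
Proof.
move=> l0 H1G H2G H12 E1 E2; apply: le_trans (hessian_ge hQ hG hcomm psi rho_gt0).
have G1 := fintype.subsetP H1G; have G2 := fintype.subsetP H2G.
have N12 d : d \in H1 -> d \in H2 -> False.
  by move=> d1 d2; have := finset.in_set0 d; rewrite -H12 inE d1 d2.
have A1 d : d \in H1 -> inv d \in H2.
  move=> d1; have := G1 _ d1; rewrite -{1}E2 => /finset.setUP[/(N12 _ d1)//|].
  by case/imsetP => f f2 ->; rewrite invK// G2.
have A2 d : d \in G -> d \notin H1 -> d \in H2 /\ inv d \in H1.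
  rewrite -{1}E1 => /finset.setUP[->//|/imsetP[e e1 ->]] _.
  by rewrite invK ?G1//; split=> //; exact: A1.
set l1 := min_curvature pi G c H1; set l2 := min_curvature pi G c H2.
have l10 : 0 <= l1 by exact: min_curvature_ge0.
have l20 : 0 <= l2 by exact: min_curvature_ge0.
pose l d := if d \in H1 then l1 else l2.
have l_ge0 d : 0 <= l d by rewrite /l; case: ifP.
have lD d : d \in G -> l d + l (inv d) = l1 + l2.
  move=> dG; rewrite /l; case: (boolP (d \in H1)) => d1.
    by rewrite ifN//; apply/negP => /N12; apply; exact: A1.
  by have [_ ->] := A2 _ dG d1; rewrite addrC.
apply: (@le_trans _ _ (2^-1 * edge_sum G c (fun x d => w x d * th x (d x) * l d))); last first.
  rewrite edge_sumZ; apply: ler_edge_sum => x d dG cx.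
  rewrite [leRHS](_ : _ = w x d * half (d x) x * local_curvature pi G c x d); last first.
    rewrite /w /half /sq; move: (local_curvature _ _ _ _ _) (2^-1 * _) (_ ^+ 2) => *.
    by move: (c x d) (pi x) => *; ring.
  rewrite mulrA; apply: ler_pM => //.
  - by rewrite mulr_ge0// mulr_ge0 ?w_ge0 ?theta_ge0.
  - rewrite mulrCA; apply: ler_wpM2l; first exact: w_ge0.
    have -> : th x (d x) = th (d x) x by exact: thetaC_gt0.
    exact: half_ge.
  - rewrite /l; case: ifPn => d1; first exact: min_curvature_le.
    by apply: min_curvature_le => //; have [] := A2 _ dG d1.
rewrite metric_form_edge; set S := edge_sum _ _ _; set S' := edge_sum _ _ _.
have -> : S' = 2^-1 * (S' + S') by field.
rewrite {1}/S' (edge_sum_rev hQ hG) edge_sumD.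
rewrite (eq_edge_sum (F' := fun x d => (l1 + l2) * (w x d * th x (d x)))).
  by rewrite -edge_sumZ -/S le_eqVlt; apply/orP; left; apply/eqP; field.
move=> x d dG cx; rewrite w_rev// (move_invE hG dG cx).
rewrite (_ : th (d x) x = th x (d x)); last exact: thetaC_gt0.
by rewrite -mulrDr [l _ + _]addrC lD// mulrC.
Qed.

End CurvatureBound.

(** * The Onsager operator and the speed of curves *)

Section ThetaSym.
Variable R : realType.
Implicit Types s t : R.

Lemma measurable_powR_prod s t :
  measurable_fun [set: R] (fun a => s `^ a * t `^ (1 - a)).
Proof.
apply: measurable_funM; first exact: measurable_powRr.
by apply: (measurableT_comp (measurable_powRr t)); apply: measurable_funB.
Qed.

Lemma theta0l t : theta 0 t = 0.
Proof.
(* At exponent a = 0 the integrand equals t, because 0 to the power 0 is 1; this null end point is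
   removed first. *)
rewrite /theta /Rintegral -integral_itv_obnd_cbnd; last first.
  apply/measurable_EFinP.
  exact: (measurable_funS measurableT (subsetT _) (measurable_powR_prod 0 t)).
rewrite (eq_integral (cst 0%E)) ?integral0// => a; rewrite inE/= in_itv/= => /andP[a0 _].
by rewrite powR0 ?mul0r// gt_eqF.
Qed.

Lemma theta0r s : theta s 0 = 0.
Proof.
rewrite /theta /Rintegral -integral_itv_bndo_bndc; last first.
  apply/measurable_EFinP.
  exact: (measurable_funS measurableT (subsetT _) (measurable_powR_prod s 0)).
rewrite (eq_integral (cst 0%E)) ?integral0// => a; rewrite inE/= in_itv/= => /andP[_ a1].
by rewrite (@powR0 _ (1 - a)) ?mulr0// subr_eq0 gt_eqF.
Qed.

Lemma thetaC s t : 0 <= s -> 0 <= t -> theta s t = theta t s.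
Proof.
rewrite le_eqVlt => /predU1P[<- _|s0]; first by rewrite theta0l theta0r.
rewrite le_eqVlt => /predU1P[<-|t0]; first by rewrite theta0l theta0r.
exact: thetaC_gt0.
Qed.

End ThetaSym.

Section MatrixLimits.
Variables (R : realType) (T : Type) (FF : set_system T).
Hypothesis FFF : Filter FF.

Lemma cvg_det n (A : T -> 'M[R]_n) (B : 'M[R]_n) :
  (forall i j, (fun t => A t i j) @ FF --> B i j) ->
  (fun t => \det (A t)) @ FF --> \det B.
Proof.
move=> AB; apply: cvg_fun_sum => s; apply: cvgM; first exact: cvg_cst.
by apply: cvg_fun_prod => i; exact: AB.
Qed.

(** Cramer's rule writes the entries of the inverse as quotients of determinants, which are
    polynomials in the entries. *)
Lemma cvg_invmx n (A : T -> 'M[R]_n) (B : 'M[R]_n) : B \in unitmx ->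
  (forall i j, (fun t => A t i j) @ FF --> B i j) ->
  forall i j, (fun t => invmx (A t) i j) @ FF --> invmx B i j.
Proof.
move=> uB AB i j; have dB : \det B != 0 by move: uB; rewrite unitmxE unitfE.
have cd := cvg_det AB.
have uA : \forall t \near FF, A t \in unitmx.
  have : \forall t \near FF, \det (A t) != 0 by exact: cvgr_neq0 cd dB.
  by apply: filterS => t; rewrite unitmxE unitfE.
have E : {near FF, (fun t => (\det (A t))^-1 * \adj (A t) i j) =1
    (fun t => invmx (A t) i j)}.
  by apply: filterS uA => t uA; rewrite /invmx uA !mxE.
apply: cvg_trans; first exact: (near_eq_cvg E).
rewrite /invmx uB mxE; apply: cvgM; first exact: cvgV.
have adjE (C : 'M[R]_n) : \adj C i j = cofactor C j i by rewrite mxE.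
rewrite adjE; under eq_fun do rewrite adjE.
rewrite /cofactor; apply: cvgM; first exact: cvg_cst.
apply: cvg_det => k l; rewrite !mxE; under eq_fun do rewrite !mxE.
exact: AB.
Qed.

End MatrixLimits.

Section Speed.
Variables (R : realType) (X : finType) (Q : X -> X -> R) (pi : X -> R).
Hypothesis hQ : markov_triple Q pi.
Implicit Types rho v psi phi : X -> R.

Local Notation K := (onsager Q).
Local Notation form := (metric_form Q pi).
Notation dot f g := (\sum_x f x * g x * pi x).

Let pi_gt0 x : 0 < pi x. Proof. exact: stationary_gt0 hQ x. Qed.
Let Q_ge0 x y : 0 <= Q x y. Proof. exact: rate_ge0 hQ x y. Qed.
Let Qpi x y : Q x y * pi x = Q y x * pi y. Proof. exact: detailed_balance hQ x y. Qed.

Lemma onsager_dot rho phi psi : (forall x, 0 <= rho x) ->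
  dot phi (K rho psi) = 2^-1 * \sum_x \sum_y
    (phi x - phi y) * (psi x - psi y) * theta (rho x) (rho y) * (Q x y * pi x).
Proof.
move=> rho0; pose S := \sum_x \sum_y
  phi x * (psi x - psi y) * theta (rho x) (rho y) * (Q x y * pi x).
have E1 : dot phi (K rho psi) = S.
  apply: eq_bigr => x _; rewrite /onsager mulr_sumr mulr_suml.
  apply: eq_bigr => y _; move: (theta _ _) => t; ring.
have E2 : S = \sum_x \sum_y
    - (phi y * (psi x - psi y) * theta (rho x) (rho y) * (Q x y * pi x)).
  rewrite /S exchange_big; apply: eq_bigr => x _; apply: eq_bigr => y _.
  by rewrite (thetaC (rho0 y) (rho0 x)) Qpi; move: (theta _ _) => t; ring.
have -> : \sum_x \sum_y
    (phi x - phi y) * (psi x - psi y) * theta (rho x) (rho y) * (Q x y * pi x) = S + S.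
  rewrite [X in _ = _ + X]E2 /S -big_split; apply: eq_bigr => x _.
  rewrite -big_split; apply: eq_bigr => y _ /=; move: (theta _ _) => t; ring.
by rewrite E1; field.
Qed.

Lemma metric_form_dot rho psi : (forall x, 0 <= rho x) ->
  form rho psi = dot psi (K rho psi).
Proof.
move=> rho0; rewrite onsager_dot//; congr (_ * _).
by do 2! (apply: eq_bigr => ? _); rewrite expr2 [RHS]mulrA.
Qed.

Lemma onsager_sym rho phi psi : (forall x, 0 <= rho x) ->
  dot phi (K rho psi) = dot psi (K rho phi).
Proof.
move=> rho0; rewrite !onsager_dot//; congr (_ * _).
by do 2! (apply: eq_bigr => ? _); congr (_ * _ * _); exact: mulrC.
Qed.

Lemma onsager_mass rho psi : (forall x, 0 <= rho x) ->
  \sum_x K rho psi x * pi x = 0.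
Proof.
move=> rho0; have := @onsager_dot rho (fun=> 1) psi rho0.
under eq_bigr do rewrite mul1r.
move=> ->; rewrite big1 ?mulr0// => x _; rewrite big1// => y _.
by rewrite subrr !mul0r.
Qed.

Lemma metric_form_ge0 rho psi : 0 <= form rho psi.
Proof.
rewrite mulr_ge0//; apply: sumr_ge0 => x _; apply: sumr_ge0 => y _.
by rewrite mulr_ge0 ?(ltW (pi_gt0 x))// mulr_ge0// mulr_ge0 ?sqr_ge0 ?theta_ge0.
Qed.

Lemma onsagerB rho phi psi x :
  K rho (fun y => phi y - psi y) x = K rho phi x - K rho psi x.
Proof.
rewrite /onsager -sumrB; apply: eq_bigr => y _; move: (theta _ _) => t; ring.
Qed.

(** psi agrees at the ends of each edge with Q x y > 0, where theta is positive, and irreducibility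
    connects all points. *)
Lemma metric_form_eq0 rho psi : (forall x, 0 < rho x) -> form rho psi = 0 ->
  forall x y, psi x = psi y.
Proof.
move=> rho0 f0.
have edge x y : 0 < Q x y -> psi x = psi y.
  move=> Qxy; move/eqP: f0; rewrite mulf_eq0 invr_eq0 pnatr_eq0/=.
  have ge0 u w : 0 <= (psi u - psi w) ^+ 2 * theta (rho u) (rho w) * Q u w * pi u.
    by rewrite mulr_ge0 ?(ltW (pi_gt0 u))// mulr_ge0// mulr_ge0 ?sqr_ge0 ?theta_ge0.
  rewrite psumr_eq0 => [/allP/(_ x (mem_index_enum _))|u _]; last exact: sumr_ge0.
  rewrite psumr_eq0// => /allP/(_ y (mem_index_enum _)).
  rewrite /= !mulf_eq0 (gt_eqF Qxy) (gt_eqF (pi_gt0 x)) !orbF orbb subr_eq0.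
  case/orP => /eqP// t0; exfalso.
  have m0 : 0 < Num.min (rho x) (rho y) by rewrite lt_min !rho0.
  have mx : Num.min (rho x) (rho y) <= rho x by rewrite ge_min lexx.
  have my : Num.min (rho x) (rho y) <= rho y by rewrite ge_min lexx orbT.
  by have := theta_ge_min m0 mx my; rewrite t0 leNgt m0.
move=> x y; have /connectP[p pp ->] := rate_irreducible hQ x y.
elim: p x pp => //= z p ih x /andP[/edge -> /ih ->//].
Qed.

(** The matrix of psi |-> K psi + (mean of psi). The rank-one mean removes the constants from the
    kernel of K, without affecting the equation K psi = v for v of mean zero. *)
Definition onsager_matrix rho : 'M[R]_#|X| := \matrix_(i, j)
  ((i == j)%:R * (\sum_z theta (rho (enum_val i)) (rho z) * Q (enum_val i) z)
   - theta (rho (enum_val i)) (rho (enum_val j)) * Q (enum_val i) (enum_val j)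
   + pi (enum_val j)).

Definition onsager_inv rho v x : R :=
  \sum_y invmx (onsager_matrix rho) (enum_rank x) (enum_rank y) * v y.

(** The squared metric norm of the tangent vector v at rho, obtained by inverting K. *)
Definition speed rho v : R := dot v (onsager_inv rho v).

Let sum_enum (F : X -> R) : \sum_x F x = \sum_(i < #|X|) F (enum_val i).
Proof.
rewrite (reindex (@enum_val X predT))/=; last first.
  by exists enum_rank => x _; rewrite ?enum_valK ?enum_rankK.
by apply: eq_bigl => i.
Qed.

Lemma onsager_matrixE rho psi i :
  \sum_j onsager_matrix rho i j * psi (enum_val j)
  = K rho psi (enum_val i) + \sum_x psi x * pi x.
Proof.
rewrite /onsager !sum_enum -big_split /=.
under eq_bigr do rewrite mxE mulrDl mulrBl.
rewrite big_split sumrB/= (bigD1 i)//= eqxx mul1r [X in _ + X - _]big1 ?addr0; last first.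
  by move=> j /negbTE; rewrite eq_sym => ->; rewrite !mul0r.
rewrite sum_enum mulr_suml -sumrB -big_split; apply: eq_bigr => j _ /=.
by move: (theta _ _) => t; ring.
Qed.

Lemma onsager_matrix_unit rho : (forall x, 0 < rho x) ->
  onsager_matrix rho \in unitmx.
Proof.
move=> rho0; rewrite unitmxE unitfE -det_tr; apply/negP => /det0P[w w0 wM].
pose psi x := w 0 (enum_rank x).
have psiK j : psi (enum_val j) = w 0 j by rewrite /psi enum_valK.
have M0 (i : 'I_#|X|) : K rho psi (enum_val i) + \sum_x psi x * pi x = 0.
  rewrite -onsager_matrixE; have /rowP/(_ i) := wM; rewrite mxE [RHS]mxE => h.
  by rewrite -[RHS]h; apply: eq_bigr => j _; rewrite psiK mulrC [in RHS]mxE.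
have ge0 x : 0 <= rho x by exact/ltW.
have mean : \sum_x psi x * pi x = 0.
  have E : \sum_x (K rho psi x + \sum_y psi y * pi y) * pi x = 0.
    by rewrite big1// => x _; rewrite -(enum_rankK x) M0 mul0r.
  move: E; under eq_bigr do rewrite mulrDl.
  by rewrite big_split/= onsager_mass// add0r -mulr_sumr (stationary_sum hQ) mulr1.
have Kpsi x : K rho psi x = 0 by have := M0 (enum_rank x); rewrite enum_rankK mean addr0.
have f0 : form rho psi = 0.
  by rewrite metric_form_dot// big1// => x _; rewrite Kpsi mulr0 mul0r.
have cst := metric_form_eq0 rho0 f0.
move/negP: w0; apply; apply/eqP/rowP => j; rewrite mxE -psiK.
move: mean; rewrite (eq_bigr (fun x => psi (enum_val j) * pi x)) => [|x _].
  by rewrite -mulr_sumr (stationary_sum hQ) mulr1.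
by rewrite (cst x (enum_val j)).
Qed.

(** Summing the linear system against pi kills the K-term, so the mean of the solution equals that
    of v, which is 0. *)
Lemma onsager_invK rho v : (forall x, 0 < rho x) -> \sum_x v x * pi x = 0 ->
  forall x, K rho (onsager_inv rho v) x = v x.
Proof.
move=> rho0 v0; have ge0 x : 0 <= rho x by exact/ltW.
have h x : K rho (onsager_inv rho v) x + \sum_y onsager_inv rho v y * pi y = v x.
  rewrite -[x]enum_rankK -onsager_matrixE.
  have := mulKVmx (onsager_matrix_unit rho0) (\col_i v (enum_val i)).
  move=> /colP/(_ (enum_rank x)); rewrite !mxE => <-.
  apply: eq_bigr => j _; congr (_ * _); rewrite !mxE /onsager_inv sum_enum.
  by apply: eq_bigr => k _; rewrite !enum_valK mxE.
suff m : \sum_y onsager_inv rho v y * pi y = 0 by move=> x; rewrite -[RHS]h m addr0.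
have : \sum_x (K rho (onsager_inv rho v) x
    + \sum_y onsager_inv rho v y * pi y) * pi x = 0.
  by under eq_bigr do rewrite h.
under eq_bigr do rewrite mulrDl.
by rewrite big_split/= onsager_mass// add0r -mulr_sumr (stationary_sum hQ) mulr1.
Qed.

Lemma speed_metric rho v : (forall x, 0 < rho x) -> \sum_x v x * pi x = 0 ->
  speed rho v = form rho (onsager_inv rho v).
Proof.
move=> rho0 v0; rewrite metric_form_dot => [|x]; last exact/ltW.
by apply: eq_bigr => x _; rewrite onsager_invK// [v x * _]mulrC.
Qed.

Lemma speed_ge0 rho v : (forall x, 0 < rho x) -> \sum_x v x * pi x = 0 ->
  0 <= speed rho v.
Proof. by move=> *; rewrite speed_metric// metric_form_ge0. Qed.

Lemma metric_form_dual rho phi psi : (forall x, 0 <= rho x) ->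
  2 * dot phi (K rho psi) - form rho phi <= form rho psi.
Proof.
move=> rho0; have := metric_form_ge0 rho (fun x => phi x - psi x).
rewrite !metric_form_dot//.
have -> : dot (fun x => phi x - psi x) (K rho (fun x => phi x - psi x)) =
  dot phi (K rho phi) - dot phi (K rho psi) - (dot psi (K rho phi) - dot psi (K rho psi)).
  rewrite -!sumrB; apply: eq_bigr => x _; rewrite onsagerB.
  by move: (K _ _ _) (K _ _ _) => a b; ring.
rewrite (onsager_sym psi phi rho0).
by move: (dot phi _) (dot phi _) (dot psi _) => a b d; lra.
Qed.

(** One half of the Legendre duality between [speed] and [metric_form]; it serves to compare speeds
    at different densities. *)
Lemma speed_ge rho v phi : (forall x, 0 < rho x) -> \sum_x v x * pi x = 0 ->
  2 * dot phi v - form rho phi <= speed rho v.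
Proof.
move=> rho0 v0; rewrite speed_metric//.
have -> : dot phi v = dot phi (K rho (onsager_inv rho v)).
  by apply: eq_bigr => x _; rewrite onsager_invK.
by apply: metric_form_dual => x; exact/ltW.
Qed.

Lemma onsager_invZ rho k v x :
  onsager_inv rho (fun y => k * v y) x = k * onsager_inv rho v x.
Proof. by rewrite /onsager_inv mulr_sumr; apply: eq_bigr => y _; rewrite mulrCA. Qed.

Lemma speedZ rho k v : speed rho (fun x => k * v x) = k ^+ 2 * speed rho v.
Proof.
rewrite /speed mulr_sumr; apply: eq_bigr => x _; rewrite onsager_invZ; ring.
Qed.

Lemma cvg_onsager_inv (T : Type) (FF : set_system T) (r w : T -> X -> R) rho v :
  Filter FF -> (forall x, 0 < rho x) ->
  (forall x, r^~ x @ FF --> rho x) -> (forall x, w^~ x @ FF --> v x) ->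
  forall x, (fun t => onsager_inv (r t) (w t) x) @ FF --> onsager_inv rho v x.
Proof.
move=> FFF rho0 rr wv x; apply: cvg_fun_sum => y; apply: cvgM; last exact: wv.
apply: cvg_invmx; first exact: onsager_matrix_unit.
move=> i j; rewrite mxE; under eq_fun do rewrite mxE.
apply: cvgD; last exact: cvg_cst.
apply: cvgB.
  apply: cvgM; first exact: cvg_cst.
  apply: cvg_fun_sum => z; apply: cvgM; last exact: cvg_cst.
  by apply: cvg_theta.
by apply: cvgM; [apply: cvg_theta|exact: cvg_cst].
Qed.

Lemma cvg_speed (T : Type) (FF : set_system T) (r w : T -> X -> R) rho v :
  Filter FF -> (forall x, 0 < rho x) ->
  (forall x, r^~ x @ FF --> rho x) -> (forall x, w^~ x @ FF --> v x) ->
  (fun t => speed (r t) (w t)) @ FF --> speed rho v.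
Proof.
move=> FFF rho0 rr wv; apply: cvg_fun_sum => x.
apply: cvgM; last exact: cvg_cst.
by apply: cvgM; [exact: wv|exact: cvg_onsager_inv].
Qed.

End Speed.

(** * The heat semigroup *)

Section ExponentialGeneratingFunction.
Variable R : realType.
Implicit Types (a b : R ^nat) (t : R).

(** The exponential generating function of the sequence a. For bounded a it is entire, and
    differentiation shifts the sequence. *)
Definition egf a t : R := limn (pseries (fun n => a n * (n`!%:R)^-1) t).

Lemma is_cvg_egf a t : (forall n, `|a n| <= 1) ->
  cvgn (pseries (fun n => a n * (n`!%:R)^-1) t).
Proof.
move=> a1; apply: normed_cvg; apply: (@series_le_cvg _ _ (exp_coeff `|t|)).
- by move=> n; exact: normr_ge0.
- by move=> n; rewrite exp_coeff_ge0.
- move=> n; rewrite /exp_coeff/= [leRHS]mulrC 2!normrM normrX.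
  apply: ler_wpM2r; first exact: exprn_ge0.
  by rewrite (ger0_norm (x := n`!%:R^-1))// ler_piMl.
exact: is_cvg_series_exp_coeff.
Qed.

Lemma is_derive_egf a t : (forall n, `|a n| <= 1) ->
  is_derive t (1 : R) (egf a) (egf (fun n => a n.+1) t).
Proof.
move=> a1; have E b : pseries_diffs (fun n => b n * (n`!%:R)^-1) =
    (fun n => b n.+1 * (n`!%:R)^-1).
  apply/funext => n; rewrite /pseries_diffs factS natrM invfM.
  by rewrite mulrCA mulVKf.
rewrite /egf -(E a); apply: (@pseries_snd_diffs _ _ (`|t| + 1)).
- exact: is_cvg_egf.
- by rewrite (E a); exact: (@is_cvg_egf (fun n => a n.+1) _ (fun n => a1 n.+1)).
- rewrite (E a) (E (fun n => a n.+1)).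
  exact: (@is_cvg_egf (fun n => a n.+2) _ (fun n => a1 n.+2)).
- by rewrite [ltRHS]ger0_norm// ltrDl.
Qed.

Lemma egf_ge0 a t : (forall n, 0 <= a n <= 1) -> 0 <= t -> 0 <= egf a t.
Proof.
move=> a1 t0; apply: limr_ge.
  by apply: is_cvg_egf => n; have /andP[h ?] := a1 n; rewrite ger0_norm.
apply: nearW => n; rewrite /pseries/=; apply: sumr_ge0 => i _.
by have /andP[h _] := a1 i; rewrite mulr_ge0 ?exprn_ge0// mulr_ge0.
Qed.

Lemma egf_sum (I : finType) (k : I -> R) (a : I -> R ^nat) t :
  (forall i n, `|a i n| <= 1) ->
  egf (fun n => \sum_i k i * a i n) t = \sum_i k i * egf (a i) t.
Proof.
move=> a1; apply/cvg_lim => //.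
have -> : pseries (fun n => (\sum_i k i * a i n) * (n`!%:R)^-1) t =
  (fun m => \sum_i k i * pseries (fun n => a i n * (n`!%:R)^-1) t m).
  apply/funext => m; rewrite /pseries/= /series/=.
  under [RHS]eq_bigr do rewrite mulr_sumr.
  rewrite exchange_big; apply: eq_bigr => n _ /=.
  by rewrite !mulr_suml; apply: eq_bigr => i _; rewrite !mulrA.
apply: cvg_fun_sum => i; apply: cvgM; first exact: cvg_cst.
exact: is_cvg_egf.
Qed.

Lemma egf0 a : egf a 0 = a 0%N.
Proof.
apply/cvg_lim => //; apply: cvg_near_cst.
exists 1%N => // n /= n0; rewrite /pseries/= /series/=.
rewrite big_mkord; case: n n0 => // n _; rewrite big_ord_recl/= expr0 fact0 invr1 !mulr1.
by rewrite big1 ?addr0// => i _; rewrite expr0n/= mulr0.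
Qed.

Lemma egf1 t : egf (fun=> 1) t = expR t.
Proof.
by rewrite /egf expRE; congr (limn (pseries _ t)); apply/funext => n; rewrite mul1r.
Qed.

End ExponentialGeneratingFunction.

Section HeatSemigroup.
Variables (R : realType) (X : finType) (Q : X -> X -> R) (pi : X -> R).
Hypothesis hQ : markov_triple Q pi.

Let Q_ge0 x y : 0 <= Q x y. Proof. exact: rate_ge0 hQ x y. Qed.

(** It exceeds every exit rate, which makes [unif_step] stochastic; the summand 1 keeps it positive
    on a one-point space. *)
Definition unif_rate : R := 1 + \sum_x \sum_y Q x y.

Definition unif_step (x y : X) : R :=
  (x == y)%:R * (1 - (\sum_z Q x z) / unif_rate) + Q x y / unif_rate.

Fixpoint unif_iter (n : nat) (x y : X) : R :=
  if n is m.+1 then \sum_z unif_step x z * unif_iter m z y else (x == y)%:R.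

(* Uniformization: exp (t L) = exp (- c t) exp (c t (I + L / c)), where *)
(* I + L / c is a stochastic matrix. *)
Definition heat_kernel (t : R) (x y : X) : R :=
  expR (- unif_rate * t) * egf (fun n => unif_iter n x y) (unif_rate * t).

Definition heat (t : R) (f : X -> R) (x : X) : R := \sum_y heat_kernel t x y * f y.

Lemma unif_rate_gt0 : 0 < unif_rate.
Proof.
rewrite ltr_pwDl//; apply: sumr_ge0 => x _; exact: sumr_ge0.
Qed.

Lemma sum_delta (x : X) (F : X -> R) : \sum_z (x == z)%:R * F z = F x.
Proof.
rewrite (bigD1 x)//= eqxx mul1r big1 ?addr0// => z; rewrite eq_sym => /negbTE->.
by rewrite mul0r.
Qed.

Lemma unif_step_ge0 x y : 0 <= unif_step x y.
Proof.
rewrite addr_ge0 ?divr_ge0 ?(ltW unif_rate_gt0)//; apply: mulr_ge0 => //.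
rewrite subr_ge0 ler_pdivrMr ?unif_rate_gt0// mul1r /unif_rate [X in _ <= _ + X](bigD1 x)//= addrCA.
by rewrite lerDl addr_ge0//; apply: sumr_ge0 => z _; apply: sumr_ge0.
Qed.

Lemma unif_step_sum x : \sum_y unif_step x y = 1.
Proof.
rewrite big_split/= sum_delta -mulr_suml.
by rewrite subrK.
Qed.

Lemma unif_iter_ge0 n x y : 0 <= unif_iter n x y.
Proof.
elim: n x => //= n ih x; apply: sumr_ge0 => z _; rewrite mulr_ge0 ?ih//.
exact: unif_step_ge0.
Qed.

Lemma unif_iter_sum n x : \sum_y unif_iter n x y = 1.
Proof.
elim: n x => /= [|n ih] x.
  by rewrite -[RHS](sum_delta x (fun=> 1)); apply: eq_bigr => y _; rewrite mulr1.
rewrite exchange_big -[RHS](unif_step_sum x); apply: eq_bigr => z _ /=.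
by rewrite -mulr_sumr ih mulr1.
Qed.

Lemma unif_iter_le1 n x y : unif_iter n x y <= 1.
Proof.
rewrite -(unif_iter_sum n x) (bigD1 y)//= lerDl; apply: sumr_ge0 => z _.
exact: unif_iter_ge0.
Qed.

Lemma unif_iter_norm n x y : `|unif_iter n x y| <= 1.
Proof. by rewrite ger0_norm ?unif_iter_ge0// unif_iter_le1. Qed.

Lemma unif_step_rev x z : pi x * unif_step x z = pi z * unif_step z x.
Proof.
rewrite /unif_step !mulrDr; congr (_ + _).
  by case: eqVneq => [->|]; rewrite ?mul0r ?mulr0// eq_sym => /negbTE->; rewrite mul0r mulr0.
by rewrite !mulrA ![pi _ * _]mulrC (detailed_balance hQ).
Qed.

Lemma unif_iter_mass n y : \sum_x pi x * unif_iter n x y = pi y.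
Proof.
elim: n => /= [|n ih].
  rewrite -[RHS](sum_delta y pi); apply: eq_bigr => x _.
  by rewrite mulrC eq_sym.
under eq_bigr do rewrite mulr_sumr.
rewrite exchange_big -[RHS]ih; apply: eq_bigr => z _ /=.
under eq_bigr do rewrite mulrA unif_step_rev -mulrA mulrCA.
by rewrite -mulr_suml unif_step_sum mul1r.
Qed.

Lemma heat_kernel_ge0 t x y : 0 <= t -> 0 <= heat_kernel t x y.
Proof.
move=> t0; rewrite mulr_ge0 ?expR_ge0//; apply: egf_ge0 => [n|].
  by rewrite unif_iter_ge0 unif_iter_le1.
by rewrite mulr_ge0// ltW// unif_rate_gt0.
Qed.

Lemma heat_kernel_sum t x : \sum_y heat_kernel t x y = 1.
Proof.
rewrite /heat_kernel -mulr_sumr.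
have := @egf_sum R X (fun=> 1) (fun y n => unif_iter n x y) (unif_rate * t)
  (fun y n => unif_iter_norm n x y).
under [RHS]eq_bigr do rewrite mul1r.
move=> <-; rewrite (_ : (fun n => _) = (fun=> 1)); last first.
  apply/funext => n; rewrite -[RHS](unif_iter_sum n x).
  by apply: eq_bigr => y _; rewrite mul1r.
by rewrite egf1 -expRD mulNr addNr expR0.
Qed.

Lemma heat_kernel_mass t y : \sum_x pi x * heat_kernel t x y = pi y.
Proof.
rewrite /heat_kernel; under eq_bigr do rewrite mulrCA.
rewrite -mulr_sumr -(@egf_sum R X pi (fun x n => unif_iter n x y) (unif_rate * t)
  (fun x n => unif_iter_norm n x y)).
(* The constant sequence pi y is written as a one-term sum, so that the linearity [egf_sum] applies
   to it. *)
have -> : (fun n => \sum_x pi x * unif_iter n x y) =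
    (fun n => \sum_(i : 'I_1) pi y * 1).
  by apply/funext => n; rewrite unif_iter_mass big_ord1 mulr1.
rewrite (@egf_sum R 'I_1 (fun=> pi y) (fun _ _ => 1)) => [|_ _]; last by rewrite normr1.
by rewrite big_ord1 egf1 mulrCA -expRD mulNr addNr expR0 mulr1.
Qed.

Lemma heat_kernel0 x y : heat_kernel 0 x y = (x == y)%:R.
Proof. by rewrite /heat_kernel !mulr0 expR0 mul1r egf0. Qed.

Lemma is_derive_heat_kernel t x y : is_derive t (1 : R)
  (fun t => heat_kernel t x y) (generator Q (heat_kernel t ^~ y) x).
Proof.
set u := unif_rate.
have d1 (k : R) : is_derive t (1 : R) (fun r => k * r) k.
  by apply: (is_derive_eq (is_derive_funZ k (is_derive_id _ _))); rewrite mulr1.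
have d2 : is_derive t (1:R) (fun r => expR (- u * r)) (- u * expR (- u * t)).
  exact: (is_derive_fun_comp (is_derive_expR _) (d1 _)).
have d3 : is_derive t (1:R) (fun r => egf (fun n => unif_iter n x y) (u * r))
    (u * egf (fun n => unif_iter n.+1 x y) (u * t)).
  apply: (is_derive_fun_comp (is_derive_egf _ _) (d1 _)) => n.
  exact: unif_iter_norm.
apply: (is_derive_eq (is_derive_funM d2 d3)).
rewrite [X in _ + _ * (_ * X)](_ : _ =
    \sum_z unif_step x z * egf (fun n => unif_iter n z y) (u * t)); last first.
  by rewrite -egf_sum// => z n; exact: unif_iter_norm.
have -> : generator Q (heat_kernel t ^~ y) x =
    \sum_z Q x z * heat_kernel t z y - (\sum_z Q x z) * heat_kernel t x y.
  by rewrite /generator mulr_suml -sumrB; apply: eq_bigr => z _; rewrite mulrBr.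
have -> : \sum_z unif_step x z * egf (fun n => unif_iter n z y) (u * t) =
  (1 - (\sum_z Q x z) / u) * egf (fun n => unif_iter n x y) (u * t)
  + u^-1 * \sum_z Q x z * egf (fun n => unif_iter n z y) (u * t).
  rewrite -[X in _ = X + _](sum_delta x (fun z =>
    (1 - (\sum_z Q x z) / u) * egf (fun n => unif_iter n z y) (u * t))).
  rewrite mulr_sumr -big_split; apply: eq_bigr => z _ /=.
  by rewrite /unif_step -/u; move: (egf _ _) (\sum_z _) => a b; ring.
rewrite /heat_kernel -/u.
have -> : \sum_i Q x i * (expR (- u * t) * egf (fun n => unif_iter n i y) (u * t)) =
    expR (- u * t) * \sum_i Q x i * egf (fun n => unif_iter n i y) (u * t).
  by rewrite mulr_sumr; apply: eq_bigr => z _; rewrite mulrCA.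
have u0 : u != 0 by rewrite gt_eqF// unif_rate_gt0.
move: (egf _ _) (expR _) (\sum_i Q x i * _) (\sum_z Q x z) => a b s r.
by field.
Qed.

Lemma is_derive_heat (h : R -> R) (rho : R -> X -> R) t k v x :
  is_derive t (1 : R) h k -> (forall y, is_derive t (1 : R) (rho ^~ y) (v y)) ->
  is_derive t (1 : R) (fun s => heat (h s) (rho s) x)
    (k * generator Q (heat (h t) (rho t)) x + heat (h t) v x).
Proof.
move=> dh drho; apply: (is_derive_eq (is_derive_fun_sum _ _ (fun y => is_derive_funM
  (is_derive_fun_comp (is_derive_heat_kernel (h t) x y) dh) (drho y)))).
rewrite big_split/=; congr (_ + _).
under eq_bigr do rewrite -mulrA; rewrite -mulr_sumr; congr (_ * _).
rewrite /generator /heat; under [RHS]eq_bigr do rewrite -sumrB mulr_sumr.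
under [LHS]eq_bigr do rewrite mulr_suml; rewrite exchange_big.
by apply: eq_bigr => z _; apply: eq_bigr => y _; rewrite -mulrBl mulrA.
Qed.

Lemma heat0 f x : heat 0 f x = f x.
Proof.
rewrite /heat (eq_bigr (fun y => (x == y)%:R * f y)) ?sum_delta// => y _.
by rewrite heat_kernel0.
Qed.

Lemma heat_ge m t f x : 0 <= t -> (forall y, m <= f y) -> m <= heat t f x.
Proof.
move=> t0 mf; rewrite -[m]mul1r -(heat_kernel_sum t x) mulr_suml.
by apply: ler_sum => y _; rewrite ler_wpM2l// heat_kernel_ge0.
Qed.

Lemma heat_mass t f : \sum_x heat t f x * pi x = \sum_x f x * pi x.
Proof.
rewrite /heat; under eq_bigr do rewrite mulr_suml.
rewrite exchange_big; apply: eq_bigr => y _ /=.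
rewrite -[in RHS](heat_kernel_mass t y) mulr_sumr; apply: eq_bigr => x _; ring.
Qed.

Lemma heat_density t rho : 0 <= t -> density pi rho -> density pi (heat t rho).
Proof.
move=> t0 [rho0 rho1]; split; last by rewrite heat_mass.
by move=> x; exact: heat_ge.
Qed.

Lemma generator_mass f : \sum_x generator Q f x * pi x = 0.
Proof.
pose S := \sum_x \sum_y Q x y * pi x * f x.
have -> : \sum_x generator Q f x * pi x = \sum_x \sum_y Q x y * pi x * f y - S.
  rewrite /S -sumrB; apply: eq_bigr => x _; rewrite mulr_suml -sumrB.
  by apply: eq_bigr => y _; ring.
rewrite exchange_big /S -sumrB big1// => x _; rewrite -sumrB big1// => y _.
by rewrite (detailed_balance hQ) subrr.
Qed.

End HeatSemigroup.

(** * Entropy along the heat semigroup *)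

Section Entropy.
Variables (R : realType) (X : finType) (pi : X -> R).
Hypothesis pi_gt0 : forall x, 0 < pi x.
Hypothesis pi_sum : \sum_x pi x = 1.
Implicit Types (rho mu nu : X -> R).

(** The tangent line at m of the convex function x ln x, down to x = 0. *)
Lemma xlnx_ge (x m : R) : 0 <= x -> 0 < m -> x * ln m + x - m <= x * ln x.
Proof.
rewrite le_eqVlt => /predU1P[<- m0|x0 m0].
  by rewrite !mul0r !add0r oppr_le0 ltW.
have := le_ln1Dx (x := m / x - 1).
rewrite addrCA subrr addr0 ltrBDr addrC subrr divr_gt0// => /(_ isT).
rewrite ln_div// => /(ler_wpM2l (ltW x0)).
rewrite mulrBr mulrBr mulr1 mulrCA divff ?gt_eqF// mulr1.
by move: (x * ln m) (x * ln x) => a b h; lra.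
Qed.

Lemma entropy_ge0 rho : density pi rho -> 0 <= entropy pi rho.
Proof.
move=> [rho0 rho1].
have -> : 0 = \sum_x pi x * (rho x - 1).
  under eq_bigr do rewrite mulrBr mulr1 mulrC.
  by rewrite sumrB rho1 pi_sum subrr.
apply: ler_sum => x _; rewrite -mulrA ler_wpM2l ?(ltW (pi_gt0 x))//.
by have := xlnx_ge (rho0 x) ltr01; rewrite ln1 mulr0 add0r.
Qed.

Lemma density_le rho x : density pi rho -> rho x <= (pi x)^-1.
Proof.
move=> [rho0 rho1]; rewrite -(ler_pM2r (pi_gt0 x)) mulVf ?gt_eqF//.
rewrite -rho1 (bigD1 x)//= lerDl; apply: sumr_ge0 => y _.
by rewrite mulr_ge0// ltW.
Qed.

Definition entropy_bound : R := \sum_x `|ln (pi x)|.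

Lemma entropy_le rho : density pi rho -> entropy pi rho <= entropy_bound.
Proof.
move=> drho; have [rho0 rho1] := drho; apply: ler_sum => x _.
have p1 : pi x * rho x <= 1.
  by rewrite -ler_pdivlMl// mulr1 density_le.
have p0 : 0 <= pi x * rho x by rewrite mulr_ge0// ltW.
have [->|nz] := eqVneq (rho x) 0; first by rewrite mulr0 mul0r.
have r0 : 0 < rho x by rewrite lt0r nz rho0.
have ll : ln (rho x) <= `|ln (pi x)|.
  apply: (@le_trans _ _ (ln (pi x)^-1)); first by rewrite ler_ln ?posrE ?invr_gt0 ?density_le.
  by rewrite lnV ?posrE// -normrN ler_norm.
apply: (le_trans (ler_wpM2l p0 ll)).
by rewrite -[leRHS]mul1r ler_wpM2r.
Qed.

Lemma entropy_mix (e : R) rho : 0 < e <= 1 -> density pi rho ->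
  entropy pi (fun x => (1 - e) * rho x + e) <= entropy pi rho.
Proof.
move=> /andP[e0 e1] drho; have [rho0 rho1] := drho.
apply: (@le_trans _ _ ((1 - e) * entropy pi rho)); last first.
  by rewrite -[leRHS]mul1r ler_wpM2r ?entropy_ge0// gerBl ltW.
rewrite /entropy mulr_sumr; apply: ler_sum => x _; rewrite -!mulrA [leRHS]mulrCA.
rewrite ler_wpM2l ?(ltW (pi_gt0 x))//; set m := (1 - e) * rho x + e.
have m0 : 0 < m by rewrite ltr_wpDl// mulr_ge0// subr_ge0.
have e1' : 0 <= 1 - e by rewrite subr_ge0.
have h1 := ler_wpM2l e1' (xlnx_ge (rho0 x) m0).
have h2 := ler_wpM2l (ltW e0) (xlnx_ge ler01 m0); rewrite ln1 mulr0 mulr0 in h2.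
move: h1 h2; rewrite /m; move: (rho x) (ln _) (ln _) => r l k h1 h2; lra.
Qed.

Lemma entropy_lsc nu (d : R) : density pi nu -> 0 < d ->
  exists2 e : R, 0 < e & forall mu, density pi mu ->
    (forall x, `|mu x - nu x| <= e) -> entropy pi nu - d <= entropy pi mu.
Proof.
(* The tangent to x ln x is taken at nu x + k rather than at nu x, so that its slope stays finite
   where nu vanishes. Half of d pays for this shift, the other half for the slopes, collected in
   S. *)
move=> [nu0 nu1] d0; pose k := d / 2; have k0 : 0 < k by rewrite divr_gt0.
pose S := 1 + \sum_x (1 + `|ln (nu x + k)|).
have S0 : 0 < S by rewrite ltr_pwDl// sumr_ge0// => x _; rewrite addr_ge0.
exists (k / S); first by rewrite divr_gt0.
move=> mu [mu0 mu1] close; rewrite lerBlDr -lerBlDl.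
have -> : entropy pi nu - entropy pi mu =
    \sum_x pi x * (nu x * ln (nu x) - mu x * ln (mu x)).
  by rewrite -sumrB; apply: eq_bigr => x _; rewrite mulrBr !mulrA.
have T x : nu x * ln (nu x) - mu x * ln (mu x) <=
    k + k / S * (1 + `|ln (nu x + k)|).
  have m0 : 0 < nu x + k by rewrite ltr_wpDl.
  have h := xlnx_ge (mu0 x) m0.
  have h2 : nu x * ln (nu x) <= nu x * ln (nu x + k).
    have [->|nz] := eqVneq (nu x) 0; first by rewrite !mul0r.
    rewrite ler_wpM2l// ler_ln ?posrE//; first by rewrite lerDl ltW.
    by rewrite lt0r nz nu0.
  have h3 : (nu x - mu x) * ln (nu x + k) <= k / S * `|ln (nu x + k)|.
    apply: (le_trans (ler_norm _)); rewrite normrM ler_wpM2r//.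
    by rewrite distrC.
  have h4 : nu x - mu x <= k / S.
    by apply: (le_trans (ler_norm _)); rewrite distrC.
  by move: h h2 h3 h4; move: (k / S) (ln (nu x + k)) (nu x * ln (nu x)) (mu x * ln (mu x))
    => a l b c h h2 h3 h4; lra.
apply: (@le_trans _ _ (\sum_x (pi x * k + k / S * (1 + `|ln (nu x + k)|)))).
  apply: ler_sum => x _; apply: (le_trans (ler_wpM2l (ltW (pi_gt0 x)) (T x))).
  rewrite mulrDr lerD2l -[leRHS]mul1r ler_wpM2r//.
    by rewrite mulr_ge0 ?addr_ge0// divr_ge0// ltW.
  rewrite -pi_sum (bigD1 x)//= lerDl sumr_ge0// => y _; exact/ltW.
rewrite big_split/= -mulr_suml pi_sum mul1r -mulr_sumr.
have : k / S * (\sum_x (1 + `|ln (nu x + k)|)) <= k.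
  by rewrite -mulrA ger_pMr// ler_pdivrMl// mulr1 /S lerDr.
by rewrite /k; lra.
Qed.

End Entropy.

(** * The derivative of the squared speed, in general and along the heat flow *)

Section SpeedDerivative.
Variables (R : realType) (X : finType) (Q : X -> X -> R) (pi : X -> R).
Hypothesis hQ : markov_triple Q pi.

Notation dot f g := (\sum_x f x * g x * pi x).
Local Notation K := (onsager Q).
Local Notation L := (generator Q).
Local Notation speed := (speed Q pi).
Local Notation inv := (onsager_inv Q pi).

Let pi_gt0 x : 0 < pi x. Proof. exact: stationary_gt0 hQ x. Qed.

Let diff_form (rho1 rho2 psi1 psi2 : X -> R) : R := 2^-1 * \sum_x \sum_y
  (psi1 x - psi1 y) * (psi2 x - psi2 y) *
  (theta (rho1 x) (rho1 y) - theta (rho2 x) (rho2 y)) * (Q x y * pi x).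

Let diff_formE rho1 rho2 psi1 psi2 : (forall x, 0 <= rho1 x) -> (forall x, 0 <= rho2 x) ->
  diff_form rho1 rho2 psi1 psi2 = dot psi1 (K rho1 psi2) - dot psi1 (K rho2 psi2).
Proof.
move=> ge1 ge2; rewrite [X in _ = X - _](onsager_dot hQ psi1 psi2 ge1).
rewrite [X in _ = _ - X](onsager_dot hQ psi1 psi2 ge2).
rewrite /diff_form -mulrBr; congr (_ * _); rewrite -sumrB.
apply: eq_bigr => x _; rewrite -sumrB; apply: eq_bigr => y _.
by rewrite mulrBr mulrBl.
Qed.

Let dot_diff rho1 rho2 v1 v2 p1 p2 : (forall x, 0 <= rho1 x) -> (forall x, 0 <= rho2 x) ->
  (forall x, K rho1 p1 x = v1 x) -> (forall x, K rho2 p2 x = v2 x) ->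
  dot v1 p1 - dot v2 p2 =
  dot (fun x => v1 x - v2 x) p2 + dot (fun x => v1 x - v2 x) p1
  - diff_form rho1 rho2 p1 p2.
Proof.
move=> ge1 ge2 k1 k2; rewrite (diff_formE p1 p2 ge1 ge2).
have e1 : dot p1 (K rho1 p2) = dot p2 v1.
  by rewrite (onsager_sym hQ p1 p2 ge1); apply: eq_bigr => x _; rewrite k1.
have e2 : dot p1 (K rho2 p2) = dot p1 v2 by apply: eq_bigr => x _; rewrite k2.
rewrite [X in _ = _ - (X - _)]e1 [X in _ = _ - (_ - X)]e2.
by rewrite -big_split -!sumrB; apply: eq_bigr => x _ /=; ring.
Qed.

(* Only the continuity of the potentials psi enters, not their differentiability. *)
Lemma speedB (rho1 rho2 v1 v2 : X -> R) :
  (forall x, 0 < rho1 x) -> (forall x, 0 < rho2 x) ->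
  \sum_x v1 x * pi x = 0 -> \sum_x v2 x * pi x = 0 ->
  speed rho1 v1 - speed rho2 v2 =
  dot (fun x => v1 x - v2 x) (inv rho2 v2) + dot (fun x => v1 x - v2 x) (inv rho1 v1)
  - diff_form rho1 rho2 (inv rho1 v1) (inv rho2 v2).
Proof.
move=> r1 r2 m1 m2; apply: dot_diff => x; try exact/ltW.
  exact: onsager_invK.
exact: onsager_invK.
Qed.

(** The variation of an inverse operator is minus that of the operator, hence the sign of
    [metric_form_deriv]. As [speedB] is an exact formula, [q] in the proof is the difference
    quotient itself, and its limit can be taken term by term. *)
Lemma is_derive_speed (r w : R -> X -> R) (r' w' : X -> R) t :
  (forall x, 0 < r t x) -> (forall s, \sum_x w s x * pi x = 0) ->
  (forall x, is_derive t (1 : R) (r ^~ x) (r' x)) ->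
  (forall x, is_derive t (1 : R) (w ^~ x) (w' x)) ->
  is_derive t (1 : R) (fun s => speed (r s) (w s))
    (2 * dot w' (inv (r t) (w t)) - metric_form_deriv Q pi (r t) r' (inv (r t) (w t))).
Proof.
move=> r0 w0 dr dw; apply: is_derive_quotient.
have cr x : r (t + h) x @[h --> 0^'] --> r t x.
  exact: cvg_shift_dnbhs (is_derive_continuous (dr x)).
have cw x : w (t + h) x @[h --> 0^'] --> w t x.
  exact: cvg_shift_dnbhs (is_derive_continuous (dw x)).
have cinv x : inv (r (t + h)) (w (t + h)) x @[h --> 0^'] --> inv (r t) (w t) x.
  exact: (@cvg_onsager_inv _ _ _ _ hQ _ _ (fun h => r (t + h)) (fun h => w (t + h))
    _ _ _ r0 cr cw).
pose q h := dot (fun x => h^-1 * (w (t + h) x - w t x)) (inv (r t) (w t))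
  + dot (fun x => h^-1 * (w (t + h) x - w t x)) (inv (r (t + h)) (w (t + h)))
  - 2^-1 * \sum_x \sum_y
    (inv (r (t + h)) (w (t + h)) x - inv (r (t + h)) (w (t + h)) y) *
    (inv (r t) (w t) x - inv (r t) (w t) y) *
    (h^-1 * (theta (r (t + h) x) (r (t + h) y) - theta (r t x) (r t y))) * (Q x y * pi x).
have pos : \forall h \near 0^', forall x, 0 < r (t + h) x.
  apply: filter_forall => x; apply: cvgr_gt (cr x) _ (r0 x).
have E : {near 0^', q =1 (fun h => h^-1 * (speed (r (t + h)) (w (t + h)) - speed (r t) (w t)))}.
  apply: filterS pos => h rh; rewrite speedB//.
  rewrite mulrBr mulrDr /q; congr (_ + _ - _).
  - by rewrite mulr_sumr; apply: eq_bigr => x _; rewrite !mulrA.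
  - by rewrite mulr_sumr; apply: eq_bigr => x _; rewrite !mulrA.
  rewrite /diff_form [RHS]mulrCA; congr (_ * _); rewrite mulr_sumr.
  apply: eq_bigr => x _; rewrite mulr_sumr; apply: eq_bigr => y _.
  by rewrite -[in RHS]mulrA [RHS]mulrCA -!mulrA.
apply: cvg_trans; first exact: (near_eq_cvg E).
have -> : 2 * dot w' (inv (r t) (w t)) - metric_form_deriv Q pi (r t) r' (inv (r t) (w t)) =
  dot w' (inv (r t) (w t)) + dot w' (inv (r t) (w t)) - 2^-1 * \sum_x \sum_y
    (inv (r t) (w t) x - inv (r t) (w t) y) * (inv (r t) (w t) x - inv (r t) (w t) y) *
    (dtheta (r t x) (r t y) * r' x + dtheta (r t y) (r t x) * r' y) * (Q x y * pi x).
  congr (_ - _); first by rewrite mulr2n mulrDl mul1r.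
  by congr (_ * _); do 2! (apply: eq_bigr => ? _); rewrite expr2 [RHS]mulrA.
have dq x : (h^-1 * (w (t + h) x - w t x)) @[h --> 0^'] --> w' x.
  exact: is_derive_cvg_quotient (dw x).
apply: cvgB.
  apply: cvgD; apply: cvg_fun_sum => x; apply: cvgM; try exact: cvg_cst.
    by apply: cvgM; [exact: dq|exact: cvg_cst].
  by apply: cvgM; [exact: dq|exact: cinv].
apply: cvgM; first exact: cvg_cst.
apply: cvg_fun_sum => x; apply: cvg_fun_sum => y; apply: cvgM; last exact: cvg_cst.
apply: cvgM.
  by apply: cvgM; [apply: cvgB; exact: cinv|exact: cvg_cst].
exact: (is_derive_cvg_quotient (is_derive_theta (r0 x) (r0 y) (dr x) (dr y))).
Qed.

(** [theta_log] turns differences of densities into theta times differences of logarithms; thus the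
    heat equation is the gradient flow of the entropy. *)
Lemma generator_log (rho : X -> R) x : (forall y, 0 < rho y) ->
  L rho x = - K rho (fun y => ln (rho y)) x.
Proof.
move=> r0; rewrite /generator /onsager -sumrN; apply: eq_bigr => y _.
by rewrite -(theta_log (r0 y) (r0 x)) (thetaC_gt0 (r0 y) (r0 x));
  move: (theta _ _) => a; ring.
Qed.

Lemma generator_sym (f g : X -> R) : dot f (L g) = dot g (L f).
Proof.
pose S := \sum_x \sum_y f x * g x * (Q x y * pi x).
have E (a b : X -> R) : dot a (L b) = \sum_x \sum_y a x * b y * (Q x y * pi x)
    - \sum_x \sum_y a x * b x * (Q x y * pi x).
  rewrite -sumrB; apply: eq_bigr => x _; rewrite -sumrB /generator mulr_sumr mulr_suml.
  by apply: eq_bigr => y _; ring.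
rewrite !E; congr (_ - _); last by do 2! (apply: eq_bigr => ? _); rewrite [f _ * _]mulrC.
rewrite exchange_big; do 2! (apply: eq_bigr => ? _).
by rewrite (detailed_balance hQ) [f _ * _]mulrC.
Qed.

Lemma generatorD (f g : X -> R) x : L (fun y => f y + g y) x = L f x + L g x.
Proof. by rewrite /generator -big_split; apply: eq_bigr => y _ /=; ring. Qed.

Lemma generatorZ k (f : X -> R) x : L (fun y => k * f y) x = k * L f x.
Proof. by rewrite /generator mulr_sumr; apply: eq_bigr => y _ /=; ring. Qed.

Lemma is_derive_generator (f : R -> X -> R) (f' : X -> R) t x :
  (forall y, is_derive t (1 : R) (f ^~ y) (f' y)) ->
  is_derive t (1 : R) (fun s => L (f s) x) (L f' x).
Proof.
by move=> df; apply: is_derive_fun_sum => y; apply: is_derive_funZ; exact: is_derive_funB.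
Qed.

(* The derivative of s |-> heat (h s) (rho s) when rho has derivative u at s. *)
Definition heat_velocity (s : R) (rho u : X -> R) (h : R) (x : X) : R :=
  h * L (heat Q (h * s) rho) x + heat Q (h * s) u x.

Lemma heat_velocity_mass s rho u h : \sum_x u x * pi x = 0 ->
  \sum_x heat_velocity s rho u h x * pi x = 0.
Proof.
move=> u0; rewrite /heat_velocity; under eq_bigr do rewrite mulrDl -mulrA.
by rewrite big_split/= -mulr_sumr (generator_mass hQ) mulr0 add0r (heat_mass hQ) u0.
Qed.

Lemma is_derive_heat_speed s rho u h : 0 <= h * s -> (forall x, 0 < rho x) ->
  \sum_x u x * pi x = 0 ->
  let g := heat Q (h * s) rho in let v := heat_velocity s rho u h in
  is_derive h (1 : R) (fun h => speed (heat Q (h * s) rho) (heat_velocity s rho u h))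
   (- 2 * dot (fun x => ln (g x)) v - 2 * s * hessian Q pi g (inv g v)).
Proof.
move=> hs0 r0 u0 g v.
have g0 x : 0 < g x.
  have [e e0 re] : exists2 e : R, 0 < e & forall y, e <= rho y.
    exists (\big[Num.min/1]_y rho y); first by apply/bigmin_gtP; split.
    by move=> y; exact: bigmin_le_cond.
  by apply: lt_le_trans e0 _; exact: (heat_ge hQ).
have v0 : \sum_x v x * pi x = 0 by exact: heat_velocity_mass.
have dh : is_derive h (1 : R) (fun h => h * s) s.
  by apply: (is_derive_eq (is_derive_funM (is_derive_id _ _) (is_derive_cst _ _ _)));
    rewrite mulr0 addr0 mul1r.
have dheat f x : is_derive h (1:R) (fun h => heat Q (h * s) f x) (s * L (heat Q (h * s) f) x).
  apply: (is_derive_eq (is_derive_heat hQ x dh (fun y => is_derive_cst _ _ _))).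
  rewrite [X in _ + X](_ : _ = 0) ?addr0// /heat big1// => y _; exact: mulr0.
have dv x : is_derive h (1 : R) (fun h => heat_velocity s rho u h x) (L g x + s * L v x).
  apply: (is_derive_eq (is_derive_funD (is_derive_funM (is_derive_id _ _)
    (is_derive_generator x (fun y => dheat rho y))) (dheat u x))).
  rewrite mul1r -addrA; congr (_ + _); rewrite generatorZ generatorD generatorZ; ring.
apply: (is_derive_eq (is_derive_speed g0 (fun h => heat_velocity_mass s rho h u0)
  (dheat rho) dv)).
rewrite -/g -/v; set psi := inv g v.
have -> : metric_form_deriv Q pi g (fun x => s * L g x) psi =
    s * metric_form_deriv Q pi g (L g) psi.
  rewrite /metric_form_deriv [RHS]mulrCA; congr (_ * _); rewrite [RHS]mulr_sumr.
  apply: eq_bigr => x _.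
  rewrite [RHS]mulr_sumr. refine (eq_bigr _ _) => y _.
  by move: (dtheta _ _) (dtheta _ _) (L _ _) (L _ _) => a b l m; ring.
have -> : dot (fun x => L g x + s * L v x) psi = - dot (fun x => ln (g x)) v
    + s * \sum_x L psi x * K g psi x * pi x.
  have -> : dot (fun x => L g x + s * L v x) psi = dot psi (L g) + s * dot psi (L v).
    by rewrite mulr_sumr -big_split; apply: eq_bigr => x _ /=; ring.
  congr (_ + _ * _).
    have -> : dot psi (L g) = - dot psi (K g (fun y => ln (g y))).
      by rewrite -sumrN; apply: eq_bigr => x _; rewrite generator_log// mulrN mulNr.
    rewrite (onsager_sym hQ) => [|x]; last exact/ltW.
    by congr (- _); apply: eq_bigr => x _; rewrite (onsager_invK hQ).
  rewrite generator_sym; apply: eq_bigr => x _.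
  by rewrite (onsager_invK hQ)// [v x * _]mulrC.
by rewrite /hessian; move: (metric_form_deriv _ _ _ _ _) (\sum_x _) (\sum_x _) => a b d; field.
Qed.

End SpeedDerivative.

(** * Piecewise C1 curves *)

Section C1On.
Variable R : realType.
Implicit Types (f g F : R -> R) (s t r : R).

(** f' is a chosen continuous derivative; at s and t it carries the one-sided limits, so that pieces
    with different slopes can meet there. *)
Definition C1_on f f' s t : Prop :=
  [/\ forall r, r \in `]s, t[ -> is_derive r (1 : R) f (f' r),
      continuous (f \o clamp s t) & continuous (f' \o clamp s t)].

Lemma clamp_oo s t r : r \in `]s, t[ -> clamp s t r = r.
Proof. by move=> /subset_itv_oo_cc; exact: clamp_id. Qed.

Lemma clampl s t : s <= t -> clamp s t s = s.
Proof. by move=> st; rewrite clamp_id// in_itv/= lexx. Qed.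

Lemma clampr s t : s <= t -> clamp s t t = t.
Proof. by move=> st; rewrite clamp_id// in_itv/= lexx andbT. Qed.

Lemma continuous_clamp_comp f s t : s <= t ->
  (forall r, r \in `[s, t] -> {for r, continuous f}) -> continuous (f \o clamp s t).
Proof.
move=> st cf r; apply: continuous_comp; first exact: continuous_clamp.
by apply: cf; exact: clamp_itv.
Qed.

Lemma clamp_within f s t : continuous (f \o clamp s t) -> {within `[s, t], continuous f}.
Proof.
move=> cf; apply: (@subspace_eq_continuous _ _ _ (f \o clamp s t)).
  by move=> r rst; rewrite /= clamp_id//; rewrite inE in rst.
exact: continuous_subspaceT.
Qed.

Lemma C1_on_is_derive f f' s t : s <= t ->
  (forall r, r \in `[s, t] -> is_derive r (1 : R) f (f' r)) ->
  (forall r, r \in `[s, t] -> {for r, continuous f'}) -> C1_on f f' s t.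
Proof.
move=> st df cf; split.
- by move=> r /subset_itv_oo_cc; exact: df.
- by apply: continuous_clamp_comp => // r /df /is_derive_continuous.
- exact: continuous_clamp_comp.
Qed.

Lemma C1_on_LRcontinuous f f' s t : s < t -> C1_on f f' s t ->
  derivable_oo_LRcontinuous f s t.
Proof.
move=> st [df cf _]; split.
- by move=> r /df[].
- have := cvg_at_right_filter (cf s); rewrite /= clampl ?(ltW st)//.
  apply: cvg_trans; apply: near_eq_cvg; near=> r; rewrite /= clamp_id// in_itv/=.
  by apply/andP; split; near: r; [exact: nbhs_right_ge|exact: nbhs_right_le].
- have := cvg_at_left_filter (cf t); rewrite /= clampr ?(ltW st)//.
  apply: cvg_trans; apply: near_eq_cvg; near=> r; rewrite /= clamp_id// in_itv/=.
  by apply/andP; split; near: r; [exact: nbhs_left_ge|exact: nbhs_left_le].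
Unshelve. all: by end_near. Qed.

Lemma FTC_C1_on f f' s t : s < t -> C1_on f f' s t ->
  (\int[lebesgue_measure]_(r in `[s, t]) (f' r)%:E = (f t - f s)%:E)%E.
Proof.
move=> st C; have [df cf cf'] := C; rewrite EFinB; apply: continuous_FTC2 => //.
- exact: clamp_within.
- exact: C1_on_LRcontinuous C.
- by move=> r /df[? <-]; rewrite derive1E.
Qed.

Lemma C1_on_prim f s t : s <= t -> continuous (f \o clamp s t) ->
  exists F, C1_on F f s t.
Proof.
move=> st cf; have [F dF] := primitive_itv st (fun r _ => cf r).
have dF' r : r \in `[s, t] -> is_derive r (1 : R) F (f r).
  by move=> rst; have := dF r rst; rewrite /= clamp_id.
exists F; split => //.
- by move=> r /subset_itv_oo_cc; exact: dF'.
- by apply: continuous_clamp_comp => // r /dF' /is_derive_continuous.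
Qed.

Lemma C1_on_eq f g f' s t : s <= t -> (forall r, r \in `[s, t] -> f r = g r) ->
  C1_on f f' s t -> C1_on g f' s t.
Proof.
move=> st fg [df cf cf']; split => //.
- move=> r rst; apply: is_derive_near (df r rst).
  have := near_in_itvoo rst; apply: filterS => z zst.
  by apply: fg; exact: subset_itv_oo_cc.
- rewrite (_ : g \o _ = f \o clamp s t)//; apply/funext => r /=.
  by rewrite fg// clamp_itv.
Qed.

Lemma C1_onD f f' g g' s t : C1_on f f' s t -> C1_on g g' s t ->
  C1_on (fun r => f r + g r) (fun r => f' r + g' r) s t.
Proof.
move=> [df cf cf'] [dg cg cg']; split.
- by move=> r rst; apply: is_derive_funD; [exact: df|exact: dg].
- by move=> r; apply: cvgD; [exact: cf|exact: cg].
- by move=> r; apply: cvgD; [exact: cf'|exact: cg'].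
Qed.

Lemma C1_onZ k f f' s t : C1_on f f' s t ->
  C1_on (fun r => k * f r) (fun r => k * f' r) s t.
Proof.
move=> [df cf cf']; split.
- by move=> r rst; apply: is_derive_funZ; exact: df.
- by move=> r; apply: cvgM; [exact: cvg_cst|exact: cf].
- by move=> r; apply: cvgM; [exact: cvg_cst|exact: cf'].
Qed.

Lemma C1_on_affine k l s t : s <= t -> C1_on (fun r => k * r + l) (fun=> k) s t.
Proof.
move=> st; apply: C1_on_is_derive => // r _; last exact: cvg_cst.
apply: (is_derive_eq (is_derive_funD (is_derive_funZ k (is_derive_id _ _))
  (is_derive_cst l _ _))).
by rewrite mulr1 addr0.
Qed.

Lemma clamp_bounded f s t : s <= t -> continuous (f \o clamp s t) ->
  exists2 M, 0 < M & forall r, r \in `[s, t] -> `|f r| <= M.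
Proof.
move=> st cf.
have cn : {within `[s, t], continuous (fun r => `|f r|)}.
  apply: (@clamp_within (fun r => `|f r|)) => r.
  by apply: (@cvg_norm _ _ _ _ _ (f \o clamp s t)); exact: cf.
have [c cst cM] := EVT_max st cn.
exists (`|f c| + 1); first by rewrite ltr_wpDl.
by move=> r /cM h; apply: (le_trans h); rewrite lerDl.
Qed.

Lemma within_clamp f s t : s <= t -> {within `[s, t], continuous f} ->
  continuous (f \o clamp s t).
Proof.
move=> st /subspace_continuousP cf r.
have h : clamp s t x @[x --> r] `=>` within `[s, t]%classic (nbhs (clamp s t r)).
  move=> U wU.
  apply: (@filterS R (nbhs r) _ (fun z => clamp s t z \in `[s, t] -> U (clamp s t z))).
    by move=> z h; apply: h; exact: clamp_itv.
  exact: (@continuous_clamp R s t r _ wU).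
exact: (cvg_comp _ _ h (cf _ (clamp_itv r st))).
Qed.

Lemma C1_itv_C1_on f s t : s < t -> C1_itv f s t -> exists f', C1_on f f' s t.
Proof.
move=> st [df cf' /cvg_ex[l fl] /cvg_ex[m fm]].
pose f' r := if r <= s then l else if t <= r then m else derive1 f r.
have E r : r \in `]s, t[ -> derive1 f r = f' r.
  by rewrite in_itv/= => /andP[sr rt]; rewrite /f' leNgt sr/= leNgt rt.
exists f'; split.
- move=> r rst; have [d _ _] := df; rewrite -E// derive1E; apply: DeriveDef => //; exact: d.
- by apply: (within_clamp (ltW st)); exact: derivable_oo_LRcontinuous_within.
- apply: (within_clamp (ltW st)); apply/(continuous_within_itvP _ st); split.
  + move=> r rst; have := cf' r rst; rewrite /continuous_at (E r rst).
    apply: cvg_trans; apply: near_eq_cvg; have := near_in_itvoo rst.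
    by apply: filterS => z /E.
  + rewrite {2}/f' lexx; apply: cvg_trans fl; apply: near_eq_cvg.
    near=> r; apply: E; rewrite in_itv/=; apply/andP; split; near: r.
      exact: nbhs_right_gt.
    exact: nbhs_right_lt.
  + rewrite {2}/f' leNgt st/= lexx; apply: cvg_trans fm; apply: near_eq_cvg.
    near=> r; apply: E; rewrite in_itv/=; apply/andP; split; near: r.
      exact: nbhs_left_gt.
    exact: nbhs_left_lt.
Unshelve. all: by end_near. Qed.

Lemma C1_on_C1_itv f f' s t : s < t -> C1_on f f' s t -> C1_itv f s t.
Proof.
move=> st C; have [df cf cf'] := C.
have E r : r \in `]s, t[ -> derive1 f r = f' r by move=> /df[? <-]; rewrite derive1E.
have /(continuous_within_itvP _ st)[c0 cs ct] := clamp_within cf'.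
split.
- exact: C1_on_LRcontinuous C.
- move=> r rst; have := c0 r rst; rewrite /continuous_at (E r rst).
  apply: cvg_trans; apply: near_eq_cvg; have := near_in_itvoo rst.
  by apply: filterS => z /E.
- apply/cvg_ex; exists (f' s); apply: cvg_trans cs; apply: near_eq_cvg.
  near=> r; apply/esym/E; rewrite in_itv/=; apply/andP; split; near: r.
    exact: nbhs_right_gt.
  exact: nbhs_right_lt.
- apply/cvg_ex; exists (f' t); apply: cvg_trans ct; apply: near_eq_cvg.
  near=> r; apply/esym/E; rewrite in_itv/=; apply/andP; split; near: r.
    exact: nbhs_left_gt.
  exact: nbhs_left_lt.
Unshelve. all: by end_near. Qed.

Lemma C1_on_comp (f f' r r' : R -> R) (s t a b : R) : a <= b -> C1_on f f' s t ->
  (forall u, u \in `[a, b] -> is_derive u (1 : R) r (r' u)) ->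
  (forall u, u \in `[a, b] -> {for u, continuous r'}) ->
  (forall u, u \in `[a, b] -> r u \in `[s, t]) ->
  (forall u, u \in `]a, b[ -> r u \in `]s, t[) ->
  C1_on (f \o r) (fun u => r' u * f' (r u)) a b.
Proof.
move=> ab [df cf cf'] dr cr' rcc roo.
have cr := continuous_clamp_comp ab (fun u h => is_derive_continuous (dr u h)).
have comp g : continuous (g \o clamp s t) -> continuous (fun u => g (r (clamp a b u))).
  move=> cg; rewrite (_ : (fun u => _) = (g \o clamp s t) \o (r \o clamp a b)).
    by move=> u; apply: continuous_comp; [exact: cr|exact: cg].
  by apply/funext => u /=; rewrite (clamp_id (rcc _ (clamp_itv u ab))).
split.
- move=> u uab; apply: is_derive_fun_comp; first exact/df/roo.
  exact/dr/subset_itv_oo_cc.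
- exact: comp.
- move=> u; apply: cvgM; last exact: comp.
  exact: (continuous_clamp_comp ab cr').
Qed.

End C1On.

(** * The weighted entropy along a heat-evolved curve *)

Section HeatPiece.
Variables (R : realType) (X : finType) (Q : X -> X -> R) (pi : X -> R).
Hypothesis hQ : markov_triple Q pi.
Variable kappa : R.
Hypothesis kappa_ge0 : 0 <= kappa.

Let pi_gt0 x : 0 < pi x. Proof. exact: stationary_gt0 hQ x. Qed.
Let pi_sum : \sum_x pi x = 1. Proof. exact: stationary_sum hQ. Qed.

Definition weight (h r : R) : R := (1 + kappa * h * r) ^+ 2.

Definition weighted_entropy (rho : X -> R) (r h : R) : R :=
  weight h r * entropy pi (heat Q (h * r) rho).

Definition entropy_deriv (rho v : X -> R) : R :=
  \sum_x pi x * ((ln (rho x) + 1) * v x).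

Definition weighted_entropy_deriv (rho u : X -> R) (r h : R) : R :=
  2 * kappa * h * (1 + kappa * h * r) * entropy pi (heat Q (h * r) rho)
  + weight h r * entropy_deriv (heat Q (h * r) rho) (heat_velocity Q r rho u h).

Lemma is_derive_entropy (g : R -> X -> R) (v : X -> R) (t : R) :
  (forall x, 0 < g t x) -> (forall x, is_derive t (1 : R) (g ^~ x) (v x)) ->
  is_derive t (1 : R) (fun s => entropy pi (g s)) (entropy_deriv (g t) v).
Proof.
move=> g0 dg; apply: is_derive_fun_sum => x.
apply: (is_derive_eq (is_derive_funM (is_derive_funZ (pi x) (dg x))
  (is_derive_fun_comp (is_derive1_ln (g0 x)) (dg x)))).
have := g0 x => /=; move: (g t x) (ln (g t x)) => r l r0; field.
by rewrite gt_eqF.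
Qed.

Lemma is_derive_mulr (k t : R) : is_derive t (1 : R) (fun s => k * s) k.
Proof. by apply: (is_derive_eq (is_derive_funZ k (is_derive_id _ _))); rewrite mulr1. Qed.

Lemma is_derive_weight (h r : R) :
  is_derive r (1 : R) (weight h) (2 * kappa * h * (1 + kappa * h * r)).
Proof.
have d1 : is_derive r (1 : R) (fun s => 1 + kappa * h * s) (0 + kappa * h).
  by apply: is_derive_funD; exact: is_derive_mulr.
rewrite /weight; under eq_fun do rewrite expr2.
by apply: (is_derive_eq (is_derive_funM d1 d1)); ring.
Qed.

Lemma heat_gt0 t (rho : X -> R) x : 0 <= t -> (forall y, 0 < rho y) -> 0 < heat Q t rho x.
Proof.
move=> t0 r0; have [e e0 re] : exists2 e : R, 0 < e & forall y, e <= rho y.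
  exists (\big[Num.min/1]_y rho y); first by apply/bigmin_gtP; split.
  by move=> y; exact: bigmin_le_cond.
by apply: lt_le_trans e0 _; exact: (heat_ge hQ).
Qed.

Lemma is_derive_heat_curve (h r : R) (g : R -> X -> R) (u : X -> R) x :
  (forall y, is_derive r (1 : R) (g ^~ y) (u y)) ->
  is_derive r (1 : R) (fun s => heat Q (h * s) (g s) x) (heat_velocity Q r (g r) u h x).
Proof. by move=> dg; exact: (is_derive_heat hQ x (is_derive_mulr h r) dg). Qed.

Lemma is_derive_weighted_entropy (h r : R) (g : R -> X -> R) (u : X -> R) :
  0 <= h * r -> (forall x, 0 < g r x) ->
  (forall x, is_derive r (1 : R) (g ^~ x) (u x)) ->
  is_derive r (1 : R) (fun s => weighted_entropy (g s) s h)
    (weighted_entropy_deriv (g r) u r h).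
Proof.
move=> hr g0 dg; apply: is_derive_funM; first exact: is_derive_weight.
apply: is_derive_entropy => x; first exact: heat_gt0.
exact: is_derive_heat_curve.
Qed.

Section Limits.
Variables (T : Type) (FF : set_system T).
Context {FFF : Filter FF}.

Lemma cvg_heat (t : T -> R) (f : T -> X -> R) t0 f0 x :
  t @ FF --> t0 -> (forall y, f ^~ y @ FF --> f0 y) ->
  (fun z => heat Q (t z) (f z) x) @ FF --> heat Q t0 f0 x.
Proof.
move=> ct cf; apply: cvg_fun_sum => y; apply: cvgM; last exact: cf.
apply: (@cvg_fun_comp R T FF (fun s => heat_kernel Q s x y) t) => //.
exact: (is_derive_continuous (is_derive_heat_kernel hQ t0 x y)).
Qed.

Lemma cvg_generator (f : T -> X -> R) f0 x :
  (forall y, f ^~ y @ FF --> f0 y) ->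
  (fun z => generator Q (f z) x) @ FF --> generator Q f0 x.
Proof.
move=> cf; apply: cvg_fun_sum => y; apply: cvgM; first exact: cvg_cst.
by apply: cvgB.
Qed.

Variables (rho u : T -> X -> R) (r h : T -> R) (rho0 u0 : X -> R) (r0 h0 : R).
Hypothesis crho : forall x, rho ^~ x @ FF --> rho0 x.
Hypothesis cu : forall x, u ^~ x @ FF --> u0 x.
Hypothesis cr : r @ FF --> r0.
Hypothesis ch : h @ FF --> h0.
Hypothesis rho0_gt0 : forall x, 0 < rho0 x.
Hypothesis hr0 : 0 <= h0 * r0.

Let chr : (fun z => h z * r z) @ FF --> h0 * r0.
Proof. exact: cvgM. Qed.

Lemma cvg_heat_velocity x :
  (fun z => heat_velocity Q (r z) (rho z) (u z) (h z) x) @ FF -->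
  heat_velocity Q r0 rho0 u0 h0 x.
Proof.
apply: cvgD; last exact: cvg_heat.
by apply: cvgM => //; apply: cvg_generator => y; exact: cvg_heat.
Qed.

Let cln x : (fun z => ln (heat Q (h z * r z) (rho z) x)) @ FF -->
  ln (heat Q (h0 * r0) rho0 x).
Proof.
apply: (@cvg_fun_comp R T FF (@ln R)); last exact: cvg_heat.
by apply: continuous_ln; exact: heat_gt0.
Qed.

Let centropy : (fun z => entropy pi (heat Q (h z * r z) (rho z))) @ FF -->
  entropy pi (heat Q (h0 * r0) rho0).
Proof.
apply: cvg_fun_sum => x; apply: cvgM; last exact: cln.
by apply: cvgM; [exact: cvg_cst|exact: cvg_heat].
Qed.

Let clin : (fun z => 1 + kappa * h z * r z) @ FF --> 1 + kappa * h0 * r0.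
Proof.
apply: cvgD; first exact: cvg_cst.
by apply: cvgM => //; apply: cvgM => //; exact: cvg_cst.
Qed.

Let cweight : (fun z => weight (h z) (r z)) @ FF --> weight h0 r0.
Proof.
rewrite /weight expr2; under eq_fun do rewrite expr2.
exact: cvgM.
Qed.

Lemma cvg_weighted_entropy :
  (fun z => weighted_entropy (rho z) (r z) (h z)) @ FF --> weighted_entropy rho0 r0 h0.
Proof. exact: cvgM. Qed.

Lemma cvg_weighted_entropy_deriv :
  (fun z => weighted_entropy_deriv (rho z) (u z) (r z) (h z)) @ FF -->
  weighted_entropy_deriv rho0 u0 r0 h0.
Proof.
apply: cvgD.
  apply: cvgM => //; apply: cvgM => //; apply: cvgM => //; exact: cvg_cst.
apply: cvgM => //; apply: cvg_fun_sum => x; apply: cvgM; first exact: cvg_cst.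
apply: cvgM; last exact: cvg_heat_velocity.
by apply: cvgD => //; exact: cvg_cst.
Qed.

End Limits.

Lemma heat_kernel_le1 t x y : 0 <= t -> heat_kernel Q t x y <= 1.
Proof.
move=> t0; rewrite -(heat_kernel_sum hQ t x) (bigD1 y)//= lerDl; apply: sumr_ge0 => z _.
exact: (heat_kernel_ge0 hQ).
Qed.

Lemma heat_norm t (f : X -> R) x : 0 <= t -> `|heat Q t f x| <= \sum_y `|f y|.
Proof.
move=> t0; apply: (le_trans (ler_norm_sum _ _ _)); apply: ler_sum => y _.
rewrite normrM -[leRHS]mul1r ler_wpM2r// ger0_norm ?heat_kernel_le1//.
exact: (heat_kernel_ge0 hQ).
Qed.

Section Bounds.
Variables (e M : R) (rho u : X -> R) (r h : R).
Hypothesis e_gt0 : 0 < e.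
Hypothesis rho_dens : density pi rho.
Hypothesis rho_ge : forall x, e <= rho x.
Hypothesis u_le : forall x, `|u x| <= M.
Hypothesis r01 : 0 <= r <= 1.
Hypothesis h01 : 0 <= h <= 1.

Let hr0 : 0 <= h * r. Proof. by apply: mulr_ge0; [case/andP: h01|case/andP: r01]. Qed.
Let khr : 0 <= kappa * h * r <= kappa.
Proof.
move: h01 r01 => /andP[h0 h1] /andP[r0 r1].
rewrite -mulrA mulr_ge0//= -[leRHS]mulr1 ler_wpM2l// -[leRHS]mulr1 ler_pM//.
Qed.

Let hdens : density pi (heat Q (h * r) rho).
Proof. exact: (heat_density hQ). Qed.

Let H0 : 0 <= entropy pi (heat Q (h * r) rho).
Proof. exact: entropy_ge0. Qed.
Let H1 : entropy pi (heat Q (h * r) rho) <= entropy_bound pi.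
Proof. exact: entropy_le. Qed.

Let w01 : 0 <= weight h r <= (1 + kappa) ^+ 2.
Proof.
case/andP: khr => k0 k1; rewrite sqr_ge0/= /weight lerXn2r// ?nnegrE ?addr_ge0//.
by rewrite lerD2l.
Qed.

Lemma weighted_entropy_bound :
  `|weighted_entropy rho r h| <= (1 + kappa) ^+ 2 * entropy_bound pi.
Proof.
case/andP: w01 => w0 w1.
by rewrite /weighted_entropy ger0_norm; [exact: ler_pM|exact: mulr_ge0].
Qed.

(** The part of the derivative that stems from the weight is O(h); integrated over the heat time it
    becomes the h^2 error. *)
Lemma weighted_entropy_deriv_slack : 2 * kappa * h * (1 + kappa * h * r) *
  entropy pi (heat Q (h * r) rho) <= 2 * kappa * (1 + kappa) * entropy_bound pi * h.
Proof.
case/andP: khr => k0 k1; case/andP: h01 => h0 h1.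
have k2 : 0 <= 2 * kappa * h by rewrite !mulr_ge0.
have a1 : 1 + kappa * h * r <= 1 + kappa by rewrite lerD2l.
have a0 : 0 <= 1 + kappa * h * r by rewrite addr_ge0.
rewrite [leRHS](_ : _ = 2 * kappa * h * (1 + kappa) * entropy_bound pi); last by ring.
apply: ler_pM => //; first exact: mulr_ge0.
exact: ler_wpM2l.
Qed.

(** Only its independence of r and h matters: it dominates the integrand when differentiating under
    the integral over the heat time. The evolved densities lie between e and 1 / pi x, which
    controls the logarithms and the generator. *)
Definition deriv_bound : R :=
  2 * kappa * (1 + kappa) * entropy_bound pi + (1 + kappa) ^+ 2 *
  (\sum_x pi x * ((`|ln e| + `|ln (pi x)| + 1) *
    (\sum_y Q x y * (2 * \sum_z (pi z)^-1) + \sum_(z : X) M))).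

Lemma weighted_entropy_deriv_bound : `|weighted_entropy_deriv rho u r h| <= deriv_bound.
Proof.
case/andP: khr => k0 k1; case/andP: h01 => h0 h1; case/andP: w01 => w0 w1.
apply: (le_trans (ler_normD _ _)); apply: lerD.
  rewrite ger0_norm; last by rewrite !mulr_ge0// addr_ge0.
  apply: (le_trans weighted_entropy_deriv_slack).
  rewrite -[leRHS]mulr1 ler_wpM2l// !mulr_ge0 ?addr_ge0//.
  exact: le_trans H0 H1.
rewrite normrM (ger0_norm w0); apply: ler_pM => //.
apply: (le_trans (ler_norm_sum _ _ _)); apply: ler_sum => x _.
rewrite normrM (gtr0_norm (pi_gt0 x)) ler_wpM2l ?(ltW (pi_gt0 x))//.
have ge : e <= heat Q (h * r) rho x by exact: (heat_ge hQ).
have g0 : 0 < heat Q (h * r) rho x by exact: lt_le_trans ge.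
rewrite normrM; apply: ler_pM => //.
  apply: (le_trans (ler_normD _ _)); rewrite normr1 lerD2r ler_norml; apply/andP; split.
    rewrite opprD; apply: (@le_trans _ _ (- `|ln e|)).
      by rewrite gerDl oppr_le0.
    rewrite lerNl; apply: (@le_trans _ _ (- ln e)); last by rewrite -normrN ler_norm.
    by rewrite lerN2 ler_ln ?posrE.
  apply: (@le_trans _ _ (ln (pi x)^-1)).
    by rewrite ler_ln ?posrE ?invr_gt0//; exact: density_le.
  rewrite lnV ?posrE//; apply: (@le_trans _ _ `|ln (pi x)|); first by rewrite -normrN ler_norm.
  by rewrite lerDr.
apply: (le_trans (ler_normD _ _)); apply: lerD; last first.
  by apply: (le_trans (heat_norm _ _ hr0)); apply: ler_sum.
rewrite normrM ger0_norm// -[leRHS]mul1r; apply: ler_pM => //.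
apply: (le_trans (ler_norm_sum _ _ _)); apply: ler_sum => y _.
rewrite normrM (ger0_norm (rate_ge0 hQ x y)) ler_wpM2l ?(rate_ge0 hQ)//.
have b z : `|heat Q (h * r) rho z| <= \sum_z (pi z)^-1.
  have [p0 _] := hdens; rewrite ger0_norm//.
  apply: (le_trans (density_le pi_gt0 z hdens)).
  rewrite (bigD1 z)//= lerDl; apply: sumr_ge0 => y' _; rewrite invr_ge0; exact/ltW.
by apply: (le_trans (ler_normB _ _)); rewrite mulr2n mulrDl mul1r lerD.
Qed.

End Bounds.

End HeatPiece.

(** * The weighted speed estimate on one C1 piece *)

Section HeatPiece2.
Variables (R : realType) (X : finType) (Q : X -> X -> R) (pi : X -> R).
Hypothesis hQ : markov_triple Q pi.
Variable kappa : R.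
Hypothesis kappa_ge0 : 0 <= kappa.

Let pi_gt0 x : 0 < pi x. Proof. exact: stationary_gt0 hQ x. Qed.
Let pi_sum : \sum_x pi x = 1. Proof. exact: stationary_sum hQ. Qed.
Local Notation mu := (@lebesgue_measure R).
Local Notation wH := (weighted_entropy Q pi kappa).
Local Notation wH' := (weighted_entropy_deriv Q pi kappa).

Variables (e s t h : R) (g g' : R -> X -> R).
Hypothesis e_gt0 : 0 < e.
Hypothesis s0 : 0 <= s.
Hypothesis st : s < t.
Hypothesis t1 : t <= 1.
Hypothesis h_gt0 : 0 < h.
Hypothesis h1 : h <= 1.
Hypothesis g_C1 : forall x, C1_on (g ^~ x) (g' ^~ x) s t.
Hypothesis g_dens : forall r, r \in `[s, t] -> density pi (g r).
Hypothesis g_ge : forall r, r \in `[s, t] -> forall x, e <= g r x.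

Let r01 r : r \in `[s, t] -> 0 <= r <= 1.
Proof.
rewrite in_itv/= => /andP[sr rt]; apply/andP; split; first exact: le_trans sr.
exact: le_trans t1.
Qed.

Let h01 (k : R) : k \in `[0, h] -> 0 <= k <= 1.
Proof. by rewrite in_itv/= => /andP[-> kh]; exact: le_trans h1. Qed.

Let kr0 k r : k \in `[0, h] -> r \in `[s, t] -> 0 <= k * r.
Proof. by move=> /h01/andP[k0 _] /r01/andP[r0 _]; exact: mulr_ge0. Qed.

Let g_gt0 r : r \in `[s, t] -> forall x, 0 < g r x.
Proof. by move=> rst x; exact: lt_le_trans (g_ge rst x). Qed.

Let g'_bound : exists M, forall r, r \in `[s, t] -> forall x, `|g' r x| <= M.
Proof.
have B x : exists M, forall r, r \in `[s, t] -> `|g' r x| <= M.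
  have [_ _ c] := g_C1 x; have [M _ hM] := clamp_bounded (ltW st) c.
  by exists M.
have /choice [M hM] := B.
exists (\sum_x `|M x|) => r rst x; apply: (le_trans (hM x r rst)).
apply: (le_trans (ler_norm _)); rewrite (bigD1 x)//= lerDl.
exact: sumr_ge0.
Qed.

(** The weighted entropy at curve time r, accumulated over heat times in [0, h]. Its values at the
    two ends are what remains after integrating [heat_speed_le] along a curve. *)
Definition entropy_action (r : R) : R := \int[mu]_(k in `[0, h]) wH (g r) r k.
Definition entropy_action_deriv (r : R) : R := \int[mu]_(k in `[0, h]) wH' (g r) (g' r) r k.

Let cont_wH r k : r \in `[s, t] -> k \in `[0, h] -> {for k, continuous (wH (g r) r)}.
Proof.
move=> rst k0h.
exact: (@cvg_weighted_entropy _ _ _ _ hQ kappa _ (nbhs k) _ (fun=> g r) (fun=> r) id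
  (g r) r k (fun x => cvg_cst _) (cvg_cst _) cvg_id (g_gt0 rst) (kr0 k0h rst)).
Qed.

Let cont_wH' r k : r \in `[s, t] -> k \in `[0, h] -> {for k, continuous (wH' (g r) (g' r) r)}.
Proof.
move=> rst k0h.
exact: (@cvg_weighted_entropy_deriv _ _ _ _ hQ kappa _ (nbhs k) _ (fun=> g r) (fun=> g' r)
  (fun=> r) id (g r) (g' r) r k (fun x => cvg_cst _) (fun x => cvg_cst _) (cvg_cst _) cvg_id
  (g_gt0 rst) (kr0 k0h rst)).
Qed.

Let int_wH r : r \in `[s, t] -> mu.-integrable `[0, h] (EFin \o wH (g r) r).
Proof. by move=> rst; apply: integrable_itv => k; exact: cont_wH. Qed.

Let int_wH' r : r \in `[s, t] -> mu.-integrable `[0, h] (EFin \o wH' (g r) (g' r) r).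
Proof. by move=> rst; apply: integrable_itv => k; exact: cont_wH'. Qed.

Let int_cst (M : R) : mu.-integrable `[0, h] (EFin \o cst M).
Proof. by apply: integrable_itv => k _; exact: cvg_cst. Qed.

Let der_wH r k : r \in `]s, t[ -> k \in `[0, h] ->
  is_derive r (1 : R) (fun r => wH (g r) r k) (wH' (g r) (g' r) r k).
Proof.
move=> rst k0h; have rst' := subset_itv_oo_cc rst.
apply: (is_derive_weighted_entropy hQ).
- exact: kr0.
- exact: g_gt0.
- by move=> x; have [d _ _] := g_C1 x; exact: d.
Qed.

Lemma entropy_action_C1 : C1_on entropy_action entropy_action_deriv s t.
Proof.
have [M gM] := g'_bound.
set B := deriv_bound Q pi kappa e M.
have bnd r k : r \in `[s, t] -> k \in `[0, h] -> `|wH' (g r) (g' r) r k| <= B.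
  move=> rst k0h; apply: weighted_entropy_deriv_bound => //.
  - exact: g_dens.
  - exact: g_ge.
  - exact: gM.
  - exact: r01.
  - exact: h01.
have cc (F : R -> X -> R) : (forall x, continuous ((F ^~ x) \o clamp s t)) ->
    forall r x, F (clamp s t z) x @[z --> r] --> F (clamp s t r) x.
  by move=> cF r x; exact: cF.
have cg : forall r x, g (clamp s t z) x @[z --> r] --> g (clamp s t r) x.
  by apply: cc => x; have [] := g_C1 x.
have cg' : forall r x, g' (clamp s t z) x @[z --> r] --> g' (clamp s t r) x.
  by apply: cc => x; have [] := g_C1 x.
have cl r : clamp s t r \in `[s, t] by exact: clamp_itv (ltW st).
split.
- move=> r rst; pose f (r k : R) := wH (g r) r k.
  have intf z : `]s, t[%classic z -> mu.-integrable `[0, h] (EFin \o f z).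
    by move=> zst; apply: int_wH; exact: subset_itv_oo_cc zst.
  have derf z k : `]s, t[%classic z -> `[0, h]%classic k -> derivable (f ^~ k) z 1.
    by move=> zst k0h; have [] := der_wH zst k0h.
  have derE z k : `]s, t[%classic z -> `[0, h]%classic k ->
      partial1of2 f z k = wH' (g z) (g' z) z k.
    by move=> zst k0h; have [_ <-] := der_wH zst k0h; rewrite partial1of2E.
  have ub z k : `]s, t[%classic z -> `[0, h]%classic k -> `|partial1of2 f z k| <= cst B k.
    move=> zst k0h; rewrite derE//; apply: bnd => //; exact: subset_itv_oo_cc zst.
  have B0 (k : R) : 0 <= cst B k.
    apply: (le_trans (normr_ge0 (wH' (g r) (g' r) r 0))); apply: bnd.
      exact: subset_itv_oo_cc.
    by rewrite in_itv/= lexx ltW.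
  have dF := @derivable_under_integral R _ _ mu f `[0, h] _ r s t rst intf derf (cst B) B0
    (int_cst B) ub.
  have eF := @differentiation_under_integral R _ _ mu f `[0, h] _ r s t rst intf derf (cst B) B0
    (int_cst B) ub.
  apply: DeriveDef; first exact: dF.
  rewrite -derive1E eF//; apply: eq_Rintegral => k; rewrite inE => k0h; exact: derE.
- move=> r.
  apply: (@continuity_under_integral R _ _ mu (fun z k => wH (g (clamp s t z)) (clamp s t z) k)
    `[0, h] _ (r - 1) (r + 1) _ _ (cst ((1 + kappa) ^+ 2 * entropy_bound pi)) _ _ r) => //.
  + by move=> z _; exact: int_wH.
  + apply: aeW => k k0h z _.
    exact: (@cvg_weighted_entropy _ _ _ _ hQ kappa _ (nbhs z) _ (fun z => g (clamp s t z))
      (clamp s t) (fun=> k) _ _ k (cg z) (@continuous_clamp R s t z) (cvg_cst _)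
      (g_gt0 (cl z)) (kr0 k0h (cl z))).
  + move=> z _; apply: aeW => k k0h; apply: weighted_entropy_bound => //.
    * exact: g_dens.
    * exact: r01.
    * exact: h01.
  + by rewrite inE/= in_itv/= ltrDl gtrBl ltr01.
- move=> r.
  apply: (@continuity_under_integral R _ _ mu
    (fun z k => wH' (g (clamp s t z)) (g' (clamp s t z)) (clamp s t z) k)
    `[0, h] _ (r - 1) (r + 1) _ _ (cst B) _ _ r) => //.
  + by move=> z _; exact: int_wH'.
  + apply: aeW => k k0h z _.
    exact: (@cvg_weighted_entropy_deriv _ _ _ _ hQ kappa _ (nbhs z) _
      (fun z => g (clamp s t z)) (fun z => g' (clamp s t z)) (clamp s t) (fun=> k) _ _ _ k
      (cg z) (cg' z) (@continuous_clamp R s t z) (cvg_cst _)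
      (g_gt0 (cl z)) (kr0 k0h (cl z))).
  + by move=> z _; apply: aeW => k k0h; exact: bnd.
  + by rewrite inE/= in_itv/= ltrDl gtrBl ltr01.
Qed.

Hypothesis hess : forall rho psi : X -> R, (forall x, 0 < rho x) ->
  kappa * metric_form Q pi rho psi <= hessian Q pi rho psi.

Lemma curve_velocity_mass r : r \in `]s, t[ -> \sum_x g' r x * pi x = 0.
Proof.
move=> rst; have d : is_derive r (1 : R) (fun z => \sum_x pi x * g z x) (\sum_x pi x * g' r x).
  apply: is_derive_fun_sum => x; apply: is_derive_funZ; have [d _ _] := g_C1 x; exact: d.
have d1 : is_derive r (1 : R) (fun z => \sum_x pi x * g z x) 0.
  apply: (@is_derive_near _ (cst 1)).
  have := near_in_itvoo rst; apply: filterS => z zst.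
  have [_ <-] := g_dens (subset_itv_oo_cc zst).
  by apply: eq_bigr => x _; rewrite mulrC.
have [_ e1] := d1; have [_ e2] := d; rewrite -[RHS]e1 [RHS]e2.
by refine (eq_bigr _ _) => x _; rewrite mulrC.
Qed.

(** Twice the constant of [weighted_entropy_deriv_slack], because the entropy enters with a factor
    2. *)
Definition evolution_error : R := 4 * kappa * (1 + kappa) * entropy_bound pi.

(* Gronwall-type estimate: d/dh of weight * speed is bounded by *)
(* - 2 * weight * (d/dr entropy), because hessian >= kappa * metric_form. *)
Lemma heat_speed_le r : r \in `]s, t[ ->
  weight kappa h r * speed Q pi (heat Q (h * r) (g r)) (heat_velocity Q r (g r) (g' r) h)
  <= speed Q pi (g r) (g' r) - 2 * entropy_action_deriv r + evolution_error * h ^+ 2.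
Proof.
move=> rst; have rst' := subset_itv_oo_cc rst.
have g0 := g_gt0 rst'; have m0 := curve_velocity_mass rst.
have [r0 r1] := andP (r01 rst').
have h0h : 0 <= h by exact: ltW.
pose G k := heat Q (k * r) (g r); pose V k := heat_velocity Q r (g r) (g' r) k.
pose psi k := onsager_inv Q pi (G k) (V k).
have Gpos k : k \in `[0, h] -> forall x, 0 < G k x.
  by move=> k0h x; apply: (heat_gt0 hQ) => //; exact: kr0.
have V0 k : \sum_x V k x * pi x = 0 by exact: heat_velocity_mass.
pose f k := weight kappa k r * speed Q pi (G k) (V k).
pose f' k := 2 * kappa * r * (1 + kappa * k * r) * speed Q pi (G k) (V k) +
  weight kappa k r * (- 2 * (\sum_x ln (G k x) * V k x * pi x)
    - 2 * r * hessian Q pi (G k) (psi k)).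
have df k : k \in `[0, h] -> is_derive k (1 : R) f (f' k).
  move=> k0h; apply: is_derive_funM; last first.
    by apply: is_derive_heat_speed => //; exact: kr0.
  have d1 : is_derive k (1 : R) (fun k => 1 + kappa * r * k) (0 + kappa * r).
    by apply: is_derive_funD; exact: is_derive_mulr.
  rewrite /weight (_ : (fun k => _) = (fun k => (1 + kappa * r * k) * (1 + kappa * r * k))).
    by apply: (is_derive_eq (is_derive_funM d1 d1)); ring.
  by apply/funext => z; rewrite expr2 mulrAC.
have [F dF] := primitive_itv h0h (fun k => @cont_wH' r k rst').
have JE : entropy_action_deriv r = F h - F 0.
  rewrite /entropy_action_deriv /Rintegral (FTC_itv h_gt0 dF)//.
  by move=> k; exact: cont_wH'.
pose C := evolution_error * h.
(* H is an antiderivative of the claimed upper bound for f', so that comparing derivatives on [0, h]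
   suffices. *)
pose H k := -2 * F k + C * k.
have dH k : k \in `[0, h] -> is_derive k (1 : R) H (-2 * wH' (g r) (g' r) r k + C).
  move=> k0h; apply: is_derive_funD; last exact: is_derive_mulr.
  by apply: is_derive_funZ; exact: dF.
have fh k : k \in `]0, h[ -> f' k <= -2 * wH' (g r) (g' r) r k + C.
  move=> k0h'; have k0h := subset_itv_oo_cc k0h'.
  have [k0 k1] := andP (h01 k0h).
  have kh : k <= h by move: k0h; rewrite in_itv/= => /andP[].
  have dens := g_dens rst'.
  have slack := weighted_entropy_deriv_slack hQ kappa_ge0 dens (r01 rst') (h01 k0h).
  have nn : 0 <= speed Q pi (G k) (V k) by apply: speed_ge0 => //; exact: Gpos.
  have hs : kappa * speed Q pi (G k) (V k) <= hessian Q pi (G k) (psi k).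
    rewrite speed_metric//; last exact: Gpos.
    by apply: hess; exact: Gpos.
  have Ed : entropy_deriv pi (G k) (V k) = \sum_x ln (G k x) * V k x * pi x.
    transitivity (\sum_x ln (G k x) * V k x * pi x + \sum_x V k x * pi x).
      by rewrite -big_split; apply: eq_bigr => x _ /=; ring.
    by rewrite V0 addr0.
  rewrite /weighted_entropy_deriv -/(G k) -/(V k) Ed /f'.
  have p1 : 1 <= 1 + kappa * k * r by rewrite lerDl !mulr_ge0.
  have e1 : 2 * kappa * (1 + kappa) * entropy_bound pi * k <= C / 2.
    rewrite /C /evolution_error; apply: (@le_trans _ _
      (2 * kappa * (1 + kappa) * entropy_bound pi * h)).
      rewrite ler_wpM2l// !mulr_ge0// ?addr_ge0//.
      exact: le_trans (entropy_ge0 pi_gt0 pi_sum dens) (entropy_le pi_gt0 dens).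
    by rewrite le_eqVlt; apply/orP; left; apply/eqP; field.
  (* Differentiating the weight leaves one factor 1 + kappa k r, while the Hessian term carries its
     square; the square is larger since kappa >= 0. *)
  have e2 : 2 * kappa * r * (1 + kappa * k * r) * speed Q pi (G k) (V k) <=
      weight kappa k r * (2 * r * hessian Q pi (G k) (psi k)).
    rewrite /weight.
    apply: (@le_trans _ _ ((1 + kappa * k * r) ^+ 2 * (2 * r * (kappa * speed Q pi (G k) (V k))))).
      rewrite [leLHS](_ : _ = (1 + kappa * k * r) *
        (2 * r * (kappa * speed Q pi (G k) (V k)))); last by ring.
      rewrite ler_wpM2r ?mulr_ge0// expr2 ler_peMr//; exact: le_trans ler01 p1.
    by rewrite ler_wpM2l ?sqr_ge0// ler_wpM2l// mulr_ge0.
  move: slack e1 e2; rewrite -/(G k).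
  set a := weight _ _ _; set b := \sum_x _; set d := hessian _ _ _ _.
  set u := 2 * kappa * k * _ * _; set v := 2 * kappa * r * _ * _.
  set y := 2 * kappa * (1 + kappa) * _ * k.
  clearbody a b d u v y C; move=> l1 l2 l3.
  have -> : a * (-2 * b - 2 * r * d) = - (2 * (a * b)) - a * (2 * r * d) by ring.
  by move: (a * b) (a * (2 * r * d)) l3 => ab ad l3; lra.
have := derive_le_itv h0h df dH fh.
have f0 : f 0 = speed Q pi (g r) (g' r).
  have e1 : G 0 = g r by apply/funext => x; rewrite /G mul0r (heat0 Q).
  have e2 : V 0 = g' r.
    by apply/funext => x; rewrite /V /heat_velocity !mul0r add0r (heat0 Q).
  by rewrite /f e1 e2 /weight mulr0 mul0r addr0 expr1n mul1r.
rewrite f0 JE /H /C -/(G h) -/(V h) -/(f h) mulr0.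
move: (f h) (speed _ _ _ _) (F h) (F 0) evolution_error => a b y z w; rewrite expr2; lra.
Qed.

End HeatPiece2.

(** * Energy bounds for piecewise C1 curves of densities *)

Section PiecewiseCurves.
Variables (R : realType) (X : finType) (Q : X -> X -> R) (pi : X -> R).
Hypothesis hQ : markov_triple Q pi.
Implicit Types (g : R -> X -> R) (w : R -> R) (e s t E : R).

Let pi_gt0 x : 0 < pi x. Proof. exact: stationary_gt0 hQ x. Qed.

(* E bounds the integral of w * (squared speed) along g on [s, t], through *)
(* piecewise C1 primitives P of upper bounds of the integrand. *)
Inductive pcurve w e g : R -> R -> R -> Prop :=
| pcurve_piece s t g' P P' : s < t ->
    (forall x, C1_on (g ^~ x) (g' ^~ x) s t) ->
    (forall r, r \in `[s, t] -> density pi (g r)) ->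
    (forall r, r \in `[s, t] -> forall x, e <= g r x) ->
    (forall r, r \in `]s, t[ -> forall x, 0 < g r x) ->
    C1_on P P' s t ->
    (forall r, r \in `]s, t[ -> w r * speed Q pi (g r) (g' r) <= P' r) ->
    pcurve w e g s t (P t - P s)
| pcurve_cat s m t E1 E2 : pcurve w e g s m E1 -> pcurve w e g m t E2 ->
    pcurve w e g s t (E1 + E2).

Local Notation one := (fun=> 1 : R).

Lemma pcurve_lt w e g s t E : pcurve w e g s t E -> s < t.
Proof. by elim=> // s' m t' E1 E2 _ sm _; exact: lt_trans. Qed.

Lemma pcurve_eq w e g1 g2 s t E : pcurve w e g1 s t E ->
  (forall r, r \in `[s, t] -> g1 r = g2 r) -> pcurve w e g2 s t E.
Proof.
elim=> {s t E} [s t g' P P' st C dens ge pos CP le E|s m t E1 E2 c1 ih1 c2 ih2 E].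
  have Eo r : r \in `]s, t[ -> g1 r = g2 r by move=> /subset_itv_oo_cc; exact: E.
  apply: (@pcurve_piece _ _ _ _ _ g' P P' st _ _ _ _ CP).
  - by move=> x; apply: C1_on_eq (ltW st) _ (C x) => r /E ->.
  - by move=> r rst; rewrite -(E r rst); exact: dens.
  - by move=> r rst; rewrite -(E r rst); exact: ge.
  - by move=> r rst; rewrite -(Eo r rst); exact: pos.
  - by move=> r rst; rewrite -(Eo r rst); exact: le.
have sm := pcurve_lt c1; have mt := pcurve_lt c2.
apply: pcurve_cat.
  apply: ih1 => r; rewrite in_itv/= => /andP[sr rm]; apply: E.
  by rewrite in_itv/= sr (le_trans rm)// ltW.
apply: ih2 => r; rewrite in_itv/= => /andP[mr rt]; apply: E.
by rewrite in_itv/= rt (le_trans _ mr)// ltW.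
Qed.

Lemma pcurve_weaken w e e' g s t E : e' <= e -> pcurve w e g s t E ->
  pcurve w e' g s t E.
Proof.
move=> ee; elim=> {s t E} [s t g' P P' st C dens ge pos CP le|s m t E1 E2 _ c1 _ c2].
  apply: (@pcurve_piece _ _ _ _ _ g' P P' st C dens _ pos CP le) => r rst x.
  exact: le_trans ee (ge r rst x).
exact: pcurve_cat c1 c2.
Qed.

Lemma pcurve_glue w e g1 g2 s m t E1 E2 : g1 m = g2 m ->
  pcurve w e g1 s m E1 -> pcurve w e g2 m t E2 ->
  pcurve w e (fun r => if r <= m then g1 r else g2 r) s t (E1 + E2).
Proof.
move=> gm c1 c2; apply: (@pcurve_cat _ _ _ _ m).
  by apply: pcurve_eq c1 _ => r; rewrite in_itv/= => /andP[_ ->].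
apply: pcurve_eq c2 _ => r; rewrite in_itv/= => /andP[mr _].
case: leP => // rm; have -> : r = m by apply/eqP; rewrite eq_le rm mr.
by rewrite gm.
Qed.

Lemma pcurve_reverse e g s t E : pcurve one e g s t E ->
  pcurve one e (fun r => g (- r)) (- t) (- s) E.
Proof.
have opp_cc (a b u : R) : (u \in `[- b, - a]) = (- u \in `[a, b] : bool).
  by rewrite !in_itv/= lerNl lerNr andbC.
have opp_oo (a b u : R) : (u \in `]- b, - a[) = (- u \in `]a, b[ : bool).
  by rewrite !in_itv/= ltrNl ltrNr andbC.
have dopp (u : R) : is_derive u (1 : R) (fun u => - u) (-1).
  exact: is_derive_funN.
elim=> {s t E} [s t g' P P' st C dens ge pos CP le|s m t E1 E2 _ c1 _ c2]; last first.
  by rewrite addrC; exact: pcurve_cat c2 c1.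
have comp f f' : C1_on f f' s t ->
    C1_on (fun u => f (- u)) (fun u => -1 * f' (- u)) (- t) (- s).
  move=> Cf; have ts : - t <= - s by rewrite lerN2 ltW.
  apply: (@C1_on_comp R f f' (fun u => - u) (fun=> -1) s t (- t) (- s) ts Cf).
  - by move=> u _; exact: cvg_cst.
  - by move=> u; rewrite opp_cc.
  - by move=> u; rewrite opp_oo.
have -> : P t - P s = - P (- - s) - (- P (- - t)) by rewrite !opprK addrC.
apply: (@pcurve_piece _ _ _ _ _ (fun u x => -1 * g' (- u) x) (fun u => - P (- u))
  (fun u => P' (- u))).
- by rewrite ltrN2.
- by move=> x; exact: (comp _ _ (C x)).
- by move=> r; rewrite opp_cc; exact: dens.
- by move=> r; rewrite opp_cc; exact: ge.
- by move=> r; rewrite opp_oo; exact: pos.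
- have := C1_onZ (-1) (comp _ _ CP).
  congr (C1_on _ _ _ _); apply/funext => u; first by rewrite mulN1r.
  by rewrite mulrA mulN1r opprK mul1r.
- move=> r; rewrite opp_oo => rst; rewrite speedZ sqrrN expr1n mul1r; exact: le.
Qed.

(** U inverts r and transports the partition points. The squared speed picks up r'^2: one factor is
    bounded by C * w, the other is the Jacobian of the change of time. *)
Lemma pcurve_reparam w e g s t E (C S T : R) (U r r' : R -> R) :
  pcurve w e g s t E -> S <= s -> t <= T -> 0 <= C ->
  {in `[S, T] &, {homo U : x y / x < y}} ->
  (forall x, x \in `[S, T] -> r (U x) = x) ->
  {in `[U S, U T] &, {homo r : x y / x < y}} ->
  (forall u, u \in `[U S, U T] -> is_derive u (1 : R) r (r' u)) ->
  (forall u, u \in `[U S, U T] -> {for u, continuous r'}) ->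
  (forall u, u \in `[U S, U T] -> 0 <= r' u <= C * w (r u)) ->
  pcurve one e (g \o r) (U s) (U t) (C * E).
Proof.
move=> c + + C0 homU rU homr dr cr' rw.
elim: c => {s t E} [s t g' P P' st Cg dens ge pos CP le Ss tT
  |s m t E1 E2 c1 ih1 c2 ih2 Ss tT]; last first.
  have sm := pcurve_lt c1; have mt := pcurve_lt c2.
  rewrite mulrDr; apply: pcurve_cat.
    by apply: ih1 => //; rewrite (le_trans _ tT)// ltW.
  by apply: ih2 => //; rewrite (le_trans Ss)// ltW.
have sST : s \in `[S, T] by rewrite in_itv/= Ss (le_trans _ tT)// ltW.
have tST : t \in `[S, T] by rewrite in_itv/= tT (le_trans Ss)// ltW.
have SST : S \in `[S, T] by move: sST; rewrite !in_itv/= lexx => /andP[h1 h2]; exact: le_trans h2.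
have TST : T \in `[S, T] by move: sST; rewrite !in_itv/= lexx andbT => /andP[h1 h2];
  exact: le_trans h2.
have leU x y : x \in `[S, T] -> y \in `[S, T] -> x <= y -> U x <= U y.
  by move=> xS yS; rewrite le_eqVlt => /predU1P[->//|xy]; exact/ltW/homU.
have UST x : x \in `[S, T] -> U x \in `[U S, U T].
  move=> xS; move: (xS); rewrite !in_itv/= => /andP[h1 h2].
  by rewrite !leU.
have ler x y : x \in `[U S, U T] -> y \in `[U S, U T] -> x <= y -> r x <= r y.
  by move=> xS yS; rewrite le_eqVlt => /predU1P[->//|xy]; exact/ltW/homr.
have Ust : U s < U t by exact: homU.
have sub u : u \in `[U s, U t] -> u \in `[U S, U T].
  rewrite !in_itv/= => /andP[h1 h2]; have := UST _ sST; have := UST _ tST.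
  rewrite !in_itv/= => /andP[_ h3] /andP[h4 _].
  by rewrite (le_trans h4)// (le_trans h2).
have rcc u : u \in `[U s, U t] -> r u \in `[s, t].
  move=> ust; have := sub _ ust; move: (ust); rewrite !in_itv/= => /andP[h1 h2] uST.
  by rewrite -[X in X <= _](rU s)// -[X in _ && (_ <= X)](rU t)// !ler// UST.
have roo u : u \in `]U s, U t[ -> r u \in `]s, t[.
  move=> ust; have := sub _ (subset_itv_oo_cc ust).
  move: ust; rewrite !in_itv/= => /andP[h1 h2] uST.
  by rewrite -[X in X < _](rU s)// -[X in _ && (_ < X)](rU t)// !homr// UST.
have comp f f' : C1_on f f' s t ->
    C1_on (f \o r) (fun u => r' u * f' (r u)) (U s) (U t).
  move=> Cf; exact: (@C1_on_comp R f f' r r' s t (U s) (U t) (ltW Ust) Cf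
    (fun u h => dr _ (sub _ h)) (fun u h => cr' _ (sub _ h)) rcc roo).
have -> : C * (P t - P s) = C * P (r (U t)) - C * P (r (U s)) by rewrite !rU// mulrBr.
apply: (@pcurve_piece _ _ _ _ _ (fun u x => r' u * g' (r u) x) (fun u => C * P (r u))
  (fun u => C * (r' u * P' (r u))) Ust).
- by move=> x; exact: (comp _ _ (Cg x)).
- by move=> u ust; apply: dens; exact: rcc.
- by move=> u ust; apply: ge; exact: rcc.
- by move=> u ust; apply: pos; exact: roo.
- exact: C1_onZ (comp _ _ CP).
- move=> u ust; rewrite mul1r speedZ; have rst := roo _ ust.
  have /andP[r0 rC] := rw _ (sub _ (subset_itv_oo_cc ust)).
  have n0 : 0 <= speed Q pi (g (r u)) (g' (r u)).
    apply: speed_ge0 => //; first exact: pos.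
    exact: (curve_velocity_mass Cg dens).
  rewrite mulrCA expr2 -mulrA ler_wpM2l//.
  apply: (le_trans (ler_wpM2r n0 rC)); rewrite -mulrA ler_wpM2l//; exact: le.
Qed.

Lemma pcurve_affine e g s t E (k l : R) : 0 < k -> pcurve one e g s t E ->
  pcurve one e (fun u => g ((u - l) / k)) (k * s + l) (k * t + l) (k^-1 * E).
Proof.
move=> k0 c; have ki : 0 < k^-1 by rewrite invr_gt0.
apply: (@pcurve_reparam one _ _ _ _ _ k^-1 s t (fun x => k * x + l)
  (fun u => (u - l) / k) (fun=> k^-1) c) => //.
- exact: ltW.
- by move=> x y _ _ xy; rewrite ltrD2r ltr_pM2l.
- by move=> x _; rewrite addrK mulrAC divff ?mul1r// gt_eqF.
- by move=> x y _ _ xy; rewrite ltr_pM2r// ltrD2r.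
- move=> u _; apply: (is_derive_eq (is_derive_funM (is_derive_funB (is_derive_id _ _)
    (is_derive_cst l _ _)) (is_derive_cst k^-1 _ _))).
  by rewrite subr0 mul1r mulr0 addr0.
- by move=> u _; exact: cvg_cst.
- by move=> u _; rewrite mulr1 lexx (ltW ki).
Qed.

End PiecewiseCurves.

(** * Heat evolution, removal of the weight, mixing *)

Section CurveTransformations.
Variables (R : realType) (X : finType) (Q : X -> X -> R) (pi : X -> R).
Hypothesis hQ : markov_triple Q pi.
Implicit Types (g : R -> X -> R) (w : R -> R) (e s t E : R).

Let pi_gt0 x : 0 < pi x. Proof. exact: stationary_gt0 hQ x. Qed.
Local Notation one := (fun=> 1 : R).
Local Notation pcurve := (pcurve Q pi).

(** [heat_speed_le] holds on each piece, and the entropy terms telescope under concatenation because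
    [entropy_action] depends only on the curve at the break point. *)
Lemma pcurve_heat (kappa e h : R) g s t E : 0 <= kappa ->
  (forall rho psi : X -> R, (forall x, 0 < rho x) ->
    kappa * metric_form Q pi rho psi <= hessian Q pi rho psi) ->
  0 < e -> 0 < h -> h <= 1 -> pcurve one e g s t E -> 0 <= s -> t <= 1 ->
  pcurve (weight kappa h) e (fun r => heat Q (h * r) (g r)) s t
   (E + 2 * (entropy_action Q pi kappa h g s - entropy_action Q pi kappa h g t)
    + evolution_error pi kappa * h ^+ 2 * (t - s)).
Proof.
move=> k0 hess e0 h0 h1; set J := entropy_action Q pi kappa h g; set W := evolution_error _ _ * _.
elim=> {s t E} [s t g' P P' st C dens ge pos CP le s0 t1|s m t E1 E2 p1 c1 p2 c2 s0 t1]; last first.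
  have sm := pcurve_lt p1; have mt := pcurve_lt p2.
  have m1 : m <= 1 by exact: le_trans (ltW mt) t1.
  have m0 : 0 <= m by exact: le_trans s0 (ltW sm).
  have := pcurve_cat (c1 s0 m1) (c2 m0 t1); congr (pcurve _ _ _ _ _).
  by move: (J s) (J m) (J t) => a b d; ring.
have CJ := entropy_action_C1 hQ k0 e0 s0 st t1 h0 h1 C dens ge.
set J' := entropy_action_deriv _ _ _ _ _ _ in CJ.
have cl r : clamp s t r \in `[s, t] by exact: clamp_itv (ltW st).
have hr0 r : r \in `[s, t] -> 0 <= h * r.
  rewrite in_itv/= => /andP[sr _]; apply: mulr_ge0; first exact: ltW.
  exact: le_trans sr.
have gpos r : r \in `[s, t] -> forall x, 0 < g r x.
  by move=> rst x; exact: lt_le_trans e0 (ge r rst x).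
have cg r x : g (clamp s t z) x @[z --> r] --> g (clamp s t r) x.
  by have [_ c _] := C x; exact: c.
have cg' r x : g' (clamp s t z) x @[z --> r] --> g' (clamp s t r) x.
  by have [_ _ c] := C x; exact: c.
have CP2 := C1_onD (C1_onD CP (C1_onZ (-2) CJ)) (C1_on_affine W 0 (ltW st)).
have -> : P t - P s + 2 * (J s - J t) + W * (t - s) =
    (P t + -2 * J t + (W * t + 0)) - (P s + -2 * J s + (W * s + 0)).
  by move: (J s) (J t) (P s) (P t) => a b d f; ring.
apply: (@pcurve_piece _ _ _ _ _ _ _ s t (fun r => heat_velocity Q r (g r) (g' r) h)
  (fun r => P r + -2 * J r + (W * r + 0)) _ st _ _ _ _ CP2).
- move=> x; split.
  + move=> r rst; apply: (is_derive_heat_curve hQ) => y.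
    by have [d _ _] := C y; exact: d.
  + move=> r; apply: (cvg_heat hQ); last exact: cg.
    by apply: cvgM; [exact: cvg_cst|exact: continuous_clamp].
  + move=> r; exact: (@cvg_heat_velocity _ _ _ _ hQ R (nbhs r) _ (fun z => g (clamp s t z))
      (fun z => g' (clamp s t z)) (clamp s t) (fun=> h) _ _ _ h (cg r) (cg' r)
      (@continuous_clamp R s t r) (cvg_cst _)).
- by move=> r rst; apply: (heat_density hQ); [exact: hr0|exact: dens].
- by move=> r rst x; apply: (heat_ge hQ); [exact: hr0|exact: ge].
- move=> r rst x; have rst' := subset_itv_oo_cc rst.
  by apply: (heat_gt0 hQ); [exact: hr0|exact: gpos].
- move=> r rst; apply: (le_trans (heat_speed_le hQ k0 e0 s0 t1 h0 h1 C dens ge hess rst)).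
  have := le r rst; rewrite mul1r -/J' -/W.
  by move: (speed _ _ _ _) (J' r) (P' r) => a b d; lra.
Qed.

Let mobius (a u : R) : R := u / (1 + a * (1 - u)).
Let mobius_inv (a s : R) : R := s * (1 + a) / (1 + a * s).

(* The change of time s = u / (1 + a (1 - u)) satisfies *)
(* ds/du = (1 + a s)^2 / (1 + a), which turns the weight into a constant. *)
Lemma pcurve_unweight (kappa h e : R) g E : 0 <= kappa -> 0 <= h ->
  pcurve (weight kappa h) e g 0 1 E ->
  exists g1, [/\ pcurve one e g1 0 1 ((1 + kappa * h)^-1 * E), g1 0 = g 0 & g1 1 = g 1].
Proof.
move=> k0 h0 c; set a := kappa * h.
have a0 : 0 <= a by exact: mulr_ge0.
have a1 : 0 < 1 + a by rewrite ltr_pwDl.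
have d1 (u : R) : u \in `[0, 1] -> 0 < 1 + a * (1 - u).
  by rewrite in_itv/= => /andP[_ u1]; rewrite ltr_pwDl// mulr_ge0// subr_ge0.
have d2 (x : R) : x \in `[0, 1] -> 0 < 1 + a * x.
  by rewrite in_itv/= => /andP[x0 _]; rewrite ltr_pwDl// mulr_ge0.
have U0 : mobius_inv a 0 = 0 by rewrite /mobius_inv !mul0r.
have U1 : mobius_inv a 1 = 1 by rewrite /mobius_inv mulr1 mul1r divff// gt_eqF.
have r0 : mobius a 0 = 0 by rewrite /mobius mul0r.
have r1 : mobius a 1 = 1 by rewrite /mobius subrr mulr0 addr0 divr1.
exists (g \o mobius a); split; last 2 first.
- by rewrite /= r0.
- by rewrite /= r1.
rewrite -[X in pcurve _ _ _ X]U0 -[X in pcurve _ _ _ _ X]U1.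
apply: (@pcurve_reparam _ _ _ _ hQ _ _ _ _ _ _ _ 0 1 (mobius_inv a) (mobius a)
  (fun u => (1 + a) / (1 + a * (1 - u)) ^+ 2) c) => //; rewrite ?U0 ?U1.
- by rewrite invr_ge0 ltW.
- move=> x y x01 y01 xy; rewrite /mobius_inv ltr_pdivrMr ?d2// mulrAC ltr_pdivlMr ?d2//.
  by move: a1; nra.
- move=> x x01; have := d2 _ x01 => dx; rewrite /mobius /mobius_inv.
  have e1 : 1 + a * (1 - x * (1 + a) / (1 + a * x)) = (1 + a) / (1 + a * x).
    by field; rewrite gt_eqF.
  by rewrite e1; field; rewrite !gt_eqF.
- move=> x y x01 y01 xy; rewrite /mobius ltr_pdivrMr ?d1// mulrAC ltr_pdivlMr ?d1//.
  by move: a1; nra.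
- move=> u u01; have du := d1 _ u01.
  have dd : is_derive u (1 : R) (fun u => 1 + a * (1 - u)) (0 + a * (0 - 1)).
    apply: is_derive_funD; apply: is_derive_funZ; exact: is_derive_funB.
  have di : is_derive u (1 : R) (fun u => (1 + a * (1 - u))^-1)
      (- (1 + a * (1 - u)) ^- 2 * (0 + a * (0 - 1))).
    have nz : 1 + a * (1 - u) != 0 by rewrite gt_eqF.
    exact: (@is_deriveV R (fun u => 1 + a * (1 - u)) u _ 1 nz dd).
  apply: (is_derive_eq (is_derive_funM (is_derive_id _ _) di)).
  by field; rewrite gt_eqF.
- move=> u u01; have du := d1 _ u01.
  apply: cvgM; first exact: cvg_cst.
  apply: cvgV; first by rewrite expf_neq0// gt_eqF.
  rewrite expr2; under eq_fun do rewrite expr2.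
  have cd : 1 + a * (1 - z) @[z --> u] --> 1 + a * (1 - u).
    apply: cvgD; first exact: cvg_cst.
    by apply: cvgM; [exact: cvg_cst|apply: cvgB; [exact: cvg_cst|exact: cvg_id]].
  exact: cvgM.
- move=> u u01; have du := d1 _ u01; rewrite divr_ge0 ?sqr_ge0 ?(ltW a1)//=.
  rewrite /weight -/a /mobius le_eqVlt; apply/orP; left; apply/eqP.
  by field; rewrite !gt_eqF.
Qed.

(** The bound rho >= m makes the metric form at rho at least m times the one at the constant
    density; the dual formula at the constant density, tested with m * psi, inverts this
    inequality. *)
Lemma speed_le_unif (m : R) (rho v : X -> R) : 0 < m -> (forall x, m <= rho x) ->
  \sum_x v x * pi x = 0 -> speed Q pi rho v <= m^-1 * speed Q pi (fun=> 1) v.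
Proof.
move=> m0 mr v0; have r0 x : 0 < rho x by exact: lt_le_trans (mr x).
have o0 (x : X) : 0 < (fun=> 1 : R) x by [].
set psi := onsager_inv Q pi rho v.
have f1 : m * metric_form Q pi (fun=> 1) psi <= metric_form Q pi rho psi.
  rewrite /metric_form mulrCA ler_wpM2l// mulr_sumr; apply: ler_sum => x _.
  rewrite mulr_sumr; apply: ler_sum => y _; rewrite theta_diag// mulr1.
  rewrite [leLHS](_ : _ = (psi x - psi y) ^+ 2 * m * Q x y * pi x); last by ring.
  rewrite ler_wpM2r ?(ltW (pi_gt0 x))// ler_wpM2r ?(rate_ge0 hQ)// ler_wpM2l ?sqr_ge0//.
  exact: theta_ge_min.
have := speed_ge hQ (fun x => m * psi x) o0 v0.
have -> : metric_form Q pi (fun=> 1) (fun x => m * psi x) =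
    m ^+ 2 * metric_form Q pi (fun=> 1) psi.
  clearbody psi; rewrite /metric_form [RHS]mulrCA; congr (_ * _); rewrite [RHS]mulr_sumr.
  apply: eq_bigr => x _; rewrite [RHS]mulr_sumr; apply: eq_bigr => y _.
  by move: (theta _ _) => a; ring.
have -> : \sum_x (m * psi x) * v x * pi x = m * speed Q pi rho v.
  by rewrite /speed mulr_sumr; apply: eq_bigr => x _; rewrite -/psi; ring.
have es : speed Q pi rho v = metric_form Q pi rho psi := speed_metric hQ r0 v0.
rewrite ler_pdivlMl//; move: f1; rewrite -es.
move: (speed _ _ _ _) (speed _ _ _ _) (metric_form _ _ _ _) => a b d h1 h2.
apply: le_trans h2; rewrite -subr_ge0.
rewrite [leRHS](_ : _ = m * (b - m * d)); last by ring.
by rewrite mulr_ge0 ?(ltW m0)// subr_ge0.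
Qed.

Definition mix (e : R) (rho : X -> R) : X -> R := fun x => (1 - e) * rho x + e.

Lemma mix_density e rho : 0 <= e <= 1 -> density pi rho -> density pi (mix e rho).
Proof.
move=> /andP[e0 e1] [r0 r1]; split.
  by move=> x; rewrite addr_ge0// mulr_ge0// subr_ge0.
rewrite /mix; under eq_bigr do rewrite mulrDl -mulrA.
by rewrite big_split/= -!mulr_sumr r1 (stationary_sum hQ) !mulr1 subrK.
Qed.

Lemma mix_ge e rho : 0 <= e <= 1 -> density pi rho -> forall x, e <= mix e rho x.
Proof. by move=> /andP[e0 e1] [r0 _] x; rewrite lerDr mulr_ge0// subr_ge0. Qed.

(* The parametrization by the square keeps the energy finite, even when rho *)
(* vanishes somewhere. *)
Lemma pcurve_mix rho (e : R) : 0 < e <= 1 -> density pi rho ->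
  exists g, [/\ pcurve one 0 g 0 1 (4 * e * speed Q pi (fun=> 1) (fun x => 1 - rho x)),
    g 0 = rho & g 1 = mix e rho].
Proof.
move=> /andP[e0 e1] dens; exists (fun r => mix (e * r ^+ 2) rho).
set C := speed _ _ _ _.
have er (r : R) : r \in `[0, 1] -> 0 <= e * r ^+ 2 <= 1.
  rewrite in_itv/= => /andP[r0 r1]; rewrite mulr_ge0 ?sqr_ge0 ?(ltW e0)//=.
  rewrite -[leRHS]mulr1 ler_pM ?sqr_ge0 ?(ltW e0)//; exact: exprn_ile1.
split; last 2 first.
- by apply/funext => x; rewrite /mix expr0n mulr0 subr0 mul1r addr0.
- by apply/funext => x; rewrite /mix expr1n mulr1.
have -> : 4 * e * C = (4 * e * C * 1 + 0) - (4 * e * C * 0 + 0) by ring.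
apply: (@pcurve_piece _ _ _ _ _ _ _ 0 1 (fun r x => 2 * e * r * (1 - rho x))
  (fun r => 4 * e * C * r + 0) (fun=> 4 * e * C) ltr01).
- move=> x; apply: C1_on_is_derive => // r _.
    have d2 : is_derive r (1 : R) (fun r => e * r ^+ 2) (2 * e * r).
      under eq_fun do rewrite expr2.
      apply: (is_derive_eq (is_derive_funZ e (is_derive_funM (is_derive_id _ _)
        (is_derive_id _ _)))); ring.
    have d1 : is_derive r (1 : R) (fun r => 1 - e * r ^+ 2) (0 - 2 * e * r).
      exact: is_derive_funB.
    have d3 := is_derive_funD (is_derive_funM d1 (is_derive_cst (rho x) r (1 : R))) d2.
    by apply: (is_derive_eq d3); rewrite /cst/=; ring.
  apply: cvgM; last exact: cvg_cst.
  by apply: cvgM; [exact: cvg_cst|exact: cvg_id].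
- by move=> r r01; apply: mix_density => //; exact: er.
- by move=> r r01 x; have [h _] := mix_density (er _ r01) dens; exact: h.
- move=> r r01 x; apply: (@lt_le_trans _ _ (e * r ^+ 2)).
    by move: r01; rewrite in_itv/= => /andP[r0 _]; rewrite mulr_gt0// exprn_gt0.
  by apply: mix_ge => //; apply: er; exact: subset_itv_oo_cc.
- exact: C1_on_affine.
- move=> r r01; rewrite mul1r speedZ.
  have r0 : 0 < r by move: r01; rewrite in_itv/= => /andP[].
  have er0 : 0 < e * r ^+ 2 by rewrite mulr_gt0// exprn_gt0.
  have m0 : \sum_x (1 - rho x) * pi x = 0.
    under eq_bigr do rewrite mulrBl mul1r.
    by rewrite sumrB (stationary_sum hQ); have [_ ->] := dens; rewrite subrr.
  have := speed_le_unif er0 (mix_ge (er _ (subset_itv_oo_cc r01)) dens) m0.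
  (* The factor (2 e r)^2 from the velocity meets 1 / (e r^2) from the lower bound on the density:
     this leaves the constant 4 e. *)
  move=> /(ler_wpM2l (sqr_ge0 (2 * e * r))) h; apply: (le_trans h).
  rewrite -/C le_eqVlt; apply/orP; left; apply/eqP; field.
  by rewrite !gt_eqF.
Qed.

End CurveTransformations.

(** * Curves and the transport distance *)

Section CurveEnergy.
Variables (R : realType) (X : finType) (Q : X -> X -> R) (pi : X -> R).
Hypothesis hQ : markov_triple Q pi.
Implicit Types (g : R -> X -> R) (w : R -> R) (e s t E : R).
Local Notation mu := (@lebesgue_measure R).
Local Notation one := (fun=> 1 : R).
Local Notation pcurve := (pcurve Q pi).

Let pi_gt0 x : 0 < pi x. Proof. exact: stationary_gt0 hQ x. Qed.

Definition Wsq (rho0 rho1 : X -> R) : \bar R :=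
  ereal_inf [set A | exists rho psi,
    admissible Q pi rho0 rho1 rho psi /\ A = action Q pi rho psi].

Definition velocity g r x : R := derive1 (g ^~ x) r.

(** It is built on [derive1], so its values at break points carry no information; those points form
    a null set. *)
Definition potential g r : X -> R := onsager_inv Q pi (g r) (velocity g r).

Lemma action_metric_form (rho psi : R -> X -> R) : action Q pi rho psi =
  (2^-1%:E * \int[mu]_(r in `[0%R, 1%R]) (2 * metric_form Q pi (rho r) (psi r))%:E)%E.
Proof.
rewrite /action; congr (_ * _)%E; apply: eq_integral => r _.
by rewrite /metric_form mulVKf.
Qed.

Lemma C1_on_velocity f f' s t r : C1_on f f' s t -> r \in `]s, t[ -> derive1 f r = f' r.
Proof. by move=> [df _ _] /df[? <-]; rewrite derive1E. Qed.

Lemma pcurve_density w e g s t E : pcurve w e g s t E ->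
  forall r, r \in `[s, t] -> density pi (g r).
Proof.
elim=> {s t E} // s m t E1 E2 c1 ih1 c2 ih2 r; rewrite in_itv/= => /andP[sr rt].
by case: (leP r m) => rm; [apply: ih1|apply: ih2]; rewrite in_itv/= ?sr ?rt ?rm// ltW.
Qed.

Lemma measurable_oo_cc (f : R -> R) s t : {in `]s, t[, continuous f} ->
  measurable_fun `[s, t] f.
Proof.
move=> cf; apply/measurable_fun_itv_bndo_bndcP; apply/measurable_fun_itv_obnd_cbndP.
by apply: open_continuous_measurable_fun; [exact: interval_open|move=> r; rewrite inE; exact: cf].
Qed.

Lemma measurable_itv_cat (f : R -> R) s m t : s <= m -> m <= t ->
  measurable_fun `[s, m] f -> measurable_fun `[m, t] f -> measurable_fun `[s, t] f.
Proof.
move=> sm mt f1 f2; rewrite (@itv_bndbnd_setU _ _ (BLeft s) (BRight m) (BRight t))//.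
apply/measurable_funU => //; split => //.
exact/measurable_fun_itv_obnd_cbndP.
Qed.

Lemma ge0_integral_itv_cat (f : R -> R) s m t : s <= m -> m <= t ->
  measurable_fun `[s, t] f -> (forall r, 0 <= f r) ->
  (\int[mu]_(r in `[s, t]) (f r)%:E =
   \int[mu]_(r in `[s, m]) (f r)%:E + \int[mu]_(r in `[m, t]) (f r)%:E)%E.
Proof.
move=> sm mt mf f0.
have e := @itv_bndbnd_setU _ _ (BLeft s) (BRight m) (BRight t) sm mt.
have mm : measurable_fun `]m, t] f.
  apply: (measurable_funS _ _ mf) => // r; rewrite /= !in_itv/= => /andP[mr ->].
  by rewrite (le_trans sm (ltW mr)).
rewrite e ge0_integral_setU//.
- congr (_ + _)%E; have m1 : measurable_fun `]m, t[ (EFin \o f).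
    by apply/measurable_EFinP/measurable_fun_itv_bndo_bndcP.
  by rewrite (integral_itv_bndoo _ _ m1) (integral_itv_bndoo _ _ m1).
- by rewrite -e; exact/measurable_EFinP.
- by move=> r _; rewrite lee_fin.
- rewrite disj_set2E; apply/eqP/seteqP; split => // r /=; rewrite !in_itv/=.
  by move=> [/andP[_ rm] /andP[mr _]]; rewrite ltNge rm in mr.
Qed.

Lemma C1_on_deriv_cvg (f f' : R -> R) s t r : C1_on f f' s t -> r \in `]s, t[ ->
  f' z @[z --> r] --> f' r.
Proof.
move=> [_ _ cf'] rst; have := cf' r; rewrite /continuous_at /= clamp_oo//.
apply: cvg_trans; apply: near_eq_cvg; have := near_in_itvoo rst.
by apply: filterS => z zst; rewrite /= clamp_oo.
Qed.

Lemma measurable_C1_on_deriv (f f' : R -> R) s t : C1_on f f' s t ->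
  measurable_fun `]s, t[ (EFin \o f').
Proof.
move=> C; apply/measurable_EFinP.
apply: open_continuous_measurable_fun; first exact: interval_open.
by move=> r; rewrite inE => rst; exact: C1_on_deriv_cvg C rst.
Qed.

Lemma velocity_piece g g' s t r : (forall x, C1_on (g ^~ x) (g' ^~ x) s t) ->
  r \in `]s, t[ -> velocity g r = g' r.
Proof. by move=> C rst; apply/funext => x; exact: C1_on_velocity (C x) rst. Qed.

Lemma continuous_potential g g' s t r x : (forall x, C1_on (g ^~ x) (g' ^~ x) s t) ->
  (forall r, r \in `]s, t[ -> forall x, 0 < g r x) -> r \in `]s, t[ ->
  potential g z x @[z --> r] --> potential g r x.
Proof.
move=> C pos rst; rewrite /potential (velocity_piece C rst).
have cg y : g z y @[z --> r] --> g r y.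
  by have [d _ _] := C y; exact: is_derive_continuous (d r rst).
have cg' y : g' z y @[z --> r] --> g' r y by exact: C1_on_deriv_cvg (C y) rst.
have h := @cvg_onsager_inv R X Q pi hQ R (nbhs r) g g' (g r) (g' r) _ (pos r rst) cg cg' x.
have e : {near nbhs r, (fun z => onsager_inv Q pi (g z) (g' z) x) =1
    (fun z => onsager_inv Q pi (g z) (velocity g z) x)}.
  have := near_in_itvoo rst; apply: filterS => z zst.
  by rewrite (velocity_piece C zst).
have h1 := h (nbhs_filter r); have e1 := @near_eq_cvg _ _ _ (nbhs_filter r) _ _ e.
exact: (cvg_trans e1 h1).
Qed.

Lemma cvg_metric_form (T : Type) (FF : set_system T) (r p : T -> X -> R) (rho psi : X -> R) :
  Filter FF -> (forall x, 0 < rho x) ->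
  (forall x, r ^~ x @ FF --> rho x) -> (forall x, p ^~ x @ FF --> psi x) ->
  (fun z => metric_form Q pi (r z) (p z)) @ FF --> metric_form Q pi rho psi.
Proof.
move=> FFF rho0 rr pp; apply: cvgM; first exact: cvg_cst.
do 2! (apply: cvg_fun_sum => ?).
apply: cvgM; last exact: cvg_cst.
apply: cvgM; last exact: cvg_cst.
apply: cvgM; last exact: cvg_theta.
by rewrite expr2; under eq_fun do rewrite expr2; apply: cvgM; apply: cvgB.
Qed.

Lemma velocity_mass g g' s t : (forall x, C1_on (g ^~ x) (g' ^~ x) s t) ->
  (forall r, r \in `[s, t] -> density pi (g r)) ->
  forall r, r \in `]s, t[ -> \sum_x velocity g r x * pi x = 0.
Proof. by move=> C dens r rst; rewrite (velocity_piece C rst) (curve_velocity_mass C dens). Qed.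

Lemma pcurve_potential_measurable e g s t E : pcurve one e g s t E ->
  (forall x, measurable_fun (`[s, t] : set R) (fun r => potential g r x)) /\
  measurable_fun (`[s, t] : set R) (fun r => metric_form Q pi (g r) (potential g r)).
Proof.
elim=> {s t E} [s t g' P P' st C dens ge pos CP le|s m t E1 E2 c1 ih1 c2 ih2].
  have cp r x : r \in `]s, t[ -> {for r, continuous (fun r => potential g r x)}.
    by move=> rst; exact: continuous_potential C pos rst.
  split=> [x|]; apply: measurable_oo_cc => r rst; first exact: cp.
  apply: cvg_metric_form => [|x|x]; first exact: pos.
    by have [d _ _] := C x; exact: is_derive_continuous (d r rst).
  exact: cp.
have [a1 b1] := ih1; have [a2 b2] := ih2.
have sm := ltW (pcurve_lt c1); have mt := ltW (pcurve_lt c2).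
by split=> [x|]; apply: (@measurable_itv_cat _ s m t).
Qed.

Lemma pcurve_integral_le e g s t E : pcurve one e g s t E ->
  (\int[mu]_(r in `[s, t]) (metric_form Q pi (g r) (potential g r))%:E <= E%:E)%E.
Proof.
move=> c; have [_ mf] := pcurve_potential_measurable c; move: c mf.
elim=> {s t E} [s t g' P P' st C dens ge pos CP le mf|s m t E1 E2 c1 ih1 c2 ih2 mf].
  rewrite -(FTC_C1_on st CP).
  have [_ _ cP'] := CP.
  have mP := measurable_C1_on_deriv CP.
  have mf' : measurable_fun `]s, t[ (fun r => (metric_form Q pi (g r) (potential g r))%:E).
    apply/measurable_EFinP; apply: (measurable_funS _ _ mf) => //; exact: subset_itv_oo_cc.
  rewrite (integral_itv_bndoo _ _ mf') (integral_itv_bndoo _ _ mP).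
  have h r : `]s, t[%classic r ->
      0 <= metric_form Q pi (g r) (potential g r) /\
      metric_form Q pi (g r) (potential g r) <= P' r.
    move=> rst; split; first exact: metric_form_ge0.
    rewrite -speed_metric//; last 2 first.
    - exact: pos.
    - exact: velocity_mass C dens _ rst.
    by have := le r rst; rewrite mul1r (velocity_piece C rst).
  by apply: ge0_le_integral => // r rst; rewrite lee_fin; have [] := h r rst.
have sm := ltW (pcurve_lt c1); have mt := ltW (pcurve_lt c2).
rewrite (@ge0_integral_itv_cat _ s m t)// => [|r]; last exact: metric_form_ge0.
rewrite EFinD; apply: leeD.
  apply: ih1; apply: (measurable_funS _ _ mf) => // r; rewrite /= !in_itv/= => /andP[-> rm].
  exact: le_trans mt.
apply: ih2; apply: (measurable_funS _ _ mf) => // r; rewrite /= !in_itv/= => /andP[mr ->].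
by rewrite (le_trans sm).
Qed.

End CurveEnergy.

(** * Partitions of an interval and their common refinements *)

Section Chains.
Variable R : realType.
Implicit Types (P : R -> R -> Prop) (f : R -> R) (p : seq R) (s m t a b : R).

(** A partition into intervals with property P, encoded as a tree of concatenations, so that
    refining and gluing become inductions rather than index computations. *)
Inductive chain P : R -> R -> Prop :=
| chain1 s t : s < t -> P s t -> chain P s t
| chain_cat s m t : chain P s m -> chain P m t -> chain P s t.

Lemma chain_lt P s t : chain P s t -> s < t.
Proof. by elim=> {s t} // s m t _ sm _; exact: lt_trans. Qed.

Lemma chain_impl P P' s t :
  (forall a b, s <= a -> b <= t -> a < b -> P a b -> P' a b) ->
  chain P s t -> chain P' s t.
Proof.
move=> PP' c; elim: c PP' => {s t} [s t st Pst h|s m t c1 ih1 c2 ih2 h].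
  by apply: chain1 => //; exact: h.
have sm := ltW (chain_lt c1); have mt := ltW (chain_lt c2).
apply: chain_cat.
  by apply: ih1 => a b sa bm; apply: h => //; exact: le_trans mt.
by apply: ih2 => a b ma bt; apply: h => //; exact: le_trans ma.
Qed.

Definition hereditary P := forall s t a b, P s t -> s <= a -> b <= t -> a < b -> P a b.

Lemma chain_sub P s t a b : hereditary P -> chain P s t ->
  s <= a -> b <= t -> a < b -> chain P a b.
Proof.
move=> hP c; elim: c a b => {s t} [s t st Pst|s m t c1 ih1 c2 ih2] a b sa bt ab.
  by apply: chain1 => //; exact: hP Pst sa bt ab.
have [bm|mb] := leP b m; first exact: ih1.
have [ma|am] := leP m a; first exact: ih2.
by apply: (@chain_cat _ _ m); [exact: ih1|exact: ih2 mb].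
Qed.

Lemma chain_and P P' s t : hereditary P -> hereditary P' ->
  chain P s t -> chain P' s t -> chain (fun a b => P a b /\ P' a b) s t.
Proof.
move=> hP hP' c c'; elim: c' c => {s t} [s t st P'st c|s m t c1 ih1 c2 ih2 c].
  by apply: chain_impl c => a b sa bt ab Pab; split => //; exact: hP' P'st sa bt ab.
have sm := chain_lt c1; have mt := chain_lt c2.
apply: chain_cat.
  by apply: ih1; apply: (chain_sub hP c) => //; exact: ltW.
by apply: ih2; apply: (chain_sub hP c) => //; exact: ltW.
Qed.

(** [piecewise_C1] gives each coordinate its own partition; as X is finite, they have a common
    refinement. *)
Lemma chain_forall (X : finType) (P : X -> R -> R -> Prop) s t : s < t ->
  (forall x, hereditary (P x)) -> (forall x, chain (P x) s t) ->
  chain (fun a b => forall x, P x a b) s t.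
Proof.
move=> st hP c.
suff h (l : seq X) : chain (fun a b => forall x, x \in l -> P x a b) s t.
  by apply: chain_impl (h (enum X)) => a b _ _ _ h' x; apply: h'; rewrite mem_enum.
elim: l => [|y l ih]; first exact: chain1.
apply: chain_impl (chain_and (hP y) _ (c y) ih) => [a b _ _ _ [h1 h2] x|].
  by rewrite inE => /predU1P[->//|]; exact: h2.
by move=> s' t' a b h sa bt ab x xl; exact: hP (h x xl) sa bt ab.
Qed.

Lemma chain_ae P (S : R -> Prop) s t :
  (forall a b, P a b -> forall r, r \in `]a, b[ -> S r) -> chain P s t ->
  {ae @lebesgue_measure R, forall r, r \in `]s, t[ -> S r}.
Proof.
move=> PS; elim=> {s t} [s t st Pst|s m t c1 ih1 c2 ih2].
  by apply: aeW => r; exact: PS.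
have ne : {ae @lebesgue_measure R, forall r, r != m}.
  exists [set m]; split => //; first exact: lebesgue_measure_set1.
  by move=> r /= /negP; rewrite negbK => /eqP.
apply: negligibleS (negligibleU (negligibleU ih1 ih2) ne) => r /=.
apply: contra_notP => /not_orP[/not_orP[/contrapT h1 /contrapT h2] /contrapT rm].
rewrite in_itv/= => /andP[sr rt].
have [lt|gt|e] := ltgtP r m; last by rewrite e eqxx in rm.
  by apply: h1; rewrite in_itv/= sr.
by apply: h2; rewrite in_itv/= gt.
Qed.

Definition C1_on_some f s t := exists f', C1_on f f' s t.

Lemma C1_on_some_hereditary f : hereditary (C1_on_some f).
Proof.
move=> s t a b [f' [df cf cf']] sa bt ab; exists f'.
have sub r : r \in `]a, b[ -> r \in `]s, t[.
  by rewrite !in_itv/= => /andP[h1 h2]; rewrite (le_lt_trans sa)// (lt_le_trans h2).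
have ccl (g : R -> R) : continuous (g \o clamp s t) -> continuous (g \o clamp a b).
  move=> cg; rewrite (_ : g \o _ = (g \o clamp s t) \o clamp a b).
    by move=> r; apply: continuous_comp; [exact: continuous_clamp|exact: cg].
  apply/funext => r /=; rewrite (@clamp_id _ s t)//.
  have := clamp_itv r (ltW ab); rewrite !in_itv/= => /andP[h1 h2].
  by rewrite (le_trans sa)// (le_trans h2).
by split; [move=> r /sub /df|exact: ccl|exact: ccl].
Qed.

Definition C1_partition f s t p := itv_partition s t p /\
  forall i, (i < size p)%N -> C1_itv f (nth 1 (s :: p) i) (nth 1 p i).

Lemma C1_partition_chain f s t p : s < t -> C1_partition f s t p ->
  chain (C1_on_some f) s t.
Proof.
elim: p s => [s st [/itv_partition_nil e _]|x p ih s st [pp h]].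
  by rewrite e ltxx in st.
have sx : s < x by case: pp => /=/andP[].
have C0 : chain (C1_on_some f) s x.
  by apply: chain1 => //; exact: C1_itv_C1_on sx (h 0%N _).
have pp' := itv_partition_cons pp.
have := itv_partition_le pp'; rewrite le_eqVlt => /predU1P[<-//|xt].
apply: chain_cat C0 (ih x xt _); split => // i ip.
exact: (h i.+1).
Qed.

Lemma chain_C1_partition f s t : chain (C1_on_some f) s t ->
  exists p, C1_partition f s t p.
Proof.
elim=> {s t} [s t st [f' C]|s m t c1 [p1 [pp1 h1]] c2 [p2 [pp2 h2]]].
  exists [:: t]; split; first exact: itv_partition1.
  by case=> [|i]//= _; exact: C1_on_C1_itv C.
exists (p1 ++ p2); split; first exact: itv_partition_cat pp1 pp2.
move=> i; rewrite size_cat => ip; rewrite -cat_cons !nth_cat /=.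
have [ip1|p1i] := ltnP i (size p1).
  by rewrite (ltn_trans ip1 (ltnSn _)); exact: h1.
have ip2 : (i - size p1 < size p2)%N by rewrite ltn_subLR.
have := h2 _ ip2.
(* At the junction the left neighbour is the last point of p1, which is m. *)
move: p1i; rewrite leq_eqVlt => /predU1P[e|p1i].
  rewrite -e ltnSn subnn /=; have := itv_partition_nth_size 1 pp1 => /= ->//.
by rewrite ltnS leqNgt p1i/= -{1}(subnSK p1i).
Qed.

Lemma piecewise_C1_chain f : piecewise_C1 f <-> chain (C1_on_some f) 0 1.
Proof.
split=> [[p pp h]|/chain_C1_partition[p [pp h]]]; last by exists p.
by apply: (@C1_partition_chain _ _ _ p).
Qed.

End Chains.

(** * Passing between admissible pairs and curves of bounded energy *)

Section CurvesAndDistance.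
Variables (R : realType) (X : finType) (Q : X -> X -> R) (pi : X -> R).
Hypothesis hQ : markov_triple Q pi.
Implicit Types (g : R -> X -> R) (e s t E : R) (rho psi : R -> X -> R).
Local Notation mu := (@lebesgue_measure R).
Local Notation one := (fun=> 1 : R).
Local Notation pcurve := (pcurve Q pi).
Local Notation form := (metric_form Q pi).
Local Notation dot f g := (\sum_x f x * g x * pi x).

Let pi_gt0 x : 0 < pi x. Proof. exact: stationary_gt0 hQ x. Qed.

Let piece g s t := exists g',
  [/\ forall x, C1_on (g ^~ x) (g' ^~ x) s t,
      forall r, r \in `[s, t] -> density pi (g r) &
      forall r, r \in `]s, t[ -> forall x, 0 < g r x].

Let pcurve_chain e g s t E : pcurve one e g s t E -> chain (piece g) s t.
Proof.
elim=> {s t E} [s t g' P P' st C dens ge pos CP le|s m t E1 E2 _ c1 _ c2].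
  by apply: chain1 => //; exists g'.
exact: chain_cat c1 c2.
Qed.

Lemma action_measurable rho psi :
  measurable_fun (`[0, 1] : set R) (fun r => form (rho r) (psi r)) ->
  action Q pi rho psi = (\int[mu]_(r in `[0%R, 1%R]) (form (rho r) (psi r))%:E)%E.
Proof.
move=> mf; rewrite action_metric_form; under eq_integral do rewrite EFinM.
rewrite ge0_integralZl_EFin//; last 2 first.
- by move=> r _; rewrite lee_fin metric_form_ge0.
- exact/measurable_EFinP.
by rewrite muleA -EFinM mulVf// mul1e.
Qed.

(** Together with its potential the curve is admissible: the continuity equation holds inside every
    piece, hence almost everywhere. *)
Lemma Wsq_le_pcurve e g E : pcurve one e g 0 1 E -> (Wsq Q pi (g 0%R) (g 1%R) <= E%:E)%E.
Proof.
move=> c; have [mp mf] := pcurve_potential_measurable hQ c.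
apply: le_trans (pcurve_integral_le hQ c); rewrite -action_measurable//.
apply: ereal_inf_lbound; exists g, (potential Q pi g); split => //; split => //.
- exact: pcurve_density c.
- move=> x; apply/piecewise_C1_chain; apply: chain_impl (pcurve_chain c).
  by move=> a b _ _ _ [g' [C _ _]]; exists (g' ^~ x).
apply: chain_ae (pcurve_chain c) => a b [g' [C dens pos]] r rab x.
have eK := onsager_invK hQ (pos r rab) (velocity_mass C dens rab) x.
rewrite -[derive1 _ _]/(velocity g r x) -eK -/(potential Q pi g r).
rewrite /onsager -big_split/= big1// => y _.
by move: (theta _ _) (potential _ _ _ _ x) (potential _ _ _ _ y) => a1 a2 a3; ring.
Qed.

Lemma metric_form_mix e (r p : X -> R) : 0 < e <= 1 -> (forall x, 0 <= r x) ->
  (1 - e) * form r p <= form (mix e r) p.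
Proof.
move=> e01 r0; rewrite mulrCA ler_wpM2l// mulr_sumr; apply: ler_sum => x _.
rewrite mulr_sumr; apply: ler_sum => y _.
have -> (a b c d k : R) : k * (a * b * c * d) = a * (k * b) * c * d by ring.
rewrite ler_wpM2r ?(ltW (pi_gt0 x))// ler_wpM2r ?(rate_ge0 hQ)// ler_wpM2l ?sqr_ge0//.
exact: theta_mix.
Qed.

(** Mixing scales the velocity by 1 - e and shrinks the metric form at most by 1 - e. Duality at r
    between p and the optimal potential q of the mixed density then shows that the energy does not
    grow. *)
Lemma speed_mix_le e (r p : X -> R) : 0 < e <= 1 -> density pi r ->
  speed Q pi (mix e r) (fun x => (1 - e) * onsager Q r p x) <= form r p.
Proof.
move=> e01 dens; have [r0 _] := dens; have /andP[e0 e1] := e01.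
have m0 x : 0 < mix e r x by apply: lt_le_trans (mix_ge _ dens x); rewrite ?(ltW e0).
set v := fun x => _; set q := onsager_inv Q pi (mix e r) v.
have v0 : \sum_x v x * pi x = 0.
  rewrite /v; under eq_bigr do rewrite -mulrA.
  by rewrite -mulr_sumr (onsager_mass hQ)// mulr0.
have S1 := speed_metric hQ m0 v0; rewrite -/q in S1.
have S2 : speed Q pi (mix e r) v = (1 - e) * dot q (onsager Q r p).
  rewrite /speed -/q mulr_sumr; apply: eq_bigr => x _; rewrite /v.
  by move: (onsager _ _ _ _) => a; ring.
have h1 := metric_form_mix q e01 r0; have h2 := metric_form_dual hQ q p r0.
have h3 := metric_form_ge0 hQ r p.
have := ler_wpM2l (_ : 0 <= 1 - e) h2; rewrite subr_ge0 => /(_ e1).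
have := ler_wpM2r h3 (_ : 1 - e <= 1); rewrite gerBl => /(_ (ltW e0)); rewrite mul1r.
move: S1 S2 h1; move: (speed _ _ _ _) (form _ _) (form _ _) (form _ _) (dot _ _) => a b c d f.
by move=> -> ->; rewrite mulrBr mulrCA; lra.
Qed.

(** The larger integrand h will be the action density of an arbitrary admissible pair, about whose
    measurability nothing is established. So the integrals are compared as suprema over simple
    functions, after removing a null set. *)
Lemma ge0_le_integral_ae (f h : R -> R) (D : set R) : measurable D ->
  measurable_fun D f -> (forall r, 0 <= f r) -> (forall r, 0 <= h r) ->
  {ae mu, forall r, D r -> f r <= h r} ->
  (\int[mu]_(r in D) (f r)%:E <= \int[mu]_(r in D) (h r)%:E)%E.
Proof.
move=> mD mf f0 h0 [N [mN N0 subN]].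
rewrite (@ge0_negligible_integral _ _ _ mu D N)//; last 2 first.
- exact/measurable_EFinP.
- by move=> r _; rewrite lee_fin.
rewrite [leLHS]integral_mkcond [leRHS]integral_mkcond !ge0_integralE//; last 2 first.
- by move=> r _; apply: erestrict_ge0 => z _; rewrite lee_fin.
- by move=> r _; apply: erestrict_ge0 => z _; rewrite lee_fin.
apply: le_ereal_sup => _ [k hk <-]; exists k => // r; apply: le_trans (hk r) _.
rewrite !patch_setT /patch; case: ifPn => [|_]; last first.
  by case: ifPn => _; rewrite ?lee_fin// -[point]/(0%E) ?lee_fin.
rewrite inE => -[Dr nNr]; rewrite mem_set// lee_fin.
by have := contra_not (subN r) nNr => /contrapT; exact.
Qed.

(** On each piece the squared speed itself serves as the majorant, so E is the exact energy and not
    merely a bound. *)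
Lemma chain_pcurve e g s t : 0 < e -> (forall r, r \in `[s, t] -> density pi (g r)) ->
  (forall r, r \in `[s, t] -> forall x, e <= g r x) ->
  chain (fun a b => forall x, C1_on_some (g ^~ x) a b) s t ->
  exists2 E, pcurve one e g s t E &
    E%:E = (\int[mu]_(r in `[s, t]) (form (g r) (potential Q pi g r))%:E)%E.
Proof.
move=> e0 + + c; elim: c => {s t} [s t st C dens ge|s m t c1 ih1 c2 ih2 dens ge].
  have [g1 C1] := choice C; pose g' r x := g1 x r.
  have st' := ltW st.
  have gc r x : g (clamp s t z) x @[z --> r] --> g (clamp s t r) x.
    by have [_ cg _] := C1 x; exact: cg.
  have gc' r x : g' (clamp s t z) x @[z --> r] --> g' (clamp s t r) x.
    by have [_ _ cg'] := C1 x; exact: cg'.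
  have pos r : r \in `[s, t] -> forall x, 0 < g r x.
    by move=> rst x; exact: lt_le_trans (ge r rst x).
  have [P CP] : exists P, C1_on P (fun r => speed Q pi (g r) (g' r)) s t.
    apply: C1_on_prim => // r.
    apply: (@cvg_speed R X Q pi hQ R (nbhs r) (fun z => g (clamp s t z))
      (fun z => g' (clamp s t z)) _ _ _ _ (gc r) (gc' r)).
    by apply: pos; exact: clamp_itv.
  have c : pcurve one e g s t (P t - P s).
    apply: (@pcurve_piece _ _ _ _ _ _ _ _ _ g' _ _ st C1 dens ge _ CP) => [r rst|r rst].
      exact/pos/subset_itv_oo_cc.
    by rewrite mul1r.
  exists (P t - P s) => //; rewrite -(FTC_C1_on st CP).
  have [_ mf] := pcurve_potential_measurable hQ c.
  have mP := measurable_C1_on_deriv CP.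
  have mf' : measurable_fun `]s, t[ (fun r => (form (g r) (potential Q pi g r))%:E).
    apply/measurable_EFinP; apply: (measurable_funS _ _ mf) => //; exact: subset_itv_oo_cc.
  rewrite (integral_itv_bndoo _ _ mf') (integral_itv_bndoo _ _ mP).
  apply: eq_integral => r; rewrite inE => rst.
  rewrite -speed_metric//; last 2 first.
  - exact/pos/subset_itv_oo_cc.
  - exact: velocity_mass C1 dens _ rst.
  by rewrite (velocity_piece C1 rst).
have sm := ltW (chain_lt c1); have mt := ltW (chain_lt c2).
have sub1 r : r \in `[s, m] -> r \in `[s, t].
  by rewrite !in_itv/= => /andP[-> rm]; exact: le_trans mt.
have sub2 r : r \in `[m, t] -> r \in `[s, t].
  by rewrite !in_itv/= => /andP[mr ->]; rewrite (le_trans sm).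
have [E1 p1 e1] := ih1 (fun r h => dens r (sub1 r h)) (fun r h => ge r (sub1 r h)).
have [E2 p2 e2] := ih2 (fun r h => dens r (sub2 r h)) (fun r h => ge r (sub2 r h)).
have p := pcurve_cat p1 p2; exists (E1 + E2) => //.
have [_ mf] := pcurve_potential_measurable hQ p.
rewrite (@ge0_integral_itv_cat _ _ _ m)// => [|r]; last exact: metric_form_ge0.
by rewrite EFinD e1 e2.
Qed.

Lemma C1_on_mix e (f f' : R -> R) s t : s <= t -> C1_on f f' s t ->
  C1_on (fun r => (1 - e) * f r + e) (fun r => (1 - e) * f' r) s t.
Proof.
move=> st C; have := C1_onD (C1_onZ (1 - e) C) (C1_on_affine 0 e st).
congr (C1_on _ _ _ _); apply/funext => r; first by rewrite mul0r add0r.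
by rewrite addr0.
Qed.

Lemma admissible_pcurve e (rho0 rho1 : X -> R) rho psi : 0 < e <= 1 ->
  admissible Q pi rho0 rho1 rho psi ->
  exists2 E, pcurve one e (fun r => mix e (rho r)) 0 1 E &
    (E%:E <= action Q pi rho psi)%E.
Proof.
move=> e01 adm; have /andP[e0 e1] := e01; have e01' : 0 <= e <= 1 by rewrite (ltW e0).
have [dens _ _ C1 mpsi ce] := adm.
have c : chain (fun a b => forall x, C1_on_some (fun r => rho r x) a b) 0 1.
  apply: chain_forall => // x; first exact: C1_on_some_hereditary.
  exact/piecewise_C1_chain.
pose g r := mix e (rho r).
have [] := @chain_pcurve e g 0 1 e0.
- by move=> r r01; exact: (mix_density hQ e01' (dens r r01)).
- by move=> r r01; exact: (mix_ge e01' (dens r r01)).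
- apply: chain_impl c => a b _ _ ab C x; have [f' Cf] := C x.
  by exists (fun r => (1 - e) * f' r); exact: C1_on_mix (ltW ab) Cf.
move=> E pE eE; exists E => //.
have [_ mf] := pcurve_potential_measurable hQ pE.
rewrite eE -[X in (X <= _)%E](action_measurable mf) !action_metric_form.
apply: lee_wpmul2l; first by rewrite lee_fin invr_ge0.
apply: ge0_le_integral_ae => //.
- by apply: measurable_funM.
- by move=> r; rewrite mulr_ge0// metric_form_ge0.
- by move=> r; rewrite mulr_ge0// metric_form_ge0.
have hd : {ae mu, forall r, r \in `]0, 1[ -> forall x, derivable (fun z => rho z x) r 1}.
  by apply: chain_ae c => a b C r rab x; have [f' [df _ _]] := C x; have [] := df r rab.
have n0 : mu.-negligible [set 0 : R].
  by exists [set 0 : R]; split => //; exact: lebesgue_measure_set1.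
have n1 : mu.-negligible [set 1 : R].
  by exists [set 1 : R]; split => //; exact: lebesgue_measure_set1.
(* The exceptional times: no derivative, failure of the continuity equation, or an end point. *)
apply: negligibleS (negligibleU (negligibleU hd ce) (negligibleU n0 n1)) => r /=.
apply: contra_notP => /not_orP[/not_orP[/contrapT h1 /contrapT h2] /not_orP[r0 r1]].
rewrite in_itv/= => /andP[]; rewrite le_eqVlt => /predU1P[e'|r0']; first by case: (r0 (esym e')).
rewrite le_eqVlt => /predU1P[e'|r1']; first by case: (r1 e').
have roo : r \in `]0, 1[ by rewrite in_itv/= r0'.
have dr := dens r (subset_itv_oo_cc roo).
apply: ler_wpM2l; first exact: ler0n.
have vE : velocity g r = (fun x => (1 - e) * onsager Q (rho r) (psi r) x).
  apply/funext => x; have dx : is_derive r (1 : R) (fun z => rho z x) (onsager Q (rho r) (psi r) x).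
    apply: DeriveDef; first exact: h1.
    rewrite -derive1E; apply/eqP; rewrite -subr_eq0; apply/eqP.
    rewrite -[RHS](h2 roo x); congr (_ + _); rewrite -sumrN; apply: eq_bigr => y _.
    by rewrite -!mulNr opprB.
  have := is_derive_funD (is_derive_funZ (1 - e) dx) (is_derive_cst e r 1).
  by rewrite addr0 => -[_ <-]; rewrite /velocity derive1E.
rewrite -speed_metric//; first by rewrite vE; exact: speed_mix_le.
- by move=> x; apply: lt_le_trans (mix_ge e01' dr x).
- rewrite vE; under eq_bigr do rewrite -mulrA.
  by rewrite -mulr_sumr (onsager_mass hQ) ?mulr0//; have [] := dr.
Qed.

End CurvesAndDistance.

(** * Displacement convexity of the entropy *)

Section Reach.
Variables (R : realType) (X : finType) (Q : X -> X -> R) (pi : X -> R).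
Hypothesis hQ : markov_triple Q pi.
Implicit Types (g : R -> X -> R) (e s t E d D : R) (rho nu a b c : X -> R).
Local Notation mu := (@lebesgue_measure R).
Local Notation one := (fun=> 1 : R).
Local Notation pcurve := (pcurve Q pi).
Local Notation Wsq := (Wsq Q pi).
Local Notation H := (entropy pi).

Let pi_gt0 x : 0 < pi x. Proof. exact: stationary_gt0 hQ x. Qed.
Let pi_sum : \sum_x pi x = 1. Proof. exact: stationary_sum hQ. Qed.

Definition reach e a b E := exists g E',
  [/\ pcurve one e g 0 1 E', g 0 = a, g 1 = b & E' <= E].

Lemma reach_weaken e e' a b E : e' <= e -> reach e a b E -> reach e' a b E.
Proof.
move=> ee [g [E' [c g0 g1 le]]]; exists g, E'; split => //.
exact: pcurve_weaken ee c.
Qed.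

Lemma reach_sym e a b E : reach e a b E -> reach e b a E.
Proof.
move=> [g [E' [c g0 g1 le]]]; exists (fun u => g (- ((u - 1) / 1))), (1^-1 * E'); split.
- have := pcurve_affine hQ 1 ltr01 (pcurve_reverse c).
  by rewrite oppr0 mulr0 add0r mulrN1 addNr.
- by rewrite sub0r divr1 opprK.
- by rewrite subrr mul0r oppr0.
- by rewrite invr1 mul1r.
Qed.

(** Running a unit-time curve in time p divides its energy by p. *)
Lemma reach_cat e a b c p E1 E2 : 0 < p < 1 -> reach e a b E1 -> reach e b c E2 ->
  reach e a c (p^-1 * E1 + (1 - p)^-1 * E2).
Proof.
move=> /andP[p0 p1] [g1 [F1 [c1 g10 g11 le1]]] [g2 [F2 [c2 g20 g21 le2]]].
have q0 : 0 < 1 - p by rewrite subr_gt0.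
have d1 := pcurve_affine hQ 0 p0 c1; have d2 := pcurve_affine hQ p q0 c2.
rewrite mulr0 mulr1 !addr0 in d1; rewrite mulr0 mulr1 add0r subrK in d2.
have gp : g1 ((p - 0) / p) = g2 ((p - p) / (1 - p)).
  by rewrite subr0 subrr mul0r divff ?gt_eqF// g11 g20.
exists (fun r => if r <= p then g1 ((r - 0) / p) else g2 ((r - p) / (1 - p))).
exists (p^-1 * F1 + (1 - p)^-1 * F2); split.
- exact: pcurve_glue gp d1 d2.
- by rewrite (ltW p0) subr0 mul0r.
- by rewrite leNgt p1/= divff ?gt_eqF.
- by apply: lerD; apply: ler_wpM2l => //; rewrite invr_ge0 ltW.
Qed.

Lemma Wsq_le_reach e a b E : reach e a b E -> (Wsq a b <= E%:E)%E.
Proof.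
move=> [g [E' [c <- <- le]]]; apply: le_trans (Wsq_le_pcurve hQ c) _.
by rewrite lee_fin.
Qed.

Lemma Wsq_ge0 a b : (0 <= Wsq a b)%E.
Proof.
apply/ereal_infP => _ [rho [psi [_ ->]]]; rewrite action_metric_form.
apply: mule_ge0; first by rewrite lee_fin invr_ge0.
by apply: integral_ge0 => r _; rewrite lee_fin mulr_ge0// (metric_form_ge0 hQ).
Qed.

Lemma Wsq_reach e a b D (eta : R) : 0 < e <= 1 -> 0 < eta -> Wsq a b = D%:E ->
  reach e (mix e a) (mix e b) (D + eta).
Proof.
move=> e01 eta0 WD.
have [] := @lb_ereal_inf_adherent R _ eta eta0 (_ : Wsq a b \is a fin_num).
  by rewrite WD.
move=> A [rho [psi [adm ->]]]; rewrite -/(Wsq a b) WD -EFinD => lt.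
have [E c leE] := admissible_pcurve hQ e01 adm.
exists (fun r => mix e (rho r)), E; split => //.
- by rewrite (adm_start adm).
- by rewrite (adm_end adm).
- by rewrite -lee_fin; apply: le_trans leE (ltW _).
Qed.

Lemma reach_mix e rho : 0 < e <= 1 -> density pi rho ->
  reach 0 rho (mix e rho) (4 * e * speed Q pi (fun=> 1) (fun x => 1 - rho x)).
Proof.
move=> e01 dens; have [g [c g0 g1]] := pcurve_mix hQ e01 dens.
by exists g; eexists; split; [exact: c|..].
Qed.

(** Full mixing, e = 1, joins each density to the constant one with finite energy. *)
Lemma Wsq_fin a b : density pi a -> density pi b -> Wsq a b \is a fin_num.
Proof.
move=> da db; rewrite ge0_fin_numE ?Wsq_ge0//.
have o : 0 < (1 : R) <= 1 by rewrite ltr01 lexx.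
have m1 r : mix 1 r = (fun=> 1) :> (X -> R).
  by apply/funext => x; rewrite /mix subrr mul0r add0r.
have r1 := reach_mix o da; have r2 := reach_sym (reach_mix o db).
rewrite m1 in r1; rewrite m1 in r2.
have h : 0 < (2^-1 : R) < 1 by rewrite invr_gt0 ltr0n invf_lt1 ?ltr1n.
by apply: le_lt_trans (Wsq_le_reach (reach_cat h r1 r2)) _; rewrite ltry.
Qed.

Lemma Rintegral_cst_itv (m h : R) : 0 <= h -> \int[mu]_(k in `[0, h]) m = h * m.
Proof.
move=> h0; rewrite Rintegral_cst//= lebesgue_measure_itv/= lte_fin.
case: ltP => [_|h0']; first by rewrite -EFinB/= subr0 mulrC.
have -> : h = 0 by apply/eqP; rewrite eq_le h0'.
by rewrite mulr0 mul0r.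
Qed.

Variable kappa : R.
Hypothesis kappa_ge0 : 0 <= kappa.
Hypothesis hess : forall rho psi : X -> R, (forall x, 0 < rho x) ->
  kappa * metric_form Q pi rho psi <= hessian Q pi rho psi.

(** The heat time grows linearly along the curve, so the start is fixed and the end moves. The
    entropy action is h H(mix e rho) <= h H(rho) at the start, and at least h m at the end since the
    weight is at least 1 and the entropy is nonnegative. *)
Lemma reach_heat e h m rho nu E : 0 < e <= 1 -> 0 < h <= 1 ->
  density pi rho -> density pi nu -> reach e (mix e rho) (mix e nu) E ->
  (forall k, k \in `[0, h] -> m <= H (heat Q k (mix e nu))) ->
  reach e (mix e rho) (heat Q h (mix e nu))
    ((1 + kappa * h)^-1 * (E + 2 * h * (H rho - m) + evolution_error pi kappa * h ^+ 2)).
Proof.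
move=> e01 /andP[h0 h1] drho dnu [g [E' [c g0 g1 le]]] Hm; have /andP[e0 e1] := e01.
have c' := pcurve_heat hQ kappa_ge0 hess e0 h0 h1 c (lexx _) (lexx _).
have [g' [c'' g'0 g'1]] := pcurve_unweight hQ kappa_ge0 (ltW h0) c'.
exists g'; eexists; split; [exact: c''|..].
- by rewrite g'0 mulr0 g0; apply/funext => x; rewrite heat0.
- by rewrite g'1 mulr1 g1.
have p0 : 0 < 1 + kappa * h by rewrite ltr_pwDl// mulr_ge0// ltW.
apply: ler_wpM2l; first by rewrite invr_ge0 ltW.
rewrite subr0 mulr1 lerD2r; apply: lerD => //; rewrite -mulrA ler_pM2l//.
have J0 : entropy_action Q pi kappa h g 0 = h * H (mix e rho).
  rewrite /entropy_action -Rintegral_cst_itv ?(ltW h0)//.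
  apply: eq_Rintegral => k _; rewrite /weighted_entropy /weight !mulr0 addr0 expr1n mul1r.
  by rewrite g0; congr (entropy pi _); apply/funext => x; rewrite heat0.
have J1 : h * m <= entropy_action Q pi kappa h g 1.
  rewrite -(Rintegral_cst_itv m (ltW h0)) /entropy_action g1.
  have m0 x : 0 < mix e nu x by apply: lt_le_trans (mix_ge _ dnu x); rewrite ?(ltW e0).
  apply: le_Rintegral => //.
  - by apply: (@integrable_itv _ (cst m)) => k _; exact: cvg_cst.
  - apply: integrable_itv => k; rewrite in_itv/= => /andP[k0 _].
    have k1 : 0 <= k * 1 by rewrite mulr1.
    exact: (@cvg_weighted_entropy _ _ _ _ hQ kappa _ (nbhs k) _ (fun=> mix e nu) (fun=> 1) id
      (mix e nu) 1 k (fun x => cvg_cst _) (cvg_cst _) cvg_id m0 k1).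
  - move=> k; rewrite /= => kh; have := kh; rewrite in_itv/= => /andP[k0 _].
    rewrite /weighted_entropy /weight !mulr1; apply: le_trans (Hm k kh) _.
    rewrite ler_peMl//.
      apply: (entropy_ge0 pi_gt0 pi_sum); apply: (heat_density hQ) => //.
      by apply: (mix_density hQ) => //; rewrite (ltW e0).
    by rewrite exprn_ege1// lerDl mulr_ge0.
rewrite J0 mulrBr; apply: lerB => //; apply: ler_wpM2l; first exact: ltW.
exact: (entropy_mix pi_gt0 pi_sum e01 drho).
Qed.

End Reach.

Lemma le_of_linear (R : realType) (a b C s0 : R) : 0 < s0 ->
  (forall s, 0 < s -> s <= s0 -> a <= b + s * C) -> a <= b.
Proof.
move=> s00 h; apply/ler_addgt0Pr => e e0.
have C0 : 0 < `|C| + 1 by rewrite ltr_wpDl.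
pose s := Num.min s0 (e / (`|C| + 1)).
have sp : 0 < s by rewrite lt_min s00 divr_gt0.
apply: (le_trans (h s sp _)); first by rewrite ge_min lexx.
rewrite lerD2l; apply: (@le_trans _ _ (s * (`|C| + 1))).
  by apply: ler_wpM2l; [exact: ltW|rewrite (le_trans (ler_norm C))// lerDl].
by rewrite -ler_pdivlMr// ge_min lexx orbT.
Qed.

(** The hypothesis is the energy of three curves in succession: bridges contributing z C0 and z C1
    around a main part of energy B (Y + z^2 a). Multiplying by (1 - z)^2 clears the inverses, and
    all terms besides B Y are O(z). *)
Lemma boundary_layer_le (R : realType) (D Y a B C0 C1 z : R) :
  0 < z < 1 -> 0 <= B <= 1 -> 0 <= D -> 0 <= a -> 0 <= C0 -> 0 <= C1 ->
  D <= (1 - z)^-1 * (z * C0 + (1 - z)^-1 * (B * (Y + z ^+ 2 * a))) + z * C1 ->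
  D <= B * Y + z * (2 * D + C0 + C1 + a).
Proof.
move=> /andP[z0 z1] /andP[B0 B1] D0 a0 C00 C10; set u := 1 - z.
have u0 : 0 < u by rewrite subr_gt0.
move/(ler_wpM2l (ltW (exprn_gt0 2 u0))).
have -> : u ^+ 2 * (u^-1 * (z * C0 + u^-1 * (B * (Y + z ^+ 2 * a))) + z * C1) =
    u * (z * C0) + B * Y + B * (z * (z * a)) + u ^+ 2 * (z * C1).
  by field; rewrite gt_eqF.
have u1 : u <= 1 by rewrite gerBl ltW.
have h1 : u * (z * C0) <= z * C0 by rewrite ler_piMl// mulr_ge0// ltW.
have h2 : u ^+ 2 * (z * C1) <= z * C1.
  by rewrite ler_piMl ?exprn_ile1// ?mulr_ge0// ltW.
have h3 : B * (z * (z * a)) <= z * a.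
  have za : 0 <= z * a by rewrite mulr_ge0// ltW.
  by apply: le_trans (ler_piMl _ B1) _; rewrite ?mulr_ge0 ?ler_piMl// ltW.
have h4 : 0 <= z ^+ 2 * D by rewrite mulr_ge0// sqr_ge0.
have -> : u ^+ 2 * D = D - 2 * (z * D) + z ^+ 2 * D by rewrite /u; ring.
move: u h1 h2 h3 h4 {u0 u1} => u *; lra.
Qed.

(** * Removal of the small parameters and convexity along geodesics *)

Section DisplacementConvexity.
Variables (R : realType) (X : finType) (Q : X -> X -> R) (pi : X -> R).
Hypothesis hQ : markov_triple Q pi.
Implicit Types (e h k t d D : R) (rho nu : X -> R).
Local Notation Wsq := (Wsq Q pi).
Local Notation H := (entropy pi).
Local Notation reach := (reach Q pi).

Let pi_gt0 x : 0 < pi x. Proof. exact: stationary_gt0 hQ x. Qed.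
Let pi_sum : \sum_x pi x = 1. Proof. exact: stationary_sum hQ. Qed.

Lemma heat_mix k e nu x : heat Q k (mix e nu) x = (1 - e) * heat Q k nu x + e.
Proof.
rewrite /heat /mix; under eq_bigr do rewrite mulrDr mulrCA.
by rewrite big_split/= -mulr_sumr -mulr_suml (heat_kernel_sum hQ) mul1r.
Qed.

Lemma heat_mix_near nu (eps : R) : 0 < eps -> exists2 s, 0 < s <= 1 &
  forall e k, 0 <= e <= s -> 0 <= k <= s -> forall x, `|heat Q k (mix e nu) x - nu x| <= eps.
Proof.
move=> eps0; pose S (k : R) : R := \sum_x `|heat Q k nu x - nu x|.
have S0 : S 0 = 0 by rewrite /S big1// => x _; rewrite heat0 subrr normr0.
have cS : S k @[k --> (0 : R)] --> S 0.
  apply: cvg_fun_sum => x; apply: cvg_norm; apply: cvgB; last exact: cvg_cst.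
  exact: (@cvg_heat _ _ _ _ hQ R (nbhs (0 : R)) _ id (fun=> nu) 0 nu x cvg_id (fun y => cvg_cst _)).
rewrite S0 in cS.
have e2 : 0 < eps / 2 by rewrite divr_gt0.
move/cvgrPdist_le: cS => /(_ _ e2) [s1 /= s10 hs1].
pose C := \sum_x `|1 - nu x| + 1.
have C0 : 0 < C by rewrite ltr_wpDl// sumr_ge0.
pose s := Num.min (Num.min 1 (s1 / 2)) (eps / 2 / C).
exists s; first by rewrite !lt_min ltr01 !divr_gt0//= !ge_min lexx.
move=> e k /andP[e0 es] /andP[k0 ks] x.
have [e1 _] : e <= 1 /\ e <= s1 / 2.
  by move: es; rewrite !le_min => /andP[/andP[]].
have eC : e * C <= eps / 2 by rewrite -ler_pdivlMr//; move: es; rewrite le_min => /andP[].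
have kS : S k <= eps / 2.
  have Sk : 0 <= S k by exact: sumr_ge0.
  have := hs1 k; rewrite /= !sub0r !normrN (ger0_norm k0) (ger0_norm Sk); apply.
  move: ks; rewrite !le_min => /andP[/andP[_ k1] _].
  by rewrite (le_lt_trans k1)// ltr_pdivrMr// ltr_pMr// ltr1n.
have -> : heat Q k (mix e nu) x - nu x = (1 - e) * (heat Q k nu x - nu x) + e * (1 - nu x).
  by rewrite heat_mix; move: (heat _ _ _ _) (nu x) => a b; ring.
have term (F : X -> R) : (forall y, 0 <= F y) -> F x <= \sum_y F y.
  by move=> F0; rewrite (bigD1 x)//= lerDl sumr_ge0.
rewrite [leRHS](splitr eps); apply: (le_trans (ler_normD _ _)); apply: lerD.
  rewrite normrM ger0_norm ?subr_ge0//; apply: le_trans kS.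
  apply: (@le_trans _ _ `|heat Q k nu x - nu x|); last first.
    exact: (term (fun y => `|heat Q k nu y - nu y|)).
  by rewrite ler_piMl// gerBl.
rewrite normrM ger0_norm//; apply: le_trans eC; apply: ler_wpM2l => //.
by rewrite /C (le_trans (term (fun y => `|1 - nu y|) _))// lerDl.
Qed.

Variable kappa : R.
Hypothesis kappa_ge0 : 0 <= kappa.
Hypothesis hess : forall rho psi : X -> R, (forall x, 0 < rho x) ->
  kappa * metric_form Q pi rho psi <= hessian Q pi rho psi.

Lemma entropy_convex rho0 rho1 nu t D : density pi rho0 -> density pi rho1 ->
  density pi nu -> 0 < t < 1 -> Wsq rho0 rho1 = D%:E ->
  Wsq rho0 nu = (t ^+ 2 * D)%:E -> Wsq nu rho1 = ((1 - t) ^+ 2 * D)%:E ->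
  H nu <= (1 - t) * H rho0 + t * H rho1 - kappa / 2 * t * (1 - t) * D.
Proof.
move=> d0 d1 dn /andP[t0 t1] WD W0 W1.
have u0 : 0 < 1 - t by rewrite subr_gt0.
have D0 : 0 <= D by rewrite -lee_fin -WD Wsq_ge0.
pose K := evolution_error pi kappa.
(* a is the sum of the time-change factors of the two halves and multiplies all error terms; [M]
   combines the entropy differences with the same factors. *)
pose a := t^-1 + (1 - t)^-1.
have a0 : 0 <= a by rewrite addr_ge0// invr_ge0 ltW.
pose M d := (H rho0 - (H nu - d)) / t + (H rho1 - (H nu - d)) / (1 - t).
(* The halves have squared lengths t^2 D and (1 - t)^2 D; run in times t and 1 - t they contribute
   exactly D, which is where the geodesic property enters. *)
have key1 d : 0 < d -> exists2 h0, 0 < h0 <= 1 & forall h, 0 < h -> h <= h0 ->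
    (1 + kappa * h) * D <= D + 2 * h * M d + K * a * h ^+ 2.
  move=> dp; have [eps eps0 lsc] := entropy_lsc pi_gt0 pi_sum dn dp.
  have [s /andP[s0 s1] near] := heat_mix_near nu eps0.
  exists s; first by rewrite s0.
  move=> h h0 hs; have h1 : 0 < h <= 1 by rewrite h0 (le_trans hs).
  have p0 : 0 < 1 + kappa * h by rewrite ltr_pwDl// mulr_ge0// ltW.
  pose C0 := 4 * speed Q pi (fun=> 1) (fun x => 1 - rho0 x).
  pose C1 := 4 * speed Q pi (fun=> 1) (fun x => 1 - rho1 x).
  rewrite mulrC -ler_pdivlMr//.
  pose B := (1 + kappa * h)^-1.
  apply: (@le_of_linear _ _ _ (2 * D + C0 + C1 + a) (Num.min (2^-1) s)).
    by rewrite lt_min invr_gt0 ltr0n.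
  move=> z z0; rewrite le_min => /andP[z2 zs].
  have z1 : z < 1 by rewrite (le_lt_trans z2)// invf_lt1 ?ltr1n.
  (* A bridge to the mixed density has energy 4 e times a constant, so with e = z^2 it costs O(z)
     when run in time z. *)
  pose e := z ^+ 2.
  have e0 : 0 < e by rewrite exprn_gt0.
  have ez : e <= z by rewrite /e expr2 ler_piMl// ltW.
  have e1 : 0 < e <= 1 by rewrite e0 (le_trans ez (ltW z1)).
  have es : 0 <= e <= s by rewrite (ltW e0) (le_trans ez).
  have Hm k : k \in `[0, h] -> H nu - d <= H (heat Q k (mix e nu)).
    rewrite in_itv/= => /andP[k0 kh]; apply: lsc.
      apply: (heat_density hQ) => //; apply: (mix_density hQ) => //.
      by rewrite (ltW e0); have /andP[] := e1.
    by move=> x; apply: near => //; rewrite k0 (le_trans kh).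
  have r0 := reach_heat hQ kappa_ge0 hess e1 h1 d0 dn (Wsq_reach hQ e1 e0 W0) Hm.
  have r1 := reach_heat hQ kappa_ge0 hess e1 h1 d1 dn
    (reach_sym hQ (Wsq_reach hQ e1 e0 W1)) Hm.
  have t01 : 0 < t < 1 by rewrite t0.
  have r := reach_weaken (ltW e0) (reach_cat hQ t01 r0 (reach_sym hQ r1)).
  have b0 := reach_mix hQ e1 d0; have b1 := reach_sym hQ (reach_mix hQ e1 d1).
  have z01 : 0 < z < 1 by rewrite z0.
  have y01 : 0 < 1 - z < 1 by rewrite subr_gt0 z1 gtrBl.
  have := Wsq_le_reach hQ (reach_cat hQ y01 (reach_cat hQ z01 b0 r) b1).
  rewrite WD lee_fin -/K => {r0 r1 r b0 b1 Hm} hD.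
  have o0 (x : X) : 0 < (fun=> 1 : R) x by [].
  have mass rho : density pi rho -> \sum_x (1 - rho x) * pi x = 0.
    move=> [_ r1]; under eq_bigr do rewrite mulrBl mul1r.
    by rewrite sumrB pi_sum r1 subrr.
  have C00 : 0 <= C0 by rewrite mulr_ge0// (speed_ge0 hQ o0)// mass.
  have C10 : 0 <= C1 by rewrite mulr_ge0// (speed_ge0 hQ o0)// mass.
  rewrite [_ / _]mulrC; apply: boundary_layer_le => //.
    by rewrite invr_ge0 (ltW p0)/= invf_le1// lerDl mulr_ge0// ltW.
  apply: le_trans hD _; rewrite le_eqVlt; apply/orP; left; apply/eqP.
  rewrite /C0 /C1 /e /a /M -/B.
  move: (speed _ _ _ _) (speed _ _ _ _) (H rho0) (H rho1) (H nu) K B.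
  move=> S0 S1 E0 E1 En KK BB.
  field.
  by rewrite subKr !gt_eqF// subr_gt0.
(* D cancels in [key1]; the rest is divided by h, which then tends to 0. *)
have key2 d : 0 < d -> kappa * D <= 2 * M d.
  move=> dp; have [h0 /andP[h00 _] hh] := key1 d dp.
  apply: (@le_of_linear _ _ _ (K * a) h0) => // h hp hle.
  have := hh h hp hle; rewrite mulrDl mul1r -addrA lerD2l => le.
  rewrite -(ler_pM2l hp); move: le; move: (M d) (K) => m k.
  have -> : h * (kappa * D) = kappa * h * D by ring.
  by have -> : h * (2 * m + h * (k * a)) = 2 * h * m + k * a * h ^+ 2 by ring.
(* M d equals M 0 + d * a, and d tends to 0. *)
have key3 : kappa * D <= 2 * M 0.
  apply: (@le_of_linear _ _ _ (2 * a) 1) => // d dp _; apply: le_trans (key2 d dp) _.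
  rewrite le_eqVlt; apply/orP; left; apply/eqP; rewrite /M /a.
  by field; rewrite !gt_eqF.
have tu : 0 <= t * (1 - t) / 2 by rewrite !mulr_ge0// ?ltW ?invr_gt0.
have := ler_wpM2l tu key3.
have -> : t * (1 - t) / 2 * (2 * M 0) = (1 - t) * (H rho0 - H nu) + t * (H rho1 - H nu).
  by rewrite /M; field; rewrite !gt_eqF.
have -> : t * (1 - t) / 2 * (kappa * D) = kappa / 2 * t * (1 - t) * D by field.
move: (kappa / 2 * t * (1 - t) * D) (H rho0) (H rho1) (H nu) => q E0 E1 En.
rewrite !mulrBr !mulrBl !mul1r; move: (t * E0) (t * E1) (t * En) => *; lra.
Qed.

Lemma Wsq_geodesic rho0 rho1 mu nu k D : Wsq rho0 rho1 = D%:E ->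
  Wdist Q pi mu nu = (`|k|%:E * Wdist Q pi rho0 rho1)%E -> Wsq mu nu = (k ^+ 2 * D)%:E.
Proof.
move=> WD W; have D0 : 0 <= D by rewrite -lee_fin -WD Wsq_ge0.
have W2 (a b : X -> R) : Wsq a b = (Wdist Q pi a b ^+ 2)%E by rewrite sqr_sqrte// Wsq_ge0.
have S : Wdist Q pi rho0 rho1 = (Num.sqrt D)%:E by rewrite /Wdist -/(Wsq rho0 rho1) WD.
rewrite W2 W S -EFinM -EFin_expe exprMn.
by rewrite sqr_sqrtr// real_normK// num_real.
Qed.

Lemma Ric_ge_of_hessian : Ric_ge Q pi kappa.
Proof.
move=> rho [dens geo] t t01.
have i0 : (0 : R) \in `[0, 1] by rewrite in_itv/= lexx ler01.
have i1 : (1 : R) \in `[0, 1] by rewrite in_itv/= lexx ler01.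
have W2 : (Wdist Q pi (rho 0%R) (rho 1%R) ^+ 2)%E = Wsq (rho 0) (rho 1).
  by rewrite sqr_sqrte// Wsq_ge0.
have WD := fineK (Wsq_fin hQ (dens _ i0) (dens _ i1)).
rewrite W2 -WD -EFinM -EFinB lee_fin; move/esym: WD; move: (fine _) => D WD.
move: (t01); rewrite in_itv/= => /andP[].
rewrite le_eqVlt => /predU1P[<- _|t0].
  by rewrite subr0 mul1r mul0r addr0 mulr0 !mul0r subr0.
rewrite le_eqVlt => /predU1P[->|t1].
  by rewrite subrr mul0r mul1r add0r mulr0 !mul0r subr0.
apply: (entropy_convex (dens _ i0) (dens _ i1) (dens _ t01) _ WD); first by rewrite t0.
  apply: Wsq_geodesic WD _; rewrite (geo 0 t i0 t01) sub0r normrN.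
  by [].
by apply: Wsq_geodesic WD _; rewrite (geo t 1 t01 i1) distrC.
Qed.

End DisplacementConvexity.

Theorem theorem3p9 (R : realType) (X : finType)
    (Q : X -> X -> R) (pi : X -> R)
    (G : {set {ffun X -> X}}) (c : X -> {ffun X -> X} -> R)
    (hQ : markov_triple Q pi)
    (hG : mapping_representation Q pi G c)
    (hcomm : commutative_moves G)
    (hlam : 0 <= min_curvature pi G c G) :
  Ric_ge Q pi (2 * min_curvature pi G c G) /\
  (forall H1 H2 : {set {ffun X -> X}},
     H1 \subset G -> H2 \subset G ->
     H1 :&: H2 = finset.set0 ->
     H1 :|: [set move_inv G c d | d in H1]%SET = G ->
     H2 :|: [set move_inv G c d | d in H2]%SET = G ->
     Ric_ge Q pi (2^-1 * (min_curvature pi G c H1 + min_curvature pi G c H2))).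
Proof.
split=> [|H1 H2 s1 s2 dis cov1 cov2]; apply: (Ric_ge_of_hessian hQ).
- by rewrite mulr_ge0.
- by move=> rho psi rho0; apply: hessian_ge_min_curvature.
- by rewrite mulr_ge0// addr_ge0//; apply: min_curvature_ge0.
- by move=> rho psi rho0; apply: hessian_ge_min_curvature2.
Qed.
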